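(* Let $Q_-(z)\,dz^2$ and $Q_+(z)\,dz^2$ be quadratic differentials on $\overline{\mathbb{C}}$ of symmetric form (as defined in the context) which are coordinated on $\mathbb{T}$, with fixed enumerations of the arcs $\alpha_j^-$, $\alpha_j^+$. Then, for any given sets of representatives $w_j^-$ and $w_j^+$, a quadratic differential $Q(\zeta)\,d\zeta^2$ on $\overline{\mathbb{C}}$ and a Jordan curve $\Gamma$ such that (i) $\Gamma$ consists of (a finite number of) arcs of trajectories and/or orthogonal trajectories of $Q(\zeta)\,d\zeta^2$ (and their endpoints), (ii) $Q_-(z)\,dz^2$ and $Q_+(z)\,dz^2$ are the pullbacks of $Q(\zeta)\,d\zeta^2$ under mappings $\varphi_-$ and $\varphi_+$ associated with $\Gamma$, and (iii) $\varphi_-$, $\varphi_+$ realize the welding determined by the representatives $w_j^-$, $w_j^+$, are defined uniquely up to a Möbius transformation. That is, if $(Q_1(\zeta)\,d\zeta^2,\Gamma_1)$ and $(Q_2(\zeta)\,d\zeta^2,\Gamma_2)$ are two such pairs for the same representatives, then there is a Möbius transformation $M$ with $M(\Gamma_1)=\Gamma_2$ and $Q_1(\zeta)\,d\zeta^2=Q_2(M(\zeta))(M'(\zeta))^2\,d\zeta^2$.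
   Context: $\mathbb{D}=\{|z|<1\}$, $\mathbb{T}=\partial\mathbb{D}$, $\mathbb{D}_+=\overline{\mathbb{C}}\setminus\overline{\mathbb{D}}$. For a Jordan curve $\Gamma\subset\mathbb{C}$, $\Omega_-$ and $\Omega_+$ are the bounded and unbounded components of $\overline{\mathbb{C}}\setminus\Gamma$. The mappings associated with $\Gamma$ are conformal bijections $\varphi_-:\mathbb{D}\to\Omega_-$ and $\varphi_+:\mathbb{D}_+\to\Omega_+$, with $\varphi_+(\infty)=\infty$, $\varphi_+'(\infty)=\lim_{z\to\infty}\varphi_+(z)/z>0$; they extend to homeomorphisms of the closures. Quadratic differentials: forms $Q(z)\,dz^2$ with $Q$ meromorphic (rational if defined on $\overline{\mathbb{C}}$), with pullback under a conformal map $\varphi$ equal to $Q(\varphi(z))(\varphi'(z))^2\,dz^2$ (at $\infty$ use the coordinate $1/z$). In (ii), $Q_-$ is the pullback in $\mathbb{D}$ and $Q_+$ is the pullback in $\mathbb{D}_+$. Zeros and simple poles are finite critical points; poles of order $\ge2$ are infinite critical points. A trajectory (respectively orthogonal trajectory) is a closed analytic Jordan curve or maximal open analytic arc along which $Q(z)\,dz^2>0$ (respectively $<0$); a whole trajectory or orthogonal trajectory also counts as an arc. The $Q$-length of an arc $\gamma$ is $|\gamma|_Q=\int_\gamma|Q(z)|^{1/2}\,|dz|$. Symmetric form: for each sign, $Q_\pm(z)\,dz^2=C_\pm\frac{P_\pm^0(z)B_\pm^0(z)}{P_\pm^\infty(z)B_\pm^\infty(z)}\,dz^2$ with $C_\pm$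 a nonzero real constant and $B_\pm^0(z)=\prod_{k=1}^{n_0^\pm}(z-c_k)(1-\overline{c}_kz)$, $B_\pm^\infty(z)=\prod_{k=1}^{n_\infty^\pm}(z-p_k)(1-\overline{p}_kz)$, $P_\pm^0(z)=\prod_{k=1}^{m_0^\pm}e^{-i(\pi+\alpha_k)/2}(z-e^{i\alpha_k})$, $P_\pm^\infty(z)=\prod_{k=1}^{m_\infty^\pm}e^{-i(\pi+\beta_k)/2}(z-e^{i\beta_k})$, where $c_k$, $p_k\in\mathbb{D}$ are the zeros and poles of $Q_\pm(z)\,dz^2$ in $\mathbb{D}$ and $e^{i\alpha_k}$, $e^{i\beta_k}$ are its zeros and poles on $\mathbb{T}$ (with multiplicity; zeros are distinct from poles; the data depend on the sign), and $2n_\infty^\pm+m_\infty^\pm-2n_0^\pm-m_0^\pm=4$. Then $Q_\pm(z)\,dz^2$ is real along $\mathbb{T}$. Arcs: $\mathbb{T}$ consists (up to finitely many points) of maximal open arcs $\alpha_1^-,\ldots,\alpha_{k_-}^-$, enumerated counterclockwise, such that for each $j$ either $Q_-(z)\,dz^2\ge0$ on all of $\alpha_j^-$ or $Q_-(z)\,dz^2\le0$ on all of $\alpha_j^-$ (maximal: the inequality fails on any larger arc; the arcs contain no poles but may contain zeros of even order; the case $k_-=1$, $\alpha_1^-=\mathbb{T}$ is allowed). Let $z_j^-$ be the initial point of $\alpha_j^-$, with $\alpha_{k_-+1}^-=\alpha_1^-$, $z_{k_-+1}^-=z_1^-$ (no such points if $\alpha_1^-=\mathbb{T}$). Define $\alpha_j^+$,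 $z_j^+$, $1\le j\le k_+$, similarly for $Q_+(z)\,dz^2$. $Q_-(z)\,dz^2$ and $Q_+(z)\,dz^2$ are coordinated on $\mathbb{T}$ if $k_-=k_+=k\ge1$ and the arcs can be enumerated in the counterclockwise direction so that: (a) $Q_-(z)\,dz^2\ge0$ on $\alpha_j^-$ if and only if $Q_+(z)\,dz^2\ge0$ on $\alpha_j^+$; (b) $z_j^-$ is an infinite critical point of $Q_-(z)\,dz^2$ if and only if $z_j^+$ is an infinite critical point of $Q_+(z)\,dz^2$; (c) if $|\alpha_j^-|_{Q_-}$ is finite then $|\alpha_j^+|_{Q_+}$ is also finite and $|\alpha_j^-|_{Q_-}=|\alpha_j^+|_{Q_+}$. Fix such an enumeration. Representatives: $w_j^-=z_j^-$, $w_j^+=z_j^+$ if $z_j^-$ is a finite critical point; $w_j^-=z_{j+1}^-$, $w_j^+=z_{j+1}^+$ if $z_j^-$ is an infinite critical point but $z_{j+1}^-$ is a finite critical point; if both $z_j^-$ and $z_{j+1}^-$ are infinite critical points, $w_j^-\in\alpha_j^-$ and $w_j^+\in\alpha_j^+$ are arbitrary points; if $\alpha_1^-=\mathbb{T}$, $w_1^-$, $w_1^+$ are arbitrary points of $\mathbb{T}$. Welding determined by the representatives: the identification of points of $\mathbb{T}=\partial\mathbb{D}$ with points of $\mathbb{T}=\partial\mathbb{D}_+$ under which $z_j^-$ is identified with $z_j^+$, $w_j^-$ with $w_j^+$, and $z_-\in\alpha_j^-$ with $z_+\in\alpha_j^+$ if either $z_\pm$ lies on the counterclockwise arc from $z_j^\pm$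 to $w_j^\pm$ and the subarcs from $z_-$ to $w_j^-$ and from $z_+$ to $w_j^+$ have equal $Q_-$-length and $Q_+$-length respectively, or $z_\pm$ lies on the counterclockwise arc from $w_j^\pm$ to $z_{j+1}^\pm$ and the subarcs from $w_j^-$ to $z_-$ and from $w_j^+$ to $z_+$ have equal $Q_-$-length and $Q_+$-length respectively. (If $\alpha_1^-=\mathbb{T}$: $w_1^-$ is identified with $w_1^+$ and $z_-$ with $z_+$ if the counterclockwise arcs from $w_1^-$ to $z_-$ and from $w_1^+$ to $z_+$ have equal $Q_-$-length and $Q_+$-length respectively.) The mappings $\varphi_-$, $\varphi_+$ realize this welding if $\varphi_-(z_-)=\varphi_+(z_+)$ whenever $z_-$ and $z_+$ are identified. *)

(* Defs.v *)
From HB Require Import structures.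
From mathcomp Require Import all_boot all_order all_algebra.
From mathcomp Require Import complex.
From mathcomp Require Import all_classical all_reals all_analysis.

Set Implicit Arguments.
Unset Strict Implicit.
Unset Printing Implicit Defensive.

Import Order.TTheory GRing.Theory Num.Theory numFieldNormedType.Exports.

Local Open Scope classical_set_scope.
Local Open Scope ring_scope.

(* The topology and normed-module structure of R[i] over itself, copied from
   the regular module as the library does for abstract numFieldTypes; with it,
   `derivable f z 1` and `derive1 f` are complex differentiation. *)
#[non_forgetful_inheritance]
HB.instance Definition _ (R : realType) := GRing.ComAlgebra.copy R[i] R[i]^o.
#[non_forgetful_inheritance]
HB.instance Definition _ (R : realType) := Vector.copy R[i] R[i]^o.
#[non_forgetful_inheritance]
HB.instance Definition _ (R : realType) := NormedModule.copy R[i] R[i]^o.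

Definition disc (R : realType) : set R[i] := [set z | `|z| < 1].
Definition cdisc (R : realType) : set R[i] := [set z | `|z| <= 1].
Definition circle (R : realType) : set R[i] := [set z | `|z| = 1].

(* The finite points of the outer disc and of its closure. *)
Definition outer (R : realType) : set R[i] := [set z | 1 < `|z|].
Definition couter (R : realType) : set R[i] := [set z | 1 <= `|z|].

Arguments disc : clear implicits.
Arguments cdisc : clear implicits.
Arguments circle : clear implicits.
Arguments outer : clear implicits.
Arguments couter : clear implicits.

Definition expi (R : realType) (t : R) : R[i] := (cos t +i* sin t)%C.

(* The Riemann sphere, None being the point at infinity. *)
Definition sphere (R : realType) : Type := one_point_compactification R[i].

Definition of_plane (R : realType) (z : R[i]) : sphere R := Some z.

(* The point of the sphere whose coordinate 1/z is w. *)
Definition of_inv_coord (R : realType) (w : R[i]) : sphere R :=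
  if w == 0 then None else Some w^-1.

Definition mobius (R : realType) (a b c d : R[i]) (p : sphere R) : sphere R :=
  match p with
  | Some z =>
      if c * z + d == 0 then None else Some ((a * z + b) / (c * z + d))
  | None => if c == 0 then None else Some (a / c)
  end.

(* Q(z) dz^2 with Q = qnum / qden in lowest terms. *)
Record qdiff (R : realType) := QDiff {
  qnum : {poly R[i]};
  qden : {poly R[i]};
  qden_neq0 : qden != 0;
  q_coprime : coprimep qnum qden }.

(* As x / 0 = 0, this is 0 at the poles. *)
Definition qeval (R : realType) (Q : qdiff R) (z : R[i]) : R[i] :=
  (qnum Q).[z] / (qden Q).[z].

Definition pole (R : realType) (Q : qdiff R) (z : R[i]) : bool :=
  root (qden Q) z.

(* In the coordinate w = 1/z the differential is Q(1/w) w^{-4} dw^2.  This is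
   the value of its coefficient at w = 0 when that value is finite and nonzero,
   and 0 otherwise. *)
Definition qeval_infty (R : realType) (Q : qdiff R) : R[i] :=
  if size (qden Q) == (size (qnum Q) + 4)%N
  then lead_coef (qnum Q) / lead_coef (qden Q) else 0.

Definition finite_critical (R : realType) (Q : qdiff R) (z : R[i]) : bool :=
  root (qnum Q) z || (mup z (qden Q) == 1)%N.

Definition infinite_critical (R : realType) (Q : qdiff R) (z : R[i]) : bool :=
  (2 <= mup z (qden Q))%N.

(* P(z) dz^2 = Q(phi(z)) phi'(z)^2 dz^2 on U, as meromorphic differentials. *)
Definition is_pullback (R : realType) (U : set R[i]) (phi : R[i] -> R[i])
    (Q P : qdiff R) : Prop :=
  forall z, U z ->
    pole P z = pole Q (phi z) /\
    (~~ pole P z -> qeval P z = qeval Q (phi z) * (derive1 phi z) ^+ 2).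

(* Below, the boolean s selects trajectories (false, Q dz^2 > 0) or orthogonal
   trajectories (true, Q dz^2 < 0). *)

(* Near t the curve g is a regular analytic curve in the sphere, that is, in
   the coordinate z or, at infinity, in the coordinate 1/z, it is the
   restriction to the real line of a holomorphic f; and Q dz^2 has the sign
   selected by s on its tangent vector at t.  The strict inequalities exclude
   critical points and force f'(t) to be nonzero. *)
Definition runs_along (R : realType) (Q : qdiff R) (s : bool)
    (g : R -> sphere R) (t : R) : Prop :=
  exists2 f : R[i] -> R[i], (\forall z \near t%:C%C, derivable f z 1) &
    ((\forall u \near t, g u = of_plane (f u%:C%C)) /\
      0 < (-1) ^+ s * (qeval Q (f t%:C%C) * (derive1 f t%:C%C) ^+ 2))
    \/ [/\ \forall u \near t, g u = of_inv_coord (f u%:C%C),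
          f t%:C%C = 0 &
          0 < (-1) ^+ s * (qeval_infty Q * (derive1 f t%:C%C) ^+ 2)].

Definition open_arc_along (R : realType) (Q : qdiff R) (s : bool)
    (S : set (sphere R)) : Prop :=
  exists g : R -> sphere R,
    [/\ forall t, runs_along Q s g t, injective g & S = range g].

Definition closed_curve_along (R : realType) (Q : qdiff R) (s : bool)
    (S : set (sphere R)) : Prop :=
  exists g : R -> sphere R,
    [/\ forall t, runs_along Q s g t,
        forall t u, g t = g u <-> exists n : int, u = t + n%:~R
      & S = range g].

Definition curve_along (R : realType) (Q : qdiff R) (s : bool)
    (S : set (sphere R)) : Prop :=
  open_arc_along Q s S \/ closed_curve_along Q s S.

Definition is_trajectory (R : realType) (Q : qdiff R) (s : bool)
    (S : set (sphere R)) : Prop :=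
  curve_along Q s S /\
  forall S', curve_along Q s S' -> S `<=` S' -> S' = S.

(* A subarc of a trajectory, or a whole one (possibly a closed curve). *)
Definition is_trajectory_arc (R : realType) (Q : qdiff R) (s : bool)
    (A : set (sphere R)) : Prop :=
  curve_along Q s A /\ exists2 S, is_trajectory Q s S & A `<=` S.

(* The closure adds to each (open) arc its endpoints. *)
Definition consists_of_trajectory_arcs (R : realType) (Q : qdiff R)
    (G : set R[i]) : Prop :=
  exists (n : nat) (A : nat -> set R[i]),
    (forall i, (i < n)%N ->
       exists s, is_trajectory_arc Q s (@of_plane R @` A i)) /\
    G = \bigcup_(i in [set i | (i < n)%N]) closure (A i).

Definition jordan_curve (R : realType) (G : set R[i]) : Prop :=
  exists g : R[i] -> R[i],
    [/\ {within circle R, continuous g}, set_inj (circle R) g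
      & G = g @` circle R].

(* By the Jordan curve theorem the complement of G in the plane has exactly one
   bounded and one unbounded component; they are the sets below.  The point at
   infinity, which belongs to the unbounded component in the sphere, is left
   out of outside G. *)
Definition inside (R : realType) (G : set R[i]) : set R[i] :=
  [set z | ~ G z /\ bounded_set (connected_component (~` G) z)].

Definition outside (R : realType) (G : set R[i]) : set R[i] :=
  [set z | ~ G z /\ ~ bounded_set (connected_component (~` G) z)].

Definition homeomorphism_on (R : realType) (A B : set R[i])
    (f : R[i] -> R[i]) : Prop :=
  [/\ set_bij A B f, {within A, continuous f} &
    exists2 g : R[i] -> R[i],
      {within B, continuous g} & forall z, A z -> g (f z) = z].

Definition conformal_bijection (R : realType) (A B : set R[i])
    (f : R[i] -> R[i]) : Prop :=
  set_bij A B f /\ forall z, A z -> derivable f z 1.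

(* phim and phip stand for the extensions to the closures.  phip is given on
   finite points only, its value at infinity being infinity; with w = 1/z, the
   limit says that phip(z)/z tends to c > 0 as z tends to infinity, which
   includes the continuity and the conformality of phip at infinity. *)
Definition associated_mappings (R : realType) (G : set R[i])
    (phim phip : R[i] -> R[i]) : Prop :=
  [/\ conformal_bijection (disc R) (inside G) phim,
      homeomorphism_on (cdisc R) (closure (inside G)) phim,
      conformal_bijection (outer R) (outside G) phip,
      homeomorphism_on (couter R) (closure (outside G)) phip
    & exists2 c : R[i], 0 < c & (fun w => w * phip w^-1) @ 0^' --> c].

(* For z on the circle, (z - c)(1 - c^* z) / z = |z - c|^2 and the factors
   e^{-i(pi+t)/2} (z - e^{it}) / z^{1/2} are real. *)
Definition symB (R : realType) (cs : seq R[i]) : {poly R[i]} :=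
  \prod_(c <- cs) (('X - c%:P) * (1 - (c^*)%C *: 'X)).

Definition symP (R : realType) (ts : seq R) : {poly R[i]} :=
  \prod_(t <- ts) (expi (- (pi + t) / 2) *: ('X - (expi t)%:P)).

Definition has_symmetric_form (R : realType) (Q : qdiff R) : Prop :=
  exists (K : R) (cs ps : seq R[i]) (alphas betas : seq R),
    [/\ K != 0,
        (forall c, c \in cs -> disc R c) /\ (forall p, p \in ps -> disc R p),
        (forall c, c \in cs -> c \notin ps) /\
        (forall a b, a \in alphas -> b \in betas -> expi a != expi b),
        (2 * size ps + size betas = 2 * size cs + size alphas + 4)%N
      & qnum Q * (symP betas * symB ps)
        = K%:C%C *: (symP alphas * symB cs) * qden Q].

(* For z on the circle, Q(z) dz^2 / dt^2 where z = e^{it}, dz = i z dt. *)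
Definition along_circle (R : realType) (Q : qdiff R) (z : R[i]) : R[i] :=
  - (qeval Q z * z ^+ 2).

Definition circle_arc (R : realType) (a b : R) : set R[i] :=
  [set expi t | t in `]a, b[].

Definition is_open_arc (R : realType) (A : set R[i]) : Prop :=
  A = circle R \/
  exists a b : R, [/\ a < b, b <= a + 2 * pi & A = circle_arc a b].

Definition nonneg_on (R : realType) (Q : qdiff R) (A : set R[i]) : Prop :=
  forall z, A z -> 0 <= along_circle Q z.

Definition nonpos_on (R : realType) (Q : qdiff R) (A : set R[i]) : Prop :=
  forall z, A z -> along_circle Q z <= 0.

Definition signed_arc (R : realType) (Q : qdiff R) (A : set R[i]) : Prop :=
  [/\ is_open_arc A, forall z, A z -> ~~ pole Q z
    & nonneg_on Q A \/ nonpos_on Q A].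

Definition max_signed_arc (R : realType) (Q : qdiff R) (A : set R[i]) : Prop :=
  signed_arc Q A /\ forall A', signed_arc Q A' -> A `<=` A' -> A' = A.

(* The Q-length of the arc e^{it}, a < t < b, on which |dz| = dt. *)
Definition qlength (R : realType) (Q : qdiff R) (a b : R) : \bar R :=
  \int[lebesgue_measure]_(t in `]a, b[)
    (Num.sqrt (complex.Re `|qeval Q (expi t)|))%:E.

(* A counterclockwise enumeration of the maximal arcs: either the whole circle
   is the only arc, or Arcs k z, with indices running from 0 to k - 1, where
   the j-th arc goes from the angle z j to the angle z j.+1.  Thus the initial
   points are e^{i z 0}, ..., e^{i z (k-1)}, and z k is z 0 after a full
   turn. *)
Inductive arc_enum (R : realType) :=
  | WholeCircle
  | Arcs of nat & (nat -> R).
Arguments WholeCircle {R}.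

Definition enumerates (R : realType) (Q : qdiff R) (E : arc_enum R) : Prop :=
  match E with
  | WholeCircle => max_signed_arc Q (circle R)
  | Arcs k z =>
      [/\ (0 < k)%N, z k = z 0%N + 2 * pi
        & forall j, (j < k)%N ->
            z j < z j.+1 /\ max_signed_arc Q (circle_arc (z j) (z j.+1))]
  end.

(* When just one of the two enumerations is the whole circle, the other one has
   an arc whose endpoints have no counterpart, so that the differentials are not
   coordinated. *)
Definition coordinated (R : realType) (Qm Qp : qdiff R)
    (Em Ep : arc_enum R) : Prop :=
  match Em, Ep with
  | WholeCircle, WholeCircle =>
      (nonneg_on Qm (circle R) <-> nonneg_on Qp (circle R)) /\
      (qlength Qm 0 (2 * pi) \is a fin_num ->
       qlength Qp 0 (2 * pi) \is a fin_num /\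
       qlength Qm 0 (2 * pi) = qlength Qp 0 (2 * pi))
  | Arcs km zm, Arcs kp zp =>
      km = kp /\
      forall j, (j < km)%N ->
        [/\ nonneg_on Qm (circle_arc (zm j) (zm j.+1)) <->
            nonneg_on Qp (circle_arc (zp j) (zp j.+1)),
            infinite_critical Qm (expi (zm j)) =
            infinite_critical Qp (expi (zp j))
          & qlength Qm (zm j) (zm j.+1) \is a fin_num ->
            qlength Qp (zp j) (zp j.+1) \is a fin_num /\
            qlength Qm (zm j) (zm j.+1) = qlength Qp (zp j) (zp j.+1)]
  | _, _ => False
  end.

(* wm and wp list the angles of the representatives, chosen in the closed
   interval of angles of the arc.  In the case of the whole circle wm 0 and
   wp 0 are the only representatives, and they are arbitrary. *)
Definition representatives (R : realType) (Qm : qdiff R)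
    (Em Ep : arc_enum R) (wm wp : nat -> R) : Prop :=
  match Em, Ep with
  | Arcs k zm, Arcs _ zp =>
      forall j, (j < k)%N ->
        [/\ finite_critical Qm (expi (zm j)) ->
              wm j = zm j /\ wp j = zp j,
            infinite_critical Qm (expi (zm j)) ->
              finite_critical Qm (expi (zm j.+1)) ->
              wm j = zm j.+1 /\ wp j = zp j.+1
          & infinite_critical Qm (expi (zm j)) ->
              infinite_critical Qm (expi (zm j.+1)) ->
              zm j < wm j < zm j.+1 /\ zp j < wp j < zp j.+1]
  | _, _ => True
  end.

(* The points e^{is} of the boundary of the disc and e^{it} of the boundary of
   the outer disc are identified. *)
Definition identified_angles (R : realType) (Qm Qp : qdiff R)
    (Em Ep : arc_enum R) (wm wp : nat -> R) (s t : R) : Prop :=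
  match Em, Ep with
  | WholeCircle, WholeCircle =>
      (s = wm 0%N /\ t = wp 0%N) \/
      [/\ wm 0%N < s < wm 0%N + 2 * pi, wp 0%N < t < wp 0%N + 2 * pi
        & qlength Qm (wm 0%N) s = qlength Qp (wp 0%N) t]
  | Arcs k zm, Arcs _ zp =>
      exists2 j, (j < k)%N &
        [\/ s = zm j /\ t = zp j,
            s = wm j /\ t = wp j,
            [/\ zm j < s <= wm j, zp j < t <= wp j
              & qlength Qm s (wm j) = qlength Qp t (wp j)]
          | [/\ wm j <= s < zm j.+1, wp j <= t < zp j.+1
              & qlength Qm (wm j) s = qlength Qp (wp j) t]]
  | _, _ => False
  end.

Definition realize_welding (R : realType) (Qm Qp : qdiff R)
    (Em Ep : arc_enum R) (wm wp : nat -> R) (phim phip : R[i] -> R[i]) : Prop :=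
  forall s t, identified_angles Qm Qp Em Ep wm wp s t ->
    phim (expi s) = phip (expi t).

Definition welding_pair (R : realType) (Qm Qp : qdiff R)
    (Em Ep : arc_enum R) (wm wp : nat -> R) (Q : qdiff R) (G : set R[i]) :
    Prop :=
  [/\ jordan_curve G, consists_of_trajectory_arcs Q G &
    exists phim phip : R[i] -> R[i],
      [/\ associated_mappings G phim phip,
          is_pullback (disc R) phim Q Qm,
          is_pullback (outer R) phip Q Qp
        & realize_welding Qm Qp Em Ep wm wp phim phip]].

(* Main.v *)
Require Import Defs.
From HB Require Import structures.
From mathcomp Require Import all_boot all_order all_algebra.
From mathcomp Require Import complex ring lra.
From mathcomp Require Import all_classical all_reals all_analysis.
From mathcomp Require Import measurable_realfun.
Import Order.TTheory GRing.Theory Num.Theory numFieldNormedType.Exports.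
Local Open Scope classical_set_scope.
Local Open Scope ring_scope.

Set Implicit Arguments.
Unset Strict Implicit.
Unset Printing Implicit Defensive.

(** Let phi_1 and phi_2 (with signs - and +) be the mappings associated with the
two curves.  The map F equal to phi_2 o phi_1^-1 on the closures of both
complementary regions of the first curve is well defined because each point of
the circle is identified with some point by the welding ([welding_total]), and
it is a continuous map of the plane with F(z) ~ a z at infinity, a > 0.  It has
to be shown that F is affine: then F carries one curve to the other, and Q1
agrees with the pullback of Q2 at infinitely many points, so everywhere.

That F is holomorphic across the curve follows from the pullback equations.
Near a point of the circle which is not critical, the equation
phi'^2 = Qm / Q(phi) shows that the square of phi' has a nonzero limit at the
boundary; Darboux's theorem fixes the sign of the square root in a convex
neighbourhood, so that phi has a nonzero derivative at the boundary point,
within the closed disc ([disc_derivative]).  So F has a derivative within the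
closure of each of the two regions, and at a point common to the closures the
two derivatives agree, because the point is not isolated among the common
points ([diff_within_cover]).  Hence F is complex differentiable off a finite
set E, where F'^2 = Q1 / Q2(F).  That the closures cover the plane is the fact
that a Jordan curve contains no disc ([jordan_curve_no_disc]).

It remains to prove a Liouville theorem for F.  Off E, the function F'
is a branch of the square root of a differentiable function, so F has
second-order Taylor expansions ([jet2_square_derivative]).  These suffice for a
maximum principle: at an interior maximum of |v|^2 + e |z|^2, averaging over
p + h, h = t, -t, it, -it, cancels the terms of degree one and two of v, and a
contradiction remains ([jet2_not_max]).  A finite set of singular points is
neutralised by passing from u to u^n prod (z - s) and letting n grow
([jet2_vanishing]).  Applied to u = (F(z) - F(z0)) / (z - z0) - a, which tends to
0 at infinity, this gives u = 0.

The surjectivity of the welding is a matter of lengths.  An endpoint of an arc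
is critical, since otherwise two adjacent arcs would merge
([junction_critical]); the density of the length behaves at most like
|t - a|^(-1/2) at a simple pole and at least like |t - a|^(-1) at a pole of higher
order, so lengths are finite at the former and infinite at the latter
([qlength_fin], [qlength_inf_left]); the intermediate value theorem gives the
partner of each point. *)


(** * Modulus and topology of the plane *)

Section Modulus.
Context (R : realType).
Implicit Types (z w : R[i]) (x : R).

(** The norm of [R[i]] takes values in [R[i]], which is only partially ordered; the
real-valued modulus makes linear arithmetic available. *)
Definition cabs z : R := complex.Re `|z|.

Lemma normE z : `|z| = (cabs z)%:C%C.
Proof. by rewrite /cabs normc_def. Qed.

Lemma cabs_ge0 z : 0 <= cabs z.
Proof. by rewrite -ler0c -normE. Qed.

Lemma cabs0 : cabs 0 = 0.
Proof. by apply: complexI; rewrite -normE normr0. Qed.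

Lemma cabs1 : cabs 1 = 1.
Proof. by apply: complexI; rewrite -normE normr1. Qed.

Lemma cabsN z : cabs (- z) = cabs z.
Proof. by apply: complexI; rewrite -!normE normrN. Qed.

Lemma cabsM z w : cabs (z * w) = cabs z * cabs w.
Proof. by apply: complexI; rewrite rmorphM/= -!normE normrM. Qed.

Lemma cabsX z n : cabs (z ^+ n) = cabs z ^+ n.
Proof. by apply: complexI; rewrite rmorphXn/= -!normE normrX. Qed.

Lemma cabsV z : cabs z^-1 = (cabs z)^-1.
Proof. by apply: complexI; rewrite fmorphV/= -!normE normfV. Qed.

Lemma cabs_distC z w : cabs (z - w) = cabs (w - z).
Proof. by rewrite -cabsN opprB. Qed.

Lemma cabs_eq0 z : (cabs z == 0) = (z == 0).
Proof. by rewrite -(inj_eq (@complexI R)) -normE normr_eq0. Qed.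

Lemma cabs_gt0 z : (0 < cabs z) = (z != 0).
Proof. by rewrite lt_def cabs_eq0 cabs_ge0 andbT. Qed.

Lemma cabsD z w : cabs (z + w) <= cabs z + cabs w.
Proof. by rewrite -lecR rmorphD/= -!normE ler_normD. Qed.

Lemma cabsB z w : cabs (z - w) <= cabs z + cabs w.
Proof. by rewrite -[cabs w]cabsN cabsD. Qed.

Lemma cabs_dist_le z w : cabs z - cabs w <= cabs (z - w).
Proof. by rewrite lerBlDr -{1}(subrK w z) cabsD. Qed.

Lemma cabs_real x : cabs x%:C%C = `|x|.
Proof. by rewrite /cabs normc_def /= expr0n addr0 sqrtr_sqr. Qed.

Lemma sqr_cabs z : cabs z ^+ 2 = complex.Re z ^+ 2 + complex.Im z ^+ 2.
Proof. by apply: complexI; rewrite rmorphXn /= -normE -add_Re2_Im2. Qed.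

Lemma Re_le_cabs z : `|complex.Re z| <= cabs z.
Proof. by rewrite -lecR -normE normc_ge_Re. Qed.

Lemma Im_le_cabs z : `|complex.Im z| <= cabs z.
Proof.
rewrite -(@ler_pXn2r _ 2) ?nnegrE ?cabs_ge0 // sqr_cabs real_normK ?num_real //.
by rewrite lerDr sqr_ge0.
Qed.

Lemma cabs_le_ReIm z : cabs z <= `|complex.Re z| + `|complex.Im z|.
Proof.
rewrite -(@ler_pXn2r _ 2) ?nnegrE ?cabs_ge0 ?addr_ge0 // sqr_cabs sqrrD.
rewrite !real_normK ?num_real // -addrA [X in _ <= _ + X]addrC addrA lerDl.
by rewrite mulrn_wge0 // mulr_ge0.
Qed.

Lemma ReM z w : complex.Re (z * w) =
  complex.Re z * complex.Re w - complex.Im z * complex.Im w.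
Proof. by case: z => a b; case: w. Qed.

Lemma ReD z w : complex.Re (z + w) = complex.Re z + complex.Re w.
Proof. by case: z => a b; case: w. Qed.

Lemma ImD z w : complex.Im (z + w) = complex.Im z + complex.Im w.
Proof. by case: z => a b; case: w. Qed.

Lemma ReN z : complex.Re (- z) = - complex.Re z.
Proof. by case: z. Qed.

Lemma Re_conjM z : complex.Re ((z^*)%C * z) = cabs z ^+ 2.
Proof. by rewrite sqr_cabs ReM; case: z => a b /=; ring. Qed.

Lemma cabs_conj z : cabs (z^*)%C = cabs z.
Proof. by apply: complexI; rewrite -!normE normcJ. Qed.

Lemma discE : disc R = [set z | cabs z < 1].
Proof. by apply/seteqP; split => z /=; rewrite /disc /= normE -ltcR. Qed.

Lemma cdiscE : cdisc R = [set z | cabs z <= 1].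
Proof. by apply/seteqP; split => z /=; rewrite /cdisc /= normE -lecR. Qed.

Lemma outerE : outer R = [set z | 1 < cabs z].
Proof. by apply/seteqP; split => z /=; rewrite /outer /= normE -ltcR. Qed.

Lemma couterE : couter R = [set z | 1 <= cabs z].
Proof. by apply/seteqP; split => z /=; rewrite /couter /= normE -lecR. Qed.

Lemma circleE : circle R = [set z | cabs z = 1].
Proof.
apply/seteqP; split => z /=; rewrite /circle /= normE; first by case.
by move=> ->.
Qed.

Lemma nbhs_cabsP z (A : set R[i]) :
  nbhs z A <-> exists2 d : R, 0 < d & forall w, cabs (w - z) < d -> A w.
Proof.
split.
  move/nbhs_ballP => [d /= d0 dA]; exists (complex.Re d).
    by move: d0; rewrite ltcE /= => /andP[].
  move=> w wz; apply: dA; rewrite -ball_normE /= distrC normE.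
  by move: d0; rewrite !ltcE /= => /andP[-> _].
move=> [d d0 dA]; apply/nbhs_ballP; exists d%:C%C => /=; first by rewrite ltcR.
by move=> w; rewrite -ball_normE /= distrC normE ltcR => /dA.
Qed.

Lemma open_cabsP (A : set R[i]) :
  open A <-> forall z, A z ->
    exists2 d : R, 0 < d & forall w, cabs (w - z) < d -> A w.
Proof.
rewrite openE; split=> [oA z /oA|oA z /oA] /=; first by move/nbhs_cabsP.
by move=> zA; apply/nbhs_cabsP.
Qed.

Lemma closureP (A : set R[i]) z :
  closure A z <-> forall d : R, 0 < d -> exists2 w, A w & cabs (w - z) < d.
Proof.
split=> [cA d d0|cA B /nbhs_cabsP[d d0 dB]].
  have [|w [Aw /= wz]] := cA [set w | cabs (w - z) < d].
    by apply/nbhs_cabsP; exists d.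
  by exists w.
by have [w Aw wz] := cA d d0; exists w; split => //; exact: dB.
Qed.

End Modulus.

(** * Continuity within a set *)

Section WithinContinuity.
Context (R : realType).
Implicit Types (z w p : R[i]) (A : set R[i]) (f g : R[i] -> R[i]).

Definition cont_within A f p := forall e : R, 0 < e ->
  exists2 d : R, 0 < d & forall z, A z -> cabs (z - p) < d ->
    cabs (f z - f p) < e.

Lemma cont_withinP A f p :
  cont_within A f p <-> f z @[z --> within A (nbhs p)] --> f p.
Proof.
split=> [cf B /nbhs_cabsP[e e0 eB]|cf e e0].
  have [d d0 dA] := cf _ e0.
  by apply/nbhs_cabsP; exists d => // z zp Az; apply: eB; exact: dA.
have : nbhs (f p) [set w | cabs (w - f p) < e] by apply/nbhs_cabsP; exists e.
by move/cf => /nbhs_cabsP[d d0 dA]; exists d => // z Az zd; exact: dA.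
Qed.

Lemma within_continuousP A f :
  {within A, continuous f} <-> forall p, A p -> cont_within A f p.
Proof.
rewrite (subspace_continuousP A f); split=> cf p Ap.
  by apply/cont_withinP; exact: cf.
by apply/cont_withinP; exact: cf.
Qed.

Lemma cont_within_sub A B f p : A `<=` B -> cont_within B f p -> cont_within A f p.
Proof.
by move=> AB cf e /cf[d d0 dB]; exists d => // z Az; apply: dB; exact: AB.
Qed.

Lemma cont_withinM A f g p : cont_within A f p -> cont_within A g p ->
  cont_within A (fun z => f z * g z) p.
Proof.
move=> /cont_withinP cf /cont_withinP cg; apply/cont_withinP.
have := @cvgM R[i] R[i] (within A (nbhs p)) _ f g (f p) (g p) cf cg; apply.
Qed.

Lemma cont_withinD A f g p : cont_within A f p -> cont_within A g p ->
  cont_within A (fun z => f z + g z) p.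
Proof.
move=> cf cg e e0.
have e20 : 0 < e / 2 by rewrite divr_gt0.
have [d1 d10 df] := cf _ e20; have [d2 d20 dg] := cg _ e20.
exists (Num.min d1 d2); first by rewrite lt_min d10.
move=> z Az; rewrite lt_min => /andP[/(df _ Az) fz /(dg _ Az) gz].
have -> : f z + g z - (f p + g p) = (f z - f p) + (g z - g p) by ring.
by have := cabsD (f z - f p) (g z - g p); lra.
Qed.

Lemma cont_withinV A f p : f p != 0 -> cont_within A f p ->
  cont_within A (fun z => (f z)^-1) p.
Proof.
move=> f0 /cont_withinP cf; apply/cont_withinP.
have := @cvgV R[i] R[i] (within A (nbhs p)) _ f (f p) f0 cf; apply.
Qed.

Lemma cont_within_cst A (c : R[i]) p : cont_within A (fun=> c) p.
Proof. by move=> e e0; exists 1 => // z _ _; rewrite subrr cabs0. Qed.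

Lemma cont_within_id A p : cont_within A id p.
Proof. by move=> e e0; exists e. Qed.

Lemma cont_within_comp A B f g p : (forall z, A z -> B (g z)) ->
  cont_within A g p -> cont_within B f (g p) -> cont_within A (fun z => f (g z)) p.
Proof.
move=> AB cg cf e /cf[d d0 df]; have [d' d'0 dg] := cg _ d0.
by exists d' => // z Az zp; apply: df; [exact: AB|exact: dg].
Qed.

Lemma cont_withinXn A f p n : cont_within A f p ->
  cont_within A (fun z => f z ^+ n) p.
Proof.
move=> cf; elim: n => [|n IH]; first exact: cont_within_cst.
have := cont_withinM cf IH.
by congr cont_within; apply/funext => z; rewrite exprS.
Qed.

Lemma cont_within_horner A (P : {poly R[i]}) p : cont_within A (horner P) p.
Proof.
elim/poly_ind: P => [|P c IH].
  have := @cont_within_cst A 0 p; congr cont_within.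
  by apply/funext => z; rewrite horner0.
have := cont_withinD (cont_withinM IH (cont_within_id A p)) (@cont_within_cst A c p).
by congr cont_within; apply/funext => z; rewrite hornerMXaddC.
Qed.

Lemma cont_within_qeval A (Q : qdiff R) p : ~~ pole Q p ->
  cont_within A (qeval Q) p.
Proof.
move=> np; apply: cont_withinM; first exact: cont_within_horner.
by apply: cont_withinV; [exact: np|exact: cont_within_horner].
Qed.

End WithinContinuity.

(** * Complex derivatives within a set *)

Section Differentiation.
Context (R : realType).
Implicit Types (z w p c : R[i]) (A : set R[i]) (f g : R[i] -> R[i]).

(** [c] is the complex derivative of [f] at [p] along [A].  With [A] the closed disc it
makes sense at boundary points, where conformal maps will be differentiated. *)
Definition diff_within A f p c := forall e : R, 0 < e ->
  exists2 d : R, 0 < d & forall z, A z -> cabs (z - p) < d ->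
    cabs (f z - f p - c * (z - p)) <= e * cabs (z - p).

Lemma diff_within_sub A B f p c : A `<=` B ->
  diff_within B f p c -> diff_within A f p c.
Proof.
by move=> AB df e /df[d d0 dB]; exists d => // z Az; apply: dB; exact: AB.
Qed.

Lemma diff_within_cont A f p c : diff_within A f p c -> cont_within A f p.
Proof.
move=> /(_ _ ltr01)[d d0 df] e e0.
have K0 : 0 < cabs c + 1 by have := cabs_ge0 c; lra.
exists (Num.min d (e / (cabs c + 1))); first by rewrite lt_min d0 divr_gt0.
move=> z Az; rewrite lt_min => /andP[zd]; rewrite ltr_pdivlMr // => ze.
have := df z Az zd; have := cabsD (f z - f p - c * (z - p)) (c * (z - p)).
rewrite subrK cabsM; nra.
Qed.

Lemma diff_cvgP f p c : diff_within setT f p c <->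
  h^-1 *: (f (h + p) - f p) @[h --> 0^'] --> c.
Proof.
split=> [df B /nbhs_cabsP[e e0 eB]|cf e e0].
  have e20 : 0 < e / 2 by rewrite divr_gt0.
  have [d d0 dA] := df _ e20.
  apply/nbhs_cabsP; exists d => // h; rewrite subr0 => hd /= h0; apply: eB.
  have := dA (h + p) I; rewrite addrK => /(_ hd).
  have -> : f (h + p) - f p - c * h = h * (h^-1 *: (f (h + p) - f p) - c).
    by rewrite mulrBr /GRing.scale /= mulVKf // [h * c]mulrC.
  rewrite cabsM mulrC ler_pM2r ?cabs_gt0 //; lra.
have : nbhs c [set w | cabs (w - c) < e] by apply/nbhs_cabsP; exists e.
move/cf => /nbhs_cabsP[d d0 dA]; exists d => // z _ zd.
have [->|zp] := eqVneq z p; first by rewrite !subrr mulr0 subr0 cabs0 mulr0.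
have h0 : z - p != 0 by rewrite subr_eq0.
have := dA (z - p); rewrite subr0 => /(_ zd h0) /=; rewrite subrK.
have {2}-> : f z - f p = (z - p) * ((z - p)^-1 *: (f z - f p)).
  by rewrite /GRing.scale /= mulVKf.
by rewrite mulrC [c * _]mulrC -mulrC -mulrBr cabsM mulrC => /ltW h; rewrite ler_wpM2r ?cabs_ge0.
Qed.

Lemma derivable_diff f p : derivable f p 1 -> diff_within setT f p (derive1 f p).
Proof.
move=> df; apply/diff_cvgP; rewrite derive1E.
have : h^-1 *: (f (h *: 1 + p) - f p) @[h --> 0^'] --> 'D_1 f p by exact: df.
by under eq_cvg do rewrite /(_ *: 1) /= mulr1.
Qed.

Lemma diff_derive1 f p c : diff_within setT f p c ->
  derivable f p 1 /\ derive1 f p = c.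
Proof.
move=> /diff_cvgP df; split.
  apply/cvg_ex; exists c; move: df.
  by under [in X in _ -> X]eq_cvg do rewrite /(_ *: 1) /= mulr1.
by rewrite derive1E /derive; apply/cvg_lim => //; move: df;
  under [in X in _ -> X]eq_cvg do rewrite /(_ *: 1) /= mulr1.
Qed.
End Differentiation.

(** * Mean value inequality and Darboux's theorem along segments *)

Section MeanValue.
Context (R : realType).
Implicit Types (z w p c : R[i]) (A : set R[i]) (f g : R[i] -> R[i]).

Definition real_diff (h : R -> R) (t l : R) := forall e : R, 0 < e ->
  exists2 d : R, 0 < d & forall s, `|s - t| < d ->
    `|h s - h t - l * (s - t)| <= e * `|s - t|.

Lemma real_diff_is_derive h t l : real_diff h t l -> is_derive t 1 h l.
Proof.
move=> dh.
have hl : u^-1 *: (h (u *: 1 + t) - h t) @[u --> 0^'] --> l.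
  apply/cvgrPdist_le => e e0; have [d d0 dA] := dh _ e0.
  rewrite near_withinE; exists d => // u; rewrite /ball_ /= sub0r normrN => ud u0.
  have := dA (u + t); rewrite addrK => /(_ ud).
  have -> : h (u + t) - h t - l * u = - (u * (l - u^-1 *: (h (u *: 1 + t) - h t))).
    rewrite mulrBr /GRing.scale /= mulr1 mulrA divff // mul1r; ring.
  by rewrite normrN normrM mulrC ler_pM2r ?normr_gt0.
split; first by apply/cvg_ex; exists l.
by rewrite /derive; apply/cvg_lim.
Qed.

Lemma exists_small (d e : R) : 0 < d -> 0 < e ->
  exists2 s : R, 0 < s & s < d /\ s <= e.
Proof.
move=> d0 e0; exists (Num.min (d / 2) e); first by rewrite lt_min divr_gt0.
by rewrite gt_min ge_min lexx orbT; split => //; apply/orP; left; lra.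
Qed.

(** A derivative without zeros cannot go from positive to negative: an interior
maximum of [h] would be a zero of [dh].  The derivative
[dh] may be discontinuous. *)
Lemma darboux_pos (h dh : R -> R) :
  (forall t, 0 <= t <= 1 -> real_diff h t (dh t)) ->
  (forall t, 0 <= t <= 1 -> dh t != 0) -> 0 < dh 0 -> 0 < dh 1.
Proof.
move=> hd dh0 dhpos; rewrite lt_def dh0 ?ler01 ?lexx //=; apply/negPn/negP.
rewrite -ltNge => dhneg.
have [//||c] := @EVT_max R h 0 1.
  apply: derivable_within_continuous => t; rewrite in_itv /= => t01.
  by have [] := real_diff_is_derive (hd t t01).
rewrite in_itv /= => c01 cmax.
have e0 : 0 < `|dh c| / 2 by rewrite divr_gt0 // normr_gt0 dh0.
have [d d0 dA] := hd c c01 _ e0.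
have contra s : 0 <= s <= 1 -> `|s - c| < d -> 0 < dh c * (s - c) -> False.
  move=> s01 sd ps; have := cmax s; rewrite in_itv /= => /(_ s01) hs.
  have := dA s sd; rewrite mulrAC -normrM ler_norml => /andP[+ _].
  by rewrite (gtr0_norm ps); lra.
have [l0|l0] := ltP 0 (dh c).
  have c1 : 0 < 1 - c.
    rewrite subr_gt0 lt_neqAle; apply/andP; split; last by lra.
    by apply/eqP => c1; move: l0; rewrite c1; lra.
  have [r r0 [rd rc]] := exists_small d0 c1.
  apply: (contra (c + r)); rewrite ?[c + r - c]addrC ?addKr ?gtr0_norm //; last exact: mulr_gt0.
  lra.
have ln : dh c < 0 by rewrite lt_neqAle l0 dh0.
have c1 : 0 < c.
  rewrite lt_neqAle; apply/andP; split; last by lra.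
  by apply/eqP => c1; move: ln; rewrite -c1; lra.
have [r r0 [rd rc]] := exists_small d0 c1.
have rE : c - r - c = - r by ring.
apply: (contra (c - r)); rewrite ?rE ?normrN ?gtr0_norm //; last by rewrite nmulr_rgt0 // oppr_lt0.
lra.
Qed.

Definition seg a b (t : R) : R[i] := a + t%:C%C * (b - a).

Lemma seg0 a b : seg a b 0 = a.
Proof. by rewrite /seg mul0r addr0. Qed.

Lemma seg1 a b : seg a b 1 = b.
Proof. by rewrite /seg mul1r addrC subrK. Qed.

Lemma real_diff_seg f a b t w c : diff_within setT f (seg a b t) c ->
  real_diff (fun s => complex.Re (w * f (seg a b s))) t (complex.Re (w * c * (b - a))).
Proof.
move=> df e e0.
have K0 : 0 < cabs w * cabs (b - a) + 1.
  by have := mulr_ge0 (cabs_ge0 w) (cabs_ge0 (b - a)); lra.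
have [d d0 dA] := df (e / (cabs w * cabs (b - a) + 1)) (divr_gt0 e0 K0).
have L0 : 0 < cabs (b - a) + 1 by have := cabs_ge0 (b - a); lra.
exists (d / (cabs (b - a) + 1)); first by rewrite divr_gt0.
move=> s; rewrite ltr_pdivlMr // => sd.
have segB : seg a b s - seg a b t = (s - t)%:C%C * (b - a).
  by rewrite /seg rmorphB /=; ring.
have := dA (seg a b s) I; rewrite segB cabsM cabs_real => hd'.
have sd' : `|s - t| * cabs (b - a) < d.
  apply: le_lt_trans sd; rewrite ler_wpM2l //; lra.
move: (hd' sd').
set E := f _ - _ - _ => hE.
have -> : complex.Re (w * f (seg a b s)) - complex.Re (w * f (seg a b t)) -
    complex.Re (w * c * (b - a)) * (s - t) = complex.Re (w * E).
  have -> : w * E = w * f (seg a b s) - w * f (seg a b t) - (w * c * (b - a)) * (s - t)%:C%C.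
    by rewrite /E; ring.
  rewrite !ReD !ReN [complex.Re (_ * (s - t)%:C%C)]ReM /=; ring.
apply: le_trans (Re_le_cabs _) _; rewrite cabsM.
apply: le_trans (ler_wpM2l (cabs_ge0 w) hE) _.
have -> : cabs w * (e / (cabs w * cabs (b - a) + 1) * (`|s - t| * cabs (b - a))) =
  (e * `|s - t|) * ((cabs w * cabs (b - a)) / (cabs w * cabs (b - a) + 1)) by ring.
rewrite ler_piMr ?mulr_ge0 ?(ltW e0) // ler_pdivrMr // mul1r; lra.
Qed.

(** The real mean value theorem, applied to the real part of f multiplied by the
conjugate of f(b) - f(a) - c (b - a). *)
Lemma mean_value_le f df a b c (eta : R) :
  (forall t, 0 <= t <= 1 -> diff_within setT f (seg a b t) (df (seg a b t))) ->
  (forall t, 0 <= t <= 1 -> cabs (df (seg a b t) - c) <= eta) ->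
  cabs (f b - f a - c * (b - a)) <= eta * cabs (b - a).
Proof.
move=> hd hc; set W := f b - f a - c * (b - a).
pose h t := complex.Re ((W^*)%C * f (seg a b t)).
have hdt t : 0 <= t <= 1 -> real_diff h t (complex.Re ((W^*)%C * df (seg a b t) * (b - a))).
  by move=> t01; exact: real_diff_seg (hd t t01).
have [||t] := @MVT R h (fun t => complex.Re ((W^*)%C * df (seg a b t) * (b - a))) 0 1 ltr01.
- by move=> t; rewrite in_itv /= => t01; apply/real_diff_is_derive/hdt; lra.
- apply: derivable_within_continuous => t; rewrite in_itv /= => t01.
  by have [] := real_diff_is_derive (hdt t t01).
rewrite in_itv /= => t01; rewrite /h seg0 seg1 subr0 mulr1 => hE.
have : cabs W ^+ 2 = complex.Re ((W^*)%C * ((df (seg a b t) - c) * (b - a))).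
  rewrite -Re_conjM {2}/W mulrBr ReD ReN mulrBr ReD ReN hE.
  rewrite -ReN -ReD; congr complex.Re; ring.
have := Re_le_cabs ((W^*)%C * ((df (seg a b t) - c) * (b - a))).
rewrite 2!cabsM cabs_conj.
have t01' : 0 <= t <= 1 by lra.
have := cabs_ge0 (df (seg a b t) - c); have := hc t t01'; have := cabs_ge0 (b - a); have := cabs_ge0 W.
move: (cabs W) (cabs (b - a)) (cabs (_ - c)) => x y u x0 y0 u0 u1 + h2.
rewrite -h2 => h3.
have {}h3 : x ^+ 2 <= x * (u * y) by apply: le_trans h3; exact: ler_norm.
have [->|xn] := eqVneq x 0; first by rewrite mulr_ge0 //; lra.
have xp : 0 < x by rewrite lt_def xn.
by move: h3; rewrite expr2 ler_pM2l // => /le_trans; apply; rewrite ler_wpM2r.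
Qed.

Definition convex_plane A := forall a b t, A a -> A b -> 0 <= t <= 1 -> A (seg a b t).

(** Under the second hypothesis df never has a purely imaginary quotient with c, so
by Darboux's theorem along segments the real part of df / c keeps its sign on the
convex set.  So a branch of the square root of df^2 is fixed before df
is known to be continuous. *)
Lemma sqrt_derivative_sign A f df c (eta : R) : convex_plane A -> c != 0 -> eta < 1 ->
  (forall z, A z -> diff_within setT f z (df z)) ->
  (forall z, A z -> cabs (df z ^+ 2 - c ^+ 2) <= eta * cabs c ^+ 2) ->
  exists2 c', c' = c \/ c' = - c & 
   forall z, A z -> 0 < complex.Re (df z / c').
Proof.
move=> cA c0 e1 hd hc.
have Ren z : A z -> complex.Re (df z / c) != 0.
  move=> Az; apply/eqP => h.
  have := hc z Az; rewrite -[df z](mulfVK c0) exprMn -[X in _ - X]mul1r -mulrBl cabsM cabsX.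
  rewrite ler_pM2r ?exprn_gt0 ?cabs_gt0 //.
  case: (df z / c) h => x y /= -> h2.
  have := Re_le_cabs ((0 +i* y)%C ^+ 2 - 1).
  rewrite ReD ReN expr2 ReM /= => h3.
  have : 1 <= `|0 * 0 - y * y - 1| by rewrite ler0_norm; nra.
  lra.
have sgn w a b : (forall z, A z -> complex.Re (w * df z) != 0) -> A a -> A b ->
    0 < complex.Re (w * df a) -> 0 < complex.Re (w * df b).
  move=> hw Aa Ab ha.
  have [->//|ab] := eqVneq b a.
  have ba0 : b - a != 0 by rewrite subr_eq0.
  have := @darboux_pos (fun t => complex.Re (w / (b - a) * f (seg a b t)))
    (fun t => complex.Re (w / (b - a) * df (seg a b t) * (b - a))).
  have E x : w / (b - a) * x * (b - a) = w * x by field.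
  rewrite /= seg0 seg1 !E; apply => // t t01.
    by apply: real_diff_seg; apply: hd; exact: cA.
  by rewrite E; apply: hw; exact: cA.
have [[a Aa]|nA] := pselect (exists a, A a); last first.
  by exists c; [left|move=> z Az; case: nA; exists z].
have [pa|na] := ltP 0 (complex.Re (df a / c)).
  exists c; first by left.
  move=> z Az; rewrite mulrC; apply: (sgn _ a z _ Aa Az); last by rewrite mulrC.
  by move=> y Ay; rewrite mulrC; exact: Ren.
exists (- c); first by right.
have E y : df y / - c = - (df y / c) by rewrite invrN mulrN.
move=> z Az; rewrite mulrC; apply: (sgn _ a z _ Aa Az).
  by move=> y Ay; rewrite mulrC E ReN oppr_eq0; exact: Ren.
by rewrite mulrC E ReN oppr_gt0 lt_neqAle na Ren.
Qed.

(** z^2 - c^2 = (z - c) (z + c), and z + c has modulus at least that of c. *)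
Lemma half_plane_dist c z : 0 < complex.Re (z / c) ->
  cabs (z - c) * cabs c <= cabs (z ^+ 2 - c ^+ 2).
Proof.
move=> zc.
have c0 : c != 0 by apply: contraTneq zc => ->; rewrite invr0 mulr0 ltxx.
have -> : z ^+ 2 - c ^+ 2 = (z - c) * (z + c) by ring.
rewrite cabsM ler_wpM2l ?cabs_ge0 //.
have -> : z + c = (z / c + 1) * c by field.
rewrite cabsM ler_peMl ?cabs_ge0 //.
have := Re_le_cabs (z / c + 1); rewrite ReD /=.
by have := ler_norm (complex.Re (z / c) + 1); lra.
Qed.
End MeanValue.

(** * Derivatives at the boundary of the disc *)

Section BoundaryDerivative.
Context (R : realType).
Implicit Types (z w p c s : R[i]) (A : set R[i]) (f g : R[i] -> R[i]).

Lemma cabs_seg p a b (t r : R) : 0 <= t <= 1 -> cabs (a - p) < r -> cabs (b - p) < r ->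
  cabs (seg a b t - p) < r.
Proof.
move=> /andP[t0 t1] ar br.
have -> : seg a b t - p = (1 - t)%:C%C * (a - p) + t%:C%C * (b - p).
  by rewrite /seg rmorphB rmorph1; ring.
apply: le_lt_trans (cabsD _ _) _; rewrite !cabsM !cabs_real.
rewrite !ger0_norm ?subr_ge0 //.
have [t2|t2] := lerP t (1 / 2); first 1 last.
  have : 0 < t * (r - cabs (b - p)) by rewrite mulr_gt0 ?subr_gt0 //; lra.
  have : 0 <= (1 - t) * (r - cabs (a - p)) by rewrite mulr_ge0 ?subr_ge0 // ltW.
  lra.
have : 0 <= t * (r - cabs (b - p)) by rewrite mulr_ge0 ?subr_ge0 // ltW.
have : 0 < (1 - t) * (r - cabs (a - p)) by rewrite mulr_gt0 ?subr_gt0 //; lra.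
lra.
Qed.

Lemma convex_disc_ball p (r : R) :
  convex_plane [set z | cabs z < 1 /\ cabs (z - p) < r].
Proof.
move=> a b t [a1 ar] [b1 br] t01; split; last exact: cabs_seg.
by rewrite -[seg _ _ _]subr0; apply: cabs_seg; rewrite ?subr0.
Qed.

(** The derivative tends to one of the two square roots c of s, the sign being
constant near p by Darboux's theorem.  So the mean value inequality bounds
f(x) - f(y) - c (x - y) for x and y in the open disc near p, and by continuity
for x and y in the closed disc, in particular for y = p. *)
Lemma disc_derivative f df p s (r : R) : cdisc R p -> 0 < r -> s != 0 ->
  (forall z, cdisc R z -> cabs (z - p) < r -> cont_within (cdisc R) f z) ->
  (forall z, disc R z -> cabs (z - p) < r -> diff_within setT f z (df z)) ->
  (forall e : R, 0 < e -> exists2 d : R, 0 < d & forall z, disc R z ->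
     cabs (z - p) < d -> cabs (df z ^+ 2 - s) < e) ->
  exists2 c, c ^+ 2 = s & diff_within (cdisc R) f p c.
Proof.
rewrite cdiscE discE => p1 r0 s0 cf hdf lf.
pose c0 := sqrtc s.
have c0s : c0 ^+ 2 = s by rewrite sqr_sqrtc.
have c00 : c0 != 0 by rewrite sqrtc_eq0.
have [|d1 d10 h1] := lf (1 / 2 * cabs c0 ^+ 2).
  by rewrite mulr_gt0 ?exprn_gt0 ?cabs_gt0.
have [|||c cc0 hc] := @sqrt_derivative_sign R _ f df c0 (1 / 2)
    (@convex_disc_ball p (Num.min r d1)) c00.
- by lra.
- by move=> z [z1]; rewrite lt_min => /andP[zr zd]; exact: hdf.
- by move=> z [z1]; rewrite lt_min c0s => /andP[zr zd]; apply/ltW/h1.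
have cs : c ^+ 2 = s by case: cc0 => ->; rewrite ?sqrrN.
have c1 : c != 0 by case: cc0 => ->; rewrite ?oppr_eq0.
exists c => // e e0.
have [|d d0 hd] := lf (e * cabs c); first by rewrite mulr_gt0 // cabs_gt0.
pose q := Num.min r (Num.min d1 d).
have q0 : 0 < q by rewrite !lt_min r0 d10.
have mv a b : cabs a < 1 -> cabs (a - p) < q -> cabs b < 1 -> cabs (b - p) < q ->
    cabs (f b - f a - c * (b - a)) <= e * cabs (b - a).
  move=> a1 ap b1 bp; apply: (@mean_value_le _ f df) => t t01.
    have [z1] := convex_disc_ball (conj a1 ap) (conj b1 bp) t01.
    by rewrite !lt_min => /and3P[zr _ _]; exact: hdf.
  have [z1] := convex_disc_ball (conj a1 ap) (conj b1 bp) t01.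
  rewrite !lt_min => /and3P[zr zd1 zd].
  have /half_plane_dist : 0 < complex.Re (df (seg a b t) / c).
    by apply: hc; split => //; rewrite lt_min zr.
  rewrite cs => h; have := hd _ z1 zd => h'.
  by rewrite -(@ler_pM2r _ (cabs c)) ?cabs_gt0 //; apply: le_trans h (ltW h').
exists q => // x /= x1 xp.
apply/ler_addgt0Pr => k k0.
have xr : cabs (x - p) < r by move: xp; rewrite !lt_min => /and3P[].
have pr : cabs (p - p) < r by rewrite subrr cabs0.
(* the total error is K times the accuracy k / K of each approximation *)
pose K := 2 + cabs c * 2 + e * 2.
have K0 : 0 < K by have := cabs_ge0 c; rewrite /K; nra.
have k1 : 0 < k / K by rewrite divr_gt0.
have [dx dx0 hx] := cf x x1 xr _ k1.
have [dp dp0 hp] := cf p p1 pr _ k1.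
pose m := Num.min (Num.min dx dp) (Num.min (k / K) (Num.min 1 (q - cabs (x - p)))).
have m0 : 0 < m by rewrite /m !lt_min dx0 dp0 k1 ltr01 subr_gt0 xp.
have [t t0 [tm _]] := exists_small m0 ltr01.
have tc : [/\ t < dx, t < dp, t < k / K, t < 1 & t < q - cabs (x - p)].
  by move: tm; rewrite /m !lt_min -!andbA => /and5P[].
case: tc => tx tp tk t1 tq {tm}.
(* scaling by 1 - t pushes points of the closed disc into the open disc *)
pose y z := (1 - t)%:C%C * z.
have yz z : cabs z <= 1 -> cabs (y z) < 1 /\ cabs (y z - z) <= t.
  move=> z1; have -> : y z - z = - (t%:C%C * z).
    by rewrite /y rmorphB rmorph1; ring.
  rewrite cabsN !cabsM !cabs_real !ger0_norm ?subr_ge0 ?(ltW t0) ?(ltW t1) //.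
  by have := cabs_ge0 z; split; nra.
have [yx1 yx] := yz x x1; have [yp1 yp] := yz p p1.
have A1 := hx (y x) (ltW yx1) (le_lt_trans yx tx).
have A2 := hp (y p) (ltW yp1) (le_lt_trans yp tp).
have A3 : cabs (y x - p) < q.
  by have := cabsD (y x - x) (x - p); rewrite addrA subrK; lra.
have A4 : cabs (y p - p) < q by have := cabs_ge0 (x - p); lra.
have := mv _ _ yp1 A4 yx1 A3.
have E1 : f x - f p - c * (x - p) = (f (y x) - f (y p) - c * (y x - y p)) -
  (f (y x) - f x) + (f (y p) - f p) + c * (y x - x) - c * (y p - p) by ring.
have E2 : y x - y p = (x - p) + (y x - x) - (y p - p) by ring.
have B1 := cabsB ((f (y x) - f (y p) - c * (y x - y p)) -
  (f (y x) - f x) + (f (y p) - f p) + c * (y x - x)) (c * (y p - p)).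
have B2 := cabsD ((f (y x) - f (y p) - c * (y x - y p)) -
  (f (y x) - f x) + (f (y p) - f p)) (c * (y x - x)).
have B3 := cabsD ((f (y x) - f (y p) - c * (y x - y p)) - (f (y x) - f x)) (f (y p) - f p).
have B4 := cabsB (f (y x) - f (y p) - c * (y x - y p)) (f (y x) - f x).
have B5 := cabsB ((x - p) + (y x - x)) (y p - p).
have B6 := cabsD (x - p) (y x - x).
rewrite -E1 in B1; rewrite -E2 in B5; move: B1 B2; rewrite !cabsM => B1 B2 B7.
have B8 : e * cabs (y x - y p) <= e * (cabs (x - p) + t + t).
  by rewrite ler_pM2l //; lra.
have B9 : cabs c * cabs (y x - x) <= cabs c * t by rewrite ler_wpM2l ?cabs_ge0.
have B10 : cabs c * cabs (y p - p) <= cabs c * t by rewrite ler_wpM2l ?cabs_ge0.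
have KE : k / K * (2 + cabs c * 2 + e * 2) = k by rewrite -/K divfK // gt_eqF.
have cc := cabs_ge0 c.
have C1 : cabs c * t <= cabs c * (k / K) by rewrite ler_wpM2l // ltW.
have C2 : e * t <= e * (k / K) by rewrite ler_wpM2l ?ltW.
move: A1 A2 tk k1 KE C1 C2; move: (k / K) => kk A1 A2 tk k1 KE C1 C2.
have {}KE : kk * 2 + cabs c * kk * 2 + e * kk * 2 = k by rewrite -KE; ring.
lra.
Qed.

(** The derivative of F = g o f^-1 on the image of A; continuity of the inverse h is
what brings points near f(z) back near z. *)
Lemma diff_within_quotient A f g h F z a b : a != 0 ->
  (forall x, A x -> h (f x) = x) -> (forall x, A x -> F (f x) = g x) ->
  A z -> cont_within (f @` A) h (f z) ->
  diff_within A f z a -> diff_within A g z b ->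
  diff_within (f @` A) F (f z) (b / a).
Proof.
move=> a0 hf Ff Az ch df dg e e0.
pose M := (1 + cabs (b / a)).
have M0 : 0 < M by have := cabs_ge0 (b / a); rewrite /M; lra.
have ap : 0 < cabs a by rewrite cabs_gt0.
pose e1 := Num.min (cabs a / 2) (e * (cabs a / 2) / M).
have e10 : 0 < e1 by rewrite lt_min !divr_gt0 ?mulr_gt0 ?divr_gt0.
have [d1 d10 h1] := df _ e10; have [d2 d20 h2] := dg _ e10.
have dm : 0 < Num.min d1 d2 by rewrite lt_min d10.
have [d d0 hd] := ch _ dm; exists d => // _ [x Ax <-] xd.
have := hd (f x) (ex_intro2 _ _ x Ax erefl) xd; rewrite !hf // lt_min => /andP[xd1 xd2].
rewrite !Ff //.
have B1 := h1 x Ax xd1; have B2 := h2 x Ax xd2.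
have E : g x - g z - b / a * (f x - f z) = (g x - g z - b * (x - z)) -
  b / a * (f x - f z - a * (x - z)) by field.
rewrite E; apply: le_trans (cabsB _ _) _; rewrite cabsM.
have B3 : cabs a * cabs (x - z) <= cabs (f x - f z) + e1 * cabs (x - z).
  rewrite -cabsM; have -> : a * (x - z) = (f x - f z) - (f x - f z - a * (x - z)) by ring.
  by apply: le_trans (cabsB _ _) _; lra.
have e1a : e1 <= cabs a / 2 by rewrite ge_min lexx.
have e1b : e1 * M <= e * (cabs a / 2) by rewrite -ler_pdivlMr // ge_min lexx orbT.
have B4 : cabs a / 2 * cabs (x - z) <= cabs (f x - f z).
  by have := cabs_ge0 (x - z); nra.
apply: le_trans (_ : e1 * M * cabs (x - z) <= _).
  rewrite /M; have := cabs_ge0 (b / a); nra.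
apply: le_trans (_ : e * (cabs a / 2) * cabs (x - z) <= _).
  by rewrite ler_wpM2r ?cabs_ge0.
by rewrite -mulrA ler_pM2l.
Qed.

Lemma diff_within_unique A f p a b : diff_within A f p a -> diff_within A f p b ->
  (forall d : R, 0 < d -> exists2 x, A x & x != p /\ cabs (x - p) < d) -> a = b.
Proof.
move=> da db acc; apply/eqP/negPn/negP => ab.
have ab0 : 0 < cabs (a - b) by rewrite cabs_gt0 subr_eq0.
have e0 : 0 < cabs (a - b) / 4 by rewrite divr_gt0.
have [d1 d10 h1] := da _ e0; have [d2 d20 h2] := db _ e0.
have dm : 0 < Num.min d1 d2 by rewrite lt_min d10.
have [x Ax [xp]] := acc _ dm; rewrite lt_min => /andP[xd1 xd2].
have B1 := h1 x Ax xd1; have B2 := h2 x Ax xd2.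
have xp0 : 0 < cabs (x - p) by rewrite cabs_gt0 subr_eq0.
have := cabsB (f x - f p - b * (x - p)) (f x - f p - a * (x - p)).
have -> : (f x - f p - b * (x - p)) - (f x - f p - a * (x - p)) = (a - b) * (x - p) by ring.
by rewrite cabsM; nra.
Qed.

Lemma diff_within_setU A B f p c : diff_within A f p c -> diff_within B f p c ->
  diff_within (A `|` B) f p c.
Proof.
move=> da db e e0; have [d1 d10 h1] := da _ e0; have [d2 d20 h2] := db _ e0.
exists (Num.min d1 d2) => [|z AB]; first by rewrite lt_min d10.
by rewrite lt_min => /andP[zd1 zd2]; case: AB => [/h1|/h2]; apply.
Qed.

Lemma diff_within_local A f p c (r : R) : 0 < r ->
  (forall z, cabs (z - p) < r -> A z) -> diff_within A f p c ->
  diff_within setT f p c.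
Proof.
move=> r0 rA df e /df[d d0 h]; exists (Num.min r d); first by rewrite lt_min r0.
by move=> z _; rewrite lt_min => /andP[/rA zA]; exact: h.
Qed.
End BoundaryDerivative.

(** * Second-order expansions and the maximum principle *)

Section MaximumPrinciple.
Context (R : realType).
Implicit Types (z w p c s : R[i]) (A : set R[i]) (f g v : R[i] -> R[i]).

Lemma real_continuous_at (h : R[i] -> R) p :
  (forall e : R, 0 < e -> exists2 d : R, 0 < d & forall z, cabs (z - p) < d -> `|h z - h p| < e) ->
  {for p, continuous h}.
Proof.
move=> hc B [e /= /hc[d d0 dh] eB]; apply/nbhs_cabsP; exists d => // z zd.
by apply: eB; rewrite /ball_ /= distrC; exact: dh.
Qed.

Lemma continuous_cabs v p : cont_within setT v p ->
  {for p, continuous (fun z => cabs (v z))}.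
Proof.
move=> cv; apply: real_continuous_at => e /cv[d d0 dv]; exists d => // z zd.
apply: le_lt_trans (dv z I zd).
by rewrite ler_norml cabs_dist_le andbT lerNl opprB cabs_distC cabs_dist_le.
Qed.

Lemma compact_closed_disc (r : R) : compact [set z : R[i] | cabs z <= r].
Proof.
pose f (u : R * R) : R[i] := (u.1 +i* u.2)%C.
have cf : continuous f.
  move=> u B /nbhs_cabsP[d d0 dB].
  have d20 : 0 < d / 2 by rewrite divr_gt0.
  exists ([set x | `|u.1 - x| < d / 2], [set x | `|u.2 - x| < d / 2]).
    by split; exists (d / 2) => //.
  move=> [x y] [/= xd yd]; apply: dB; apply: le_lt_trans (cabs_le_ReIm _) _ => /=.
  by rewrite distrC (distrC y); lra.
have cR : compact (f @` (`[(- r), r] `*` `[(- r), r])).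
  apply: continuous_compact; last exact: compact_setX (@segment_compact _ _ _) (@segment_compact _ _ _).
  by apply: continuous_subspaceT.
apply: subclosed_compact cR _; last first.
  move=> [x y] zr; exists (x, y) => //=.
  have := Re_le_cabs (x +i* y)%C; have := Im_le_cabs (x +i* y)%C; move: zr => /=.
  by rewrite !in_itv /= !ler_norml => h /andP[h1 h2] /andP[h3 h4]; split; lra.
move=> z zc; rewrite /= leNgt; apply/negP => rz.
have rz0 : 0 < cabs z - r by rewrite subr_gt0.
have /closureP/(_ _ rz0)[w /= wr wz] := zc.
by have := cabs_dist_le z w; rewrite cabs_distC; lra.
Qed.

(** A Taylor expansion of order two, in the manner of Caratheodory: the coefficient
of the quadratic term is a function continuous at [p].  In this form expansions
multiply by pure algebra. *)
Definition jet2 f p := exists c g (d : R), [/\ 0 < d, cont_within setT g p &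
  forall z, cabs (z - p) < d -> f z = f p + c * (z - p) + g z * (z - p) ^+ 2].

Lemma jet2_cst c p : jet2 (fun=> c) p.
Proof.
exists 0, (fun=> 0), 1; split=> //; first exact: cont_within_cst.
by move=> z _; ring.
Qed.

Lemma jet2_subr s p : jet2 (fun z => z - s) p.
Proof.
exists 1, (fun=> 0), 1; split=> //; first exact: cont_within_cst.
by move=> z _; ring.
Qed.

Lemma jet2D f g p : jet2 f p -> jet2 g p -> jet2 (fun z => f z + g z) p.
Proof.
move=> [c [k [d [d0 kc h]]]] [c' [k' [d' [d'0 k'c h']]]].
exists (c + c'), (fun z => k z + k' z), (Num.min d d'); split.
- by rewrite lt_min d0.
- exact: cont_withinD.
- by move=> z; rewrite lt_min => /andP[/h -> /h' ->]; ring.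
Qed.

Lemma jet2M f g p : jet2 f p -> jet2 g p -> jet2 (fun z => f z * g z) p.
Proof.
move=> [c [k [d [d0 kc h]]]] [c' [k' [d' [d'0 k'c h']]]].
exists (c * g p + f p * c'), (fun z => f p * k' z + k z * g p + c * c' +
   (c * k' z + c' * k z) * (z - p) + k z * k' z * (z - p) ^+ 2), (Num.min d d'); split.
- by rewrite lt_min d0.
- have zc : cont_within setT (fun z => z - p) p.
    by apply: cont_withinD; [exact: cont_within_id|exact: cont_within_cst].
  have cc b : cont_within setT (fun=> b) p by exact: cont_within_cst.
  repeat apply: cont_withinD; repeat apply: cont_withinM => //; try exact: cont_withinXn.
  by apply: cont_withinD; apply: cont_withinM.
- by move=> z; rewrite lt_min => /andP[/h -> /h' ->]; ring.
Qed.

Lemma jet2X f p n : jet2 f p -> jet2 (fun z => f z ^+ n) p.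
Proof.
move=> jf; elim: n => [|n IH]; first exact: jet2_cst.
by have := jet2M jf IH; congr jet2; apply/funext => z; rewrite exprS.
Qed.

Lemma jet2_inv s p : p != s -> jet2 (fun z => (z - s)^-1) p.
Proof.
move=> ps; have ps0 : p - s != 0 by rewrite subr_eq0.
exists (- (p - s) ^- 2), (fun z => (p - s) ^- 2 * (z - s)^-1), (cabs (p - s)); split.
- by rewrite cabs_gt0.
- apply: cont_withinM; first exact: cont_within_cst.
  apply: cont_withinV => //.
  by apply: cont_withinD; [exact: cont_within_id|exact: cont_within_cst].
- move=> z zp; have zs : z - s != 0.
    apply: contraTneq zp => /eqP; rewrite subr_eq0 => /eqP ->.
    by rewrite cabs_distC ltxx.
  by field; rewrite zs ps0.
Qed.

Lemma jet2_local f g p (r : R) : 0 < r -> (forall z, cabs (z - p) < r -> f z = g z) ->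
  jet2 f p -> jet2 g p.
Proof.
move=> r0 fg [c [k [d [d0 kc h]]]]; exists c, k, (Num.min r d); split=> //.
  by rewrite lt_min r0.
move=> z; rewrite lt_min => /andP[zr zd]; rewrite -!fg ?subrr ?cabs0 //; exact: h.
Qed.

(** The mean value inequality for f(z) - b / 2 (z - p)^2, whose derivative
df(z) - b (z - p) differs from df(p) by little compared with z - p. *)
Lemma jet2_derivative f df p b (r : R) : 0 < r ->
  (forall z, cabs (z - p) < r -> diff_within setT f z (df z)) ->
  diff_within setT df p b -> jet2 f p.
Proof.
move=> r0 hdf hb.
pose g z := if z == p then b / 2 else (f z - f p - df p * (z - p)) / (z - p) ^+ 2.
exists (df p), g, 1; split=> //; last first.
  move=> z _; rewrite /g; case: eqVneq => [->|zp]; first by ring.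
  by field; rewrite subr_eq0.
move=> e e0; have e20 : 0 < e / 2 by rewrite divr_gt0.
have [d d0 hd] := hb _ e20.
exists (Num.min r d); first by rewrite lt_min r0.
move=> z _; rewrite lt_min => /andP[zr zd].
rewrite {2}/g eqxx /g; case: eqVneq => [_|zp]; first by rewrite subrr cabs0.
have zp0 : z - p != 0 by rewrite subr_eq0.
have -> : (f z - f p - df p * (z - p)) / (z - p) ^+ 2 - b / 2 =
   ((f z - b / 2 * (z - p) ^+ 2) - (f p - b / 2 * (p - p) ^+ 2) - df p * (z - p)) / (z - p) ^+ 2.
  by field.
rewrite cabsM cabsV cabsX ltr_pdivrMr ?exprn_gt0 ?cabs_gt0 //.
have S t : 0 <= t <= 1 -> cabs (seg p z t - p) <= cabs (z - p).
  move=> t01; rewrite /seg addrC addKr cabsM cabs_real ger0_norm; last by lra.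
  by have := cabs_ge0 (z - p); nra.
have : cabs ((f z - b / 2 * (z - p) ^+ 2) - (f p - b / 2 * (p - p) ^+ 2) - df p * (z - p)) <=
    (e / 2 * cabs (z - p)) * cabs (z - p).
  apply: (@mean_value_le _ (fun z => f z - b / 2 * (z - p) ^+ 2) (fun z => df z - b * (z - p))) => t t01.
    set y := seg _ _ _ => k k0; have k20 : 0 < k / 2 by rewrite divr_gt0.
    have [|d' d'0 h'] := hdf y _ _ k20; first exact: le_lt_trans (S t t01) zr.
    have B0 : 0 < cabs (b / 2) + 1 by have := cabs_ge0 (b / 2); lra.
    exists (Num.min d' (k / 2 / (cabs (b / 2) + 1))); first by rewrite lt_min d'0 divr_gt0.
    move=> x _; rewrite lt_min ltr_pdivlMr // => /andP[xd xb].
    have -> : f x - b / 2 * (x - p) ^+ 2 - (f y - b / 2 * (y - p) ^+ 2) - (df y - b * (y - p)) * (x - y) =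
      (f x - f y - df y * (x - y)) - b / 2 * (x - y) ^+ 2 by field.
    apply: le_trans (cabsB _ _) _; have := h' x I xd; rewrite cabsM cabsX.
    have := cabs_ge0 (x - y); have := cabs_ge0 (b / 2); nra.
  have := hd (seg p z t) I (le_lt_trans (S t t01) zd).
  have -> : df (seg p z t) - df p - b * (seg p z t - p) = df (seg p z t) - b * (seg p z t - p) - df p by ring.
  by move=> /le_trans; apply; rewrite ler_pM2l // S.
have zp1 : 0 < cabs (z - p) by rewrite cabs_gt0.
by move=> /le_lt_trans; apply; rewrite -mulrA -expr2 ltr_pM2r ?exprn_gt0 //; lra.
Qed.

Lemma cabs_parallelogram p (t : R) :
  cabs (p + t%:C%C) ^+ 2 + cabs (p + - t%:C%C) ^+ 2 + cabs (p + (0 +i* t)%C) ^+ 2 +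
    cabs (p + - (0 +i* t)%C) ^+ 2 = 4 * cabs p ^+ 2 + 4 * t ^+ 2.
Proof. by rewrite !sqr_cabs; case: p => x y /=; ring. Qed.

(** Averaging v over p + h for h = t, -t, it, -it cancels the linear terms, and also the
quadratic ones since the sum of the h^2 vanishes; so the average of |v|^2 decreases
by at most o(t^2), while that of e |z|^2 increases by e t^2. *)
Lemma jet2_not_max v p (e : R) : 0 < e -> jet2 v p -> forall r : R, 0 < r ->
  exists2 z, cabs (z - p) < r & 
    cabs (v p) ^+ 2 + e * cabs p ^+ 2 < cabs (v z) ^+ 2 + e * cabs z ^+ 2.
Proof.
move=> e0 [c [g [d [d0 gc hv]]]] r r0.
(* accuracy k of the quadratic coefficient costs 8 k |v p| t^2 < 4 e t^2 *)
pose k := e / (2 * (cabs (v p) + 1)).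
have V0 : 0 < cabs (v p) + 1 by have := cabs_ge0 (v p); lra.
have k0 : 0 < k by rewrite divr_gt0 ?mulr_gt0.
have [d' d'0 hg] := gc _ k0.
have [t t0 [td tr]] := exists_small (d := Num.min d d') (e := r / 2) ltac:(by rewrite lt_min d0) ltac:(by rewrite divr_gt0).
move: td; rewrite lt_min => /andP[td td'].
apply: contrapT => H.
have lez h : cabs h = t -> cabs (v (p + h)) ^+ 2 + e * cabs (p + h) ^+ 2 <= cabs (v p) ^+ 2 + e * cabs p ^+ 2.
  move=> ht; rewrite leNgt; apply/negP => hlt; apply: H; exists (p + h) => //.
  by rewrite addrC addKr ht; lra.
pose a : R[i] := t%:C%C; pose b : R[i] := (0 +i* t)%C.
have ht1 : cabs a = t by rewrite cabs_real gtr0_norm.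
have ht3 : cabs b = t.
  apply/eqP; rewrite -(eqrXn2 (n := 2)) ?cabs_ge0 ?ltW // sqr_cabs /=; apply/eqP; ring.
have ht2 : cabs (- a) = t by rewrite cabsN.
have ht4 : cabs (- b) = t by rewrite cabsN.
have L1 := lez _ ht1; have L2 := lez _ ht2; have L3 := lez _ ht3; have L4 := lez _ ht4.
have ap (u : R[i]) : cabs (v p + u) ^+ 2 >= cabs (v p) ^+ 2 + 2 * complex.Re (((v p)^*)%C * u).
  rewrite !sqr_cabs; case: (v p) u => x y [x' y'] /=.
  have -> : 2 * (x * x' - - y * y') = 2 * x * x' + 2 * y * y' by ring.
  have := sqr_ge0 x'; have := sqr_ge0 y'; nra.
have E h : cabs h = t -> v (p + h) = v p + (c * h + g (p + h) * h ^+ 2).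
  by move=> hh; rewrite hv addrC ?addKr ?hh //; ring.
have G h : cabs h = t -> cabs (g (p + h) - g p) < k.
  by move=> hh; apply: hg => //; rewrite addrC addKr hh.
have G1 := G _ ht1; have G2 := G _ ht2; have G3 := G _ ht3; have G4 := G _ ht4.
move: L1 L2 L3 L4; rewrite (E _ ht1) (E _ ht2) (E _ ht3) (E _ ht4).
have A1 := ap (c * a + g (p + a) * a ^+ 2).
have A2 := ap (c * - a + g (p + - a) * (- a) ^+ 2).
have A3 := ap (c * b + g (p + b) * b ^+ 2).
have A4 := ap (c * - b + g (p + - b) * (- b) ^+ 2).
have b2 : b ^+ 2 = - a ^+ 2.
  by rewrite /a /b !expr2; apply/eqP; rewrite eq_complex /=; apply/andP; split; apply/eqP; ring.
have SR : complex.Re (((v p)^*)%C * (c * a + g (p + a) * a ^+ 2)) +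
  complex.Re (((v p)^*)%C * (c * - a + g (p + - a) * (- a) ^+ 2)) +
  complex.Re (((v p)^*)%C * (c * b + g (p + b) * b ^+ 2)) +
  complex.Re (((v p)^*)%C * (c * - b + g (p + - b) * (- b) ^+ 2)) =
  complex.Re (((v p)^*)%C * (((g (p + a) - g p) + (g (p + - a) - g p) - (g (p + b) - g p) - (g (p + - b) - g p)) * a ^+ 2)).
  rewrite -!ReD; congr complex.Re; rewrite !sqrrN b2; ring.
have := Re_le_cabs (((v p)^*)%C * (((g (p + a) - g p) + (g (p + - a) - g p) - (g (p + b) - g p) - (g (p + - b) - g p)) * a ^+ 2)).
rewrite -SR 2!cabsM cabs_conj cabsX ht1.
set S := (X in cabs X * t ^+ 2).
have : cabs S <= 4 * k.
  have := cabsB (g (p + a) - g p + (g (p + - a) - g p) - (g (p + b) - g p)) (g (p + - b) - g p).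
  have := cabsB (g (p + a) - g p + (g (p + - a) - g p)) (g (p + b) - g p).
  have := cabsD (g (p + a) - g p) (g (p + - a) - g p).
  rewrite -/S; lra.
have SP := cabs_parallelogram p t.
rewrite -/a -/b in SP.
move=> S4; rewrite ler_norml => /andP[+ _].
have KE : k * (2 * (cabs (v p) + 1)) = e by rewrite /k divfK // gt_eqF ?mulr_gt0.
have t2 : 0 < t ^+ 2 by rewrite exprn_gt0.
have M1 : cabs (v p) * (cabs S * t ^+ 2) <= cabs (v p) * (4 * k * t ^+ 2).
  by rewrite ler_wpM2l ?cabs_ge0 // ler_wpM2r // ltW.
have M2 : 2 * (cabs (v p) * (4 * k * t ^+ 2)) < 4 * e * t ^+ 2.
  have -> : 2 * (cabs (v p) * (4 * k * t ^+ 2)) = 8 * k * cabs (v p) * t ^+ 2 by ring.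
  by rewrite ltr_pM2r // -KE; lra.
move: SR => _ N L1 L2 L3 L4.
have {SP}SP : e * cabs (p + a) ^+ 2 + e * cabs (p + - a) ^+ 2 + e * cabs (p + b) ^+ 2 +
    e * cabs (p + - b) ^+ 2 = 4 * e * cabs p ^+ 2 + 4 * e * t ^+ 2.
  by rewrite -!mulrDr SP; ring.
lra.
Qed.

(** The zeros of v may be singular points: at such a zero |v|^2 + e |z|^2 is at most
e rho^2, which is negligible as e tends to 0. *)
Lemma maximum_principle v (rho m : R) : 0 <= m ->
  (forall z, cont_within setT v z) ->
  (forall z, cabs z < rho -> v z = 0 \/ jet2 v z) ->
  (forall z, cabs z = rho -> cabs (v z) <= m) ->
  forall z, cabs z <= rho -> cabs (v z) <= m.
Proof.
move=> m0 cv jv bv z zr.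
rewrite -(@ler_pXn2r _ 2) ?nnegrE ?cabs_ge0 //.
apply/ler_addgt0Pr => k k0.
have r0 : 0 < rho ^+ 2 + 1 by have := sqr_ge0 rho; lra.
pose e := k / (rho ^+ 2 + 1).
have e0 : 0 < e by rewrite divr_gt0.
pose Phi z := cabs (v z) ^+ 2 + e * cabs z ^+ 2.
have cPhi : continuous Phi.
  move=> p; have c1 := continuous_cabs (cv p).
  have c2 : {for p, continuous (@cabs R)} by apply: continuous_cabs; exact: cont_within_id.
  apply: (@continuousD _ _ _ (fun z => cabs (v z) ^+ 2) (fun z => e * cabs z ^+ 2)).
    exact: (continuousM c1 c1).
  apply: (@continuousM _ _ (fun=> e)); first exact: cst_continuous.
  exact: (continuousM c2 c2).
have [|||c] := @compact_EVT_max _ R Phi [set z | cabs z <= rho].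
- by exists z.
- exact: compact_closed_disc.
- exact: continuous_subspaceT.
rewrite inE /= => cr cmax.
have := cmax z; rewrite inE /= => /(_ zr); rewrite /Phi => zc.
have EK : e * (rho ^+ 2 + 1) = k by rewrite /e divfK // gt_eqF.
have ec : e * cabs c ^+ 2 <= e * rho ^+ 2.
  by rewrite ler_pM2l // ler_pXn2r // ?nnegrE ?cabs_ge0 // (le_trans (cabs_ge0 c)).
have ez : 0 <= e * cabs z ^+ 2 by rewrite mulr_ge0 ?sqr_ge0 // ltW.
have : cabs (v c) ^+ 2 <= m ^+ 2; last by lra.
have [cr'|] := ltP (cabs c) rho; last first.
  move=> rc; rewrite ler_pXn2r ?nnegrE ?cabs_ge0 //.
  by apply: bv; apply/eqP; rewrite eq_le cr.
have [->|jc] := jv c cr'; first by rewrite cabs0 expr0n sqr_ge0.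
have rc0 : 0 < rho - cabs c by rewrite subr_gt0.
have [w wc] := jet2_not_max e0 jc rc0.
rewrite ltNge => /negP[]; have := cmax w; rewrite inE; apply => /=.
by have := cabsD (w - c) c; rewrite subrK; lra.
Qed.

(** On a large disc the maximum principle for u^n prod (z - s), s in S, bounds
|u(z)|^n by a constant independent of n times e^n, where e bounds |u| on the
boundary; so |u(z)| is at most e for every z off S. *)
Lemma jet2_vanishing u (S : seq R[i]) :
  (forall z, cont_within setT u z) ->
  (forall z, z \notin S -> jet2 u z) ->
  (forall e : R, 0 < e -> exists2 r : R, 0 < r & forall z, r < cabs z -> cabs (u z) <= e) ->
  forall z, z \notin S -> u z = 0.
Proof.
move=> cu ju u0 z zS; apply/eqP; rewrite -cabs_eq0; apply/eqP/le_anti.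
rewrite cabs_ge0 andbT; apply/ler_addgt0Pr => e e0; rewrite add0r.
have [r r0 ur] := u0 e e0.
(* the disc of radius rho contains z and S, and |u| <= e on its boundary *)
pose rho := r + cabs z + 1 + \sum_(s <- S) cabs s.
have S0 : 0 <= \sum_(s <- S) cabs s by apply: sumr_ge0 => s _; exact: cabs_ge0.
have zc := cabs_ge0 z.
have Sr s : s \in S -> cabs s <= rho.
  move=> sS; have : cabs s <= \sum_(s <- S) cabs s.
    rewrite (big_rem s) //= lerDl; apply: sumr_ge0 => x _; exact: cabs_ge0.
  by rewrite /rho; lra.
pose P z := \prod_(s <- S) (z - s).
have rho0 : 0 <= rho by rewrite /rho; lra.
have cabsP x : cabs x <= rho -> cabs (P x) <= (2 * rho) ^+ size S.
  move=> xr; rewrite /P.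
  have : {subset S <= S} by [].
  elim: {1 3 4}S => [|s T IH] TS; first by rewrite big_nil cabs1.
  rewrite big_cons cabsM exprS ler_pM ?cabs_ge0 //.
    have /TS/Sr : s \in s :: T by rewrite mem_head.
    by have := cabsB x s; lra.
  by apply: IH => y yT; apply: TS; rewrite inE yT orbT.
have Pz : 0 < cabs (P z).
  rewrite cabs_gt0 /P prodf_seq_neq0; apply/allP => s sS /=.
  by rewrite subr_eq0; apply: contraNneq zS => ->.
have jP x : jet2 P x.
  rewrite /P; elim: (S) => [|s T IH].
    by have := @jet2_cst 1 x; congr jet2; apply/funext => y; rewrite big_nil.
  have := jet2M (@jet2_subr s x) IH; congr jet2.
  by apply/funext => y; rewrite big_cons.
have cP x : cont_within setT P x.
  rewrite /P; elim: (S) => [|s T IH].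
    have := @cont_within_cst _ setT 1 x; congr cont_within.
    by apply/funext => y; rewrite big_nil.
  have := cont_withinM (cont_withinD (@cont_within_id _ setT x) (@cont_within_cst _ setT (- s) x)) IH.
  by congr cont_within; apply/funext => y; rewrite big_cons.
have key n : (cabs (u z) / e) ^+ n.+1 <= (2 * rho) ^+ size S / cabs (P z).
  rewrite ler_pdivlMr // expr_div_n mulrAC ler_pdivrMr ?exprn_gt0 //.
  rewrite -cabsX -cabsM.
  apply: (@maximum_principle (fun z => u z ^+ n.+1 * P z) rho).
  - by rewrite mulr_ge0 ?exprn_ge0 // ?mulr_ge0 // ltW.
  - by move=> x; apply: cont_withinM => //; exact: cont_withinXn.
  - move=> x xr; have [xS|xS] := boolP (x \in S); last first.
      by right; apply: jet2M => //; apply/jet2X/ju.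
    left; rewrite /P; apply/eqP; rewrite mulf_eq0; apply/orP; right.
    by rewrite prodf_seq_eq0; apply/hasP; exists x => //=; rewrite subrr.
  - move=> x xr; rewrite cabsM cabsX mulrC ler_pM ?cabs_ge0 ?exprn_ge0 ?cabs_ge0 //.
      by apply: cabsP; rewrite xr.
    rewrite ler_pXn2r ?nnegrE ?cabs_ge0 ?(ltW e0) //; apply: ur; rewrite xr /rho; lra.
  - by rewrite /rho; lra.
rewrite leNgt; apply/negP => ue.
have d0 : 0 < cabs (u z) / e - 1 by rewrite subr_gt0 ltr_pdivlMr // mul1r.
have bern n : 1 + n%:R * (cabs (u z) / e - 1) <= (cabs (u z) / e) ^+ n.
  elim: n => [|n IH]; first by rewrite expr0 mul0r addr0.
  rewrite exprS -natr1; move: IH d0; set q := _ / e; set Q := q ^+ n.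
  have : 0 <= n%:R :> R by [].
  move: (n%:R : R) => y y0 IH q1.
  have q0 : 0 <= q by lra.
  have := ler_wpM2l q0 IH; have : 0 <= y * (q - 1) ^+ 2 by rewrite mulr_ge0 ?sqr_ge0.
  lra.
set B := (2 * rho) ^+ size S / cabs (P z) in key.
have /archi_boundP : 0 <= B / (cabs (u z) / e - 1).
  by rewrite divr_ge0 ?(ltW d0) // divr_ge0 ?exprn_ge0 ?mulr_ge0 // ltW.
set n := Num.bound _; rewrite ltr_pdivrMr // => hn.
have := key n; have := bern n.+1; rewrite -natr1 mulrDl; lra.
Qed.
End MaximumPrinciple.

(** * Rules of differentiation, and affine functions *)

Section Caratheodory.
Context (R : realType).
Implicit Types (z w p c s : R[i]) (A : set R[i]) (f g v : R[i] -> R[i]).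

(** Caratheodory's form of differentiability, from which the rules for products,
inverses and composites follow by algebra. *)
Lemma diff_withinP A f p c : diff_within A f p c <->
  exists g (d : R), [/\ 0 < d, cont_within A g p, g p = c &
    forall z, A z -> cabs (z - p) < d -> f z = f p + g z * (z - p)].
Proof.
split=> [df|[g [d [d0 gc gp h]]] e e0].
  exists (fun z => if z == p then c else (f z - f p) / (z - p)), 1; split => //.
  - move=> e e0; have e20 : 0 < e / 2 by rewrite divr_gt0.
    have [d d0 h] := df _ e20; exists d => // z Az zd; rewrite eqxx.
    case: eqVneq => [_|zp]; first by rewrite subrr cabs0.
    have zp0 : z - p != 0 by rewrite subr_eq0.
    have := h z Az zd.
    have -> : f z - f p - c * (z - p) = ((f z - f p) / (z - p) - c) * (z - p) by field.
    by rewrite cabsM ler_pM2r ?cabs_gt0 //; lra.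
  - by rewrite eqxx.
  - move=> z Az _; case: eqVneq => [->|zp]; first by ring.
    by field; rewrite subr_eq0.
have [d' d'0 h'] := gc _ e0; exists (Num.min d d'); first by rewrite lt_min d0.
move=> z Az; rewrite lt_min => /andP[zd zd'].
rewrite (h z Az zd) -gp.
have -> : f p + g z * (z - p) - f p - g p * (z - p) = (g z - g p) * (z - p) by ring.
by rewrite cabsM ler_wpM2r ?cabs_ge0 // ltW // h'.
Qed.

Lemma diff_withinM A f g p a b : diff_within A f p a -> diff_within A g p b ->
  diff_within A (fun z => f z * g z) p (a * g p + f p * b).
Proof.
move=> fa gb; have cg := diff_within_cont gb.
move: fa gb => /diff_withinP[h [d [d0 hc hp hf]]] /diff_withinP[k [d' [d'0 kc kp kg]]].
apply/diff_withinP; exists (fun z => h z * g z + f p * k z), (Num.min d d'); split.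
- by rewrite lt_min d0.
- by apply: cont_withinD; apply: cont_withinM => //; exact: cont_within_cst.
- by rewrite hp kp.
- move=> z Az; rewrite lt_min => /andP[zd zd'].
  by rewrite (hf z) // (kg z) //; ring.
Qed.

Lemma diff_withinV A f p a : f p != 0 -> diff_within A f p a ->
  diff_within A (fun z => (f z)^-1) p (- a / f p ^+ 2).
Proof.
move=> f0 fa; have cf := diff_within_cont fa.
move: fa => /diff_withinP[h [d [d0 hc hp hf]]].
have f00 : 0 < cabs (f p) by rewrite cabs_gt0.
have [d' d'0 hn] := cf _ f00.
apply/diff_withinP; exists (fun z => - h z * ((f z)^-1 * (f p)^-1)), (Num.min d d'); split.
- by rewrite lt_min d0.
- apply: cont_withinM.
    have := cont_withinM (@cont_within_cst _ A (-1) p) hc.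
    by congr cont_within; apply/funext => z; rewrite mulN1r.
  by apply: cont_withinM; [exact: cont_withinV|exact: cont_within_cst].
- by rewrite hp; field.
- move=> z Az; rewrite lt_min => /andP[zd zd'].
  have fz0 : f z != 0.
    by apply: contraTneq (hn z Az zd') => ->; rewrite sub0r cabsN ltxx.
  have -> : - h z * ((f z)^-1 / f p) * (z - p) = - (h z * (z - p)) * ((f z)^-1 / f p) by ring.
  have -> : h z * (z - p) = f z - f p by rewrite [in RHS](hf z) //; ring.
  by field; rewrite fz0 f0.
Qed.

Lemma diff_within_comp A f g p a b : diff_within setT f (g p) a ->
  diff_within A g p b -> diff_within A (fun z => f (g z)) p (a * b).
Proof.
move=> fa gb; have cg := diff_within_cont gb.
move: fa gb => /diff_withinP[h [d [d0 hc hp hf]]] /diff_withinP[k [d' [d'0 kc kp kg]]].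
have [d'' d''0 hn] := cg _ d0.
apply/diff_withinP; exists (fun z => h (g z) * k z), (Num.min d' d''); split.
- by rewrite lt_min d'0.
- by apply: cont_withinM => //; apply: (cont_within_comp (B := setT)).
- by rewrite hp kp.
- move=> z Az; rewrite lt_min => /andP[zd' zd''].
  rewrite (hf (g z)) //; last exact: hn.
  by rewrite [in g z - _](kg z) //; ring.
Qed.

Lemma diff_within_horner A (P : {poly R[i]}) p : diff_within A (horner P) p P^`().[p].
Proof.
have /factor_theorem[q qE] : root (P - P.[p]%:P) p by rewrite /root !hornerE subrr.
have PE : P = q * ('X - p%:P) + P.[p]%:P by rewrite -qE subrK.
apply/diff_withinP; exists (horner q), 1; split=> //.
- exact: cont_within_horner.
- by rewrite {1}PE derivD derivC addr0 derivM derivXsubC !hornerE subrr mulr0 add0r.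
- by move=> z _ _; rewrite {1}PE !hornerE addrC.
Qed.

Lemma diff_within_qeval A (Q : qdiff R) p : ~~ pole Q p ->
  exists c, diff_within A (qeval Q) p c.
Proof.
move=> np; eexists; apply: diff_withinM; first exact: diff_within_horner.
by apply: diff_withinV; [exact: np|exact: diff_within_horner].
Qed.

(** Near p, df stays near c = df(p) rather than -c, by Darboux's theorem.  So
df(z) - c = (S(z) - S(p)) / (df(z) + c), and df is differentiable at p together with S. *)
Lemma jet2_square_derivative f df S p a (r : R) : 0 < r ->
  (forall z, cabs (z - p) < r -> diff_within setT f z (df z)) ->
  (forall z, cabs (z - p) < r -> df z ^+ 2 = S z) ->
  S p != 0 -> diff_within setT S p a -> jet2 f p.
Proof.
move=> r0 hdf hS Sp hSa.
have pr : cabs (p - p) < r by rewrite subrr cabs0.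
pose c := df p; have cS : c ^+ 2 = S p by exact: hS.
have c0 : c != 0 by apply: contraNneq Sp => c0; rewrite -cS c0 expr0n.
have c00 : 0 < cabs c by rewrite cabs_gt0.
have [|d d0 hd] := diff_within_cont hSa (e := 1 / 2 * cabs c ^+ 2).
  by rewrite mulr_gt0 // exprn_gt0.
pose A := [set z | cabs (z - p) < Num.min r d].
have cA : convex_plane A by move=> x y t Ax Ay t01; exact: cabs_seg.
have [|||c' cc' hc] := @sqrt_derivative_sign R A f df c (1 / 2) cA c0.
- by lra.
- by move=> z; rewrite /A /= lt_min => /andP[/hdf].
- move=> z; rewrite /A /= lt_min => /andP[zr zd].
  by rewrite hS // cS ltW // hd.
have Ap : A p by rewrite /A /= subrr cabs0 lt_min r0.
have {c' cc'}hc z : A z -> 0 < complex.Re (df z / c).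
  move=> Az; case: cc' hc => -> hc; first exact: hc.
  have := hc p Ap; rewrite -/c invrN mulrN divff // ReN /=; lra.
have hD z : A z -> cabs (df z - c) * cabs c <= cabs (S z - S p).
  move=> Az; have := half_plane_dist (hc z Az); rewrite cS hS //.
  by move: Az; rewrite /A /= lt_min => /andP[].
suff : diff_within setT df p (a / (2 * c)) by apply: jet2_derivative hdf.
move=> e e0.
have a0 := cabs_ge0 a.
pose K := (cabs a + 1) / cabs c.
have K0 : 0 < K by rewrite divr_gt0 //; lra.
have [d1 d10 h1] := hSa _ ltr01.
have ec : 0 < e * cabs c by rewrite mulr_gt0.
have [d2 d20 h2] := hSa _ ec.
have K2 : 0 < e * cabs c / K ^+ 2 by rewrite divr_gt0 // exprn_gt0.
exists (Num.min (Num.min r d) (Num.min d1 (Num.min d2 (e * cabs c / K ^+ 2)))).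
  by rewrite !lt_min r0 d0 d10 d20.
move=> z _; rewrite lt_min => /andP[Az]; rewrite !lt_min => /and3P[zd1 zd2 zd3].
have B1 := h1 z I zd1; have B2 := h2 z I zd2; have B3 := hD z Az.
rewrite ltr_pdivlMr ?exprn_gt0 // in zd3.
have zS : df z ^+ 2 = S z by apply: hS; move: Az; rewrite /A /= lt_min => /andP[].
have -> : df z - df p - a / (2 * c) * (z - p) =
  (S z - S p - a * (z - p) - (df z - c) ^+ 2) / (2 * c).
  by rewrite -zS -cS /c; field.
rewrite cabsM cabsV cabsM (_ : cabs 2 = 2); last first.
  by have := @cabs_real R 2; rewrite ger0_norm // => <-; congr cabs; rewrite rmorph_nat.
rewrite ler_pdivrMr ?mulr_gt0 //.
apply: le_trans (cabsB _ _) _; rewrite cabsX.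
have B4 : cabs (df z - c) <= K * cabs (z - p).
  rewrite /K mulrAC ler_pdivlMr //; apply: le_trans B3 _.
  have := cabsD (S z - S p - a * (z - p)) (a * (z - p)); rewrite subrK cabsM; lra.
have B5 : cabs (df z - c) ^+ 2 <= (K * cabs (z - p)) ^+ 2.
  by rewrite ler_pXn2r // nnegrE ?cabs_ge0 // mulr_ge0 ?cabs_ge0 ?ltW.
have : cabs (z - p) * (cabs (z - p) * K ^+ 2) <= cabs (z - p) * (e * cabs c).
  by rewrite ler_wpM2l ?cabs_ge0 // ltW.
by move: B5; rewrite exprMn; lra.
Qed.

Lemma isolated_seq (S : seq R[i]) p :
  exists2 r : R, 0 < r & forall z, z != p -> cabs (z - p) < r -> z \notin S.
Proof.
elim: S => [|s S [r r0 hr]]; first by exists 1.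
have [->|sp] := eqVneq s p.
  by exists r => // z zp zr; rewrite inE negb_or zp hr.
exists (Num.min r (cabs (s - p))); first by rewrite lt_min r0 cabs_gt0 subr_eq0.
move=> z zp; rewrite lt_min => /andP[zr zs]; rewrite inE negb_or hr // andbT.
by apply: contraTneq zs => ->; rewrite ltxx.
Qed.

Lemma exists_notin_seq (S : seq R[i]) p (d : R) : 0 < d ->
  exists2 z, z \notin S & z != p /\ cabs (z - p) < d.
Proof.
move=> d0; have [r r0 hr] := isolated_seq S p.
have r20 : 0 < r / 2 by rewrite divr_gt0.
have [t t0 [td tr]] := exists_small d0 r20.
have E : cabs (p + t%:C%C - p) = t by rewrite addrC addKr cabs_real gtr0_norm.
have zp : p + t%:C%C != p by rewrite -subr_eq0 -cabs_eq0 E gt_eqF.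
exists (p + t%:C%C); last by rewrite E.
by apply: hr => //; rewrite E; move: tr; lra.
Qed.

Lemma cont_within_local A f g p (r : R) : 0 < r ->
  (forall z, cabs (z - p) < r -> f z = g z) -> cont_within A f p -> cont_within A g p.
Proof.
move=> r0 fg cf e /cf[d d0 h]; exists (Num.min r d); first by rewrite lt_min r0.
move=> z Az; rewrite lt_min => /andP[zr zd]; rewrite -!fg ?subrr ?cabs0 //; exact: h.
Qed.

(** The difference quotient of F at a regular point z0, minus a, extends continuously
to z0 and tends to 0 at infinity, so it vanishes identically. *)
Lemma affine_of_jet2 F (S : seq R[i]) a :
  (forall z, cont_within setT F z) -> (forall z, z \notin S -> jet2 F z) ->
  (forall e : R, 0 < e -> exists2 r : R, 0 < r & forall z, r < cabs z ->
    cabs (F z - a * z) <= e * cabs z) ->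
  exists b, forall z, F z = a * z + b.
Proof.
move=> cF jF Foo.
have [z0 z0S _] := exists_notin_seq S 0 ltr01.
have [c [g [d [d0 gc hF]]]] := jF _ z0S.
pose u z := if z == z0 then c - a else (F z - F z0) / (z - z0) - a.
have uE z : z != z0 -> u z = (F z - F z0) / (z - z0) - a by move=> /negbTE zz; rewrite /u zz.
have loc (z : R[i]) : z != z0 -> forall y, cabs (y - z) < cabs (z - z0) -> y != z0.
  by move=> zz y; apply: contraTneq => ->; rewrite cabs_distC ltxx.
have cu z : cont_within setT u z.
  have [->|zz] := eqVneq z z0.
    move=> e e0.
    have gb : cont_within setT (fun z => g z * (z - z0)) z0.
      apply: cont_withinM => //; apply: cont_withinD; [exact: cont_within_id|exact: cont_within_cst].
    have [d' d'0 h'] := gb _ e0.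
    exists (Num.min d d'); first by rewrite lt_min d0.
    move=> y _; rewrite lt_min => /andP[yd yd']; rewrite /u eqxx.
    case: eqVneq => [_|yz]; first by rewrite subrr cabs0.
    have yz0 : y - z0 != 0 by rewrite subr_eq0.
    have := h' y I yd'; rewrite (hF y) // subrr mulr0 subr0.
    have -> : (F z0 + c * (y - z0) + g y * (y - z0) ^+ 2 - F z0) / (y - z0) - a - (c - a) =
      g y * (y - z0) by field.
    by [].
  have zz0 : 0 < cabs (z - z0) by rewrite cabs_gt0 subr_eq0.
  apply: (@cont_within_local _ (fun y => (F y + - F z0) * (y - z0)^-1 + - a) _ _ _ zz0).
    by move=> y /(loc z zz) yz; rewrite uE.
  have cc b : cont_within setT (fun=> b) z by exact: cont_within_cst.
  apply: cont_withinD => //; apply: cont_withinM; first exact: cont_withinD.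
  apply: cont_withinV; first by rewrite subr_eq0.
  by apply: cont_withinD => //; exact: cont_within_id.
have ju z : z \notin z0 :: S -> jet2 u z.
  rewrite inE negb_or => /andP[zz zS].
  have zz0 : 0 < cabs (z - z0) by rewrite cabs_gt0 subr_eq0.
  apply: (@jet2_local _ (fun y => (F y + - F z0) * (y - z0)^-1 + - a) _ _ _ zz0).
    by move=> y /(loc z zz) yz; rewrite uE.
  apply: jet2D; last exact: jet2_cst.
  apply: jet2M; last exact: jet2_inv.
  by apply: jet2D; [exact: jF|exact: jet2_cst].
have uoo e : 0 < e -> exists2 r : R, 0 < r & forall z, r < cabs z -> cabs (u z) <= e.
  move=> e0; have e40 : 0 < e / 4 by rewrite divr_gt0.
  have [r r0 hr] := Foo _ e40.
  pose K := cabs (F z0 - a * z0).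
  have K0 : 0 <= K by exact: cabs_ge0.
  have zc := cabs_ge0 z0.
  have KK : 0 <= K / (e / 4) by rewrite divr_ge0 // ltW.
  exists (r + 2 * cabs z0 + K / (e / 4)); first by lra.
  move=> z zr.
  have hz := hr z ltac:(lra).
  have zz : z != z0 by apply: contraTneq zr => ->; rewrite -leNgt; lra.
  have zz1 : z - z0 != 0 by rewrite subr_eq0.
  rewrite uE //.
  have -> : (F z - F z0) / (z - z0) - a = ((F z - a * z) - (F z0 - a * z0)) / (z - z0).
    by field.
  rewrite cabsM cabsV ler_pdivrMr ?cabs_gt0 //.
  apply: le_trans (cabsB _ _) _; rewrite -/K.
  have B1 : K <= e / 4 * cabs z by rewrite mulrC -ler_pdivrMr //; lra.
  have B2 := cabs_dist_le z z0.
  have : e * (cabs z / 2) <= e * cabs (z - z0) by rewrite ler_pM2l //; lra.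
  lra.
have u0 := jet2_vanishing cu ju uoo.
have uF z : z \notin z0 :: S -> F z = a * z + (F z0 - a * z0).
  move=> zS; have := u0 z zS; move: zS; rewrite inE negb_or => /andP[zz _]; rewrite uE //.
  have zz1 : z - z0 != 0 by rewrite subr_eq0.
  move=> /eqP; rewrite subr_eq0 => /eqP h.
  have : F z - F z0 = a * (z - z0) by rewrite -h divfK.
  by move=> h2; rewrite -[F z](subrK (F z0)) h2; ring.
exists (F z0 - a * z0) => z.
set b := F z0 - a * z0.
have cD : cont_within setT (fun z => F z - (a * z + b)) z.
  apply: cont_withinD => //.
  have := @cont_within_horner _ setT (- (a *: 'X + b%:P)) z; congr cont_within.
  by apply/funext => y; rewrite !hornerE.
apply/eqP; rewrite -subr_eq0 -cabs_eq0 eq_le cabs_ge0 andbT.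
apply/ler_addgt0Pr => e e0; rewrite add0r.
have [q q0 hq] := cD _ e0.
have [y yS [_ yz]] := exists_notin_seq (z0 :: S) z q0.
by have := hq y I yz; rewrite uF // subrr sub0r cabsN => /ltW.
Qed.
End Caratheodory.

(** * Derivatives of maps that pull back quadratic differentials *)

Section PullbackDerivative.
Context (R : realType).
Implicit Types (z w p c s : R[i]) (A : set R[i]) (f g psi : R[i] -> R[i]) (Q : qdiff R).

(** [p] is neither a zero nor a pole. *)
Definition regular Q p := ~~ root (qnum Q * qden Q) p.

Lemma regularP Q p : reflect (~~ pole Q p /\ qeval Q p != 0) (regular Q p).
Proof.
rewrite /regular /pole /qeval rootM negb_or /root; apply: (iffP andP) => -[h1 h2].
  by split => //; rewrite mulf_neq0 ?invr_eq0.
by split => //; apply: contraNneq h2 => ->; rewrite mul0r.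
Qed.

Lemma regular_near Q p : regular Q p ->
  exists2 r : R, 0 < r & forall z, cabs (z - p) < r -> regular Q z.
Proof.
rewrite /regular /root => rp.
have cp : 0 < cabs (qnum Q * qden Q).[p] by rewrite cabs_gt0.
have [d d0 h] := @cont_within_horner _ setT (qnum Q * qden Q) p _ cp.
exists d => // z zd; have := h z I zd.
by apply: contraTN => /eqP ->; rewrite sub0r cabsN ltxx.
Qed.

(** The square of psi' is P / Q(psi), which has a nonzero limit at z0.  At an interior
point z0 this shows that psi'(z0) <> 0. *)
Lemma pullback_derivative Q psi dpsi P z0 (r : R) : cdisc R z0 -> 0 < r ->
  (forall z, cdisc R z -> cabs (z - z0) < r -> cont_within (cdisc R) psi z) ->
  (forall z, disc R z -> cabs (z - z0) < r -> diff_within setT psi z (dpsi z)) ->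
  (forall z, disc R z -> cabs (z - z0) < r -> ~~ pole Q (psi z) ->
     P z = qeval Q (psi z) * dpsi z ^+ 2) ->
  cont_within (cdisc R) P z0 -> P z0 != 0 -> regular Q (psi z0) ->
  exists2 a, a ^+ 2 * qeval Q (psi z0) = P z0 & diff_within (cdisc R) psi z0 a.
Proof.
move=> z0d r0 cpsi hd hP cP P0 rQ.
have /regularP[np Q0] := rQ.
have [q q0 hq] := regular_near rQ.
have zz : cabs (z0 - z0) < r by rewrite subrr cabs0.
have cz0 := cpsi z0 z0d zz.
have [d d0 hd'] := cz0 _ q0.
have cQ : cont_within (cdisc R) (fun z => P z * (qeval Q (psi z))^-1) z0.
  apply: cont_withinM => //; apply: cont_withinV => //.
  apply: (cont_within_comp (B := setT)) => //; exact: cont_within_qeval.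
have dc : disc R `<=` cdisc R by move=> z /ltW.
have [||||a ha da] := @disc_derivative _ psi dpsi z0 (P z0 / qeval Q (psi z0)) r z0d r0.
- by rewrite mulf_neq0 ?invr_eq0.
- exact: cpsi.
- exact: hd.
- move=> e e0; have [d' d'0 h'] := cQ _ e0.
  exists (Num.min r (Num.min d d')); first by rewrite !lt_min r0 d0.
  move=> z zd; rewrite !lt_min => /and3P[zr z1 z2].
  have /hq/regularP[npz Qz] := hd' z (dc z zd) z1.
  by have := h' z (dc z zd) z2; rewrite (hP z zd zr npz) [qeval _ _ * _]mulrC mulfK.
by exists a => //; rewrite ha divfK.
Qed.

Lemma transition_derivative Q1 Q2 psi1 psi2 dpsi1 dpsi2 h F P A z0 (r : R) : 
  A `<=` cdisc R -> A z0 -> 0 < r ->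
  (forall z, cdisc R z -> cabs (z - z0) < r ->
     cont_within (cdisc R) psi1 z /\ cont_within (cdisc R) psi2 z) ->
  (forall z, disc R z -> cabs (z - z0) < r ->
     diff_within setT psi1 z (dpsi1 z) /\ diff_within setT psi2 z (dpsi2 z)) ->
  (forall z, disc R z -> cabs (z - z0) < r ->
     (~~ pole Q1 (psi1 z) -> P z = qeval Q1 (psi1 z) * dpsi1 z ^+ 2) /\
     (~~ pole Q2 (psi2 z) -> P z = qeval Q2 (psi2 z) * dpsi2 z ^+ 2)) ->
  cont_within (cdisc R) P z0 -> P z0 != 0 ->
  regular Q1 (psi1 z0) -> regular Q2 (psi2 z0) ->
  (forall z, A z -> h (psi1 z) = z) -> (forall z, A z -> F (psi1 z) = psi2 z) ->
  cont_within (psi1 @` A) h (psi1 z0) ->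
  exists2 c, c ^+ 2 = qeval Q1 (psi1 z0) / qeval Q2 (psi2 z0) &
    diff_within (psi1 @` A) F (psi1 z0) c.
Proof.
move=> AD Az r0 cp dp hP cP P0 rQ1 rQ2 hh hF ch.
have zd := AD _ Az.
have [|||a1 ha1 da1] := @pullback_derivative Q1 psi1 dpsi1 P z0 r zd r0 _ _ _ cP P0 rQ1.
- by move=> z z1 z2; have [] := cp z z1 z2.
- by move=> z z1 z2; have [] := dp z z1 z2.
- by move=> z z1 z2; have [] := hP z z1 z2.
have [|||a2 ha2 da2] := @pullback_derivative Q2 psi2 dpsi2 P z0 r zd r0 _ _ _ cP P0 rQ2.
- by move=> z z1 z2; have [] := cp z z1 z2.
- by move=> z z1 z2; have [] := dp z z1 z2.
- by move=> z z1 z2; have [] := hP z z1 z2.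
have /regularP[_ q1] := rQ1; have /regularP[_ q2] := rQ2.
have a10 : a1 != 0 by apply: contraNneq P0 => a0; rewrite -ha1 a0 expr0n mul0r.
exists (a2 / a1).
  have -> : qeval Q2 (psi2 z0) = a1 ^+ 2 * qeval Q1 (psi1 z0) / a2 ^+ 2.
    rewrite ha1 -ha2 mulrAC mulfV ?mul1r // expf_neq0 //.
    by apply: contraNneq P0 => a0; rewrite -ha2 a0 expr0n mul0r.
  have a20 : a2 != 0 by apply: contraNneq P0 => a0; rewrite -ha2 a0 expr0n mul0r.
  by field; rewrite q1 a10 a20.
exact: (diff_within_quotient a10 hh hF Az ch (diff_within_sub AD da1) (diff_within_sub AD da2)).
Qed.

End PullbackDerivative.

(** * The two sides of a Jordan curve *)

Section InsideOutside.
Context (R : realType).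
Implicit Types (z w p c s : R[i]) (A G : set R[i]) (f g psi : R[i] -> R[i]) (Q : qdiff R).

Lemma compact_circle : compact (circle R).
Proof.
apply: subclosed_compact (@compact_closed_disc R 1) _ => [z cz|]; last first.
  by rewrite circleE => z /= ->.
rewrite circleE /=; apply/eqP; rewrite -subr_eq0 -normr_le0.
apply/ler_addgt0Pr => e e0; rewrite add0r.
have /closureP/(_ _ e0)[w] := cz; rewrite circleE /= => w1 wz.
have := cabs_dist_le z w; have := cabs_dist_le w z.
by rewrite (cabs_distC z w) ler_norml => h1 h2; lra.
Qed.

Lemma hausdorff_plane : hausdorff_space R[i].
Proof.
move=> p q pq; apply/eqP/negPn/negP => npq.
have d0 : 0 < cabs (p - q) / 2 by rewrite divr_gt0 // cabs_gt0 subr_eq0.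
have [||x [/= xp xq]] := pq [set x | cabs (x - p) < cabs (p - q) / 2] [set x | cabs (x - q) < cabs (p - q) / 2].
- by apply/nbhs_cabsP; exists (cabs (p - q) / 2).
- by apply/nbhs_cabsP; exists (cabs (p - q) / 2).
have := cabsB (x - q) (x - p); have -> : x - q - (x - p) = p - q by ring.
lra.
Qed.

Lemma jordan_curve_closed G : jordan_curve G -> closed G.
Proof.
move=> [g [cg _ ->]]; apply: compact_closed; first exact: hausdorff_plane.
exact: continuous_compact cg compact_circle.
Qed.

Lemma connected_seg p q : connected (seg p q @` `[0, 1]).
Proof.
apply: connected_continuous_connected; first exact: segment_connected.
apply: continuous_subspaceT => t B /nbhs_cabsP[e e0 eB].
have K0 : 0 < cabs (q - p) + 1 by have := cabs_ge0 (q - p); lra.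
exists (e / (cabs (q - p) + 1)); first by rewrite /= divr_gt0.
move=> s; rewrite /ball_ /= ltr_pdivlMr // => st; apply: eB.
have -> : seg p q s - seg p q t = (s - t)%:C%C * (q - p).
  by rewrite /seg rmorphB /=; ring.
rewrite cabsM cabs_real distrC; apply: le_lt_trans st.
by rewrite ler_wpM2l //; lra.
Qed.

(** Small discs are connected, being unions of segments, so components of an open
set of the plane are open. *)
Lemma component_near G p : closed G -> ~ G p -> exists2 r : R, 0 < r &
  forall z, cabs (z - p) < r -> ~ G z /\
    connected_component (~` G) z = connected_component (~` G) p.
Proof.
move=> cG nGp; have /open_cabsP oG : open (~` G) by exact: closed_openC.
have [r r0 hr] := oG p nGp; exists r => // z zr; split; first exact: hr.
apply/esym/same_connected_component.
exists (seg p z @` `[0, 1]); last first.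
  by exists 1; rewrite ?seg1 //= in_itv /= ler01 lexx.
split.
- by exists 0; rewrite ?seg0 //= in_itv /= ler01 lexx.
- move=> y [t /=]; rewrite in_itv /= => t01 <-; apply: hr.
  by apply: cabs_seg => //; rewrite subrr cabs0.
- exact: connected_seg.
Qed.

Lemma open_inside G : closed G -> open (inside G).
Proof.
move=> cG; apply/open_cabsP => p [nGp bp].
have [r r0 hr] := component_near cG nGp; exists r => // z /hr[nGz e].
by split => //; rewrite e.
Qed.

Lemma open_outside G : closed G -> open (outside G).
Proof.
move=> cG; apply/open_cabsP => p [nGp bp].
have [r r0 hr] := component_near cG nGp; exists r => // z /hr[nGz e].
by split => //; rewrite e.
Qed.

Lemma inside_or_outside G p : ~ G p -> inside G p \/ outside G p.
Proof.
move=> nG; have [b|nb] := pselect (bounded_set (connected_component (~` G) p)).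
  by left.
by right.
Qed.

Lemma inside_outside G p : inside G p -> outside G p -> False.
Proof. by move=> [_ b] [_ nb]. Qed.

(** The distance from g(z) to g(w) has a positive minimum over the compact set of
the w in A at distance at least e from z. *)
Lemma continuous_injection_inverse g A : compact A -> {within A, continuous g} ->
  set_inj A g -> forall z, A z -> forall e : R, 0 < e -> exists2 d : R, 0 < d &
    forall w, A w -> cabs (g w - g z) < d -> cabs (w - z) < e.
Proof.
move=> cA cg ig z Az e e0.
pose B := A `&` [set w | e <= cabs (w - z)].
have cB : compact B.
  apply: (subclosed_compact _ cA); last by move=> w [].
  apply: closedI; first by apply: compact_closed; [exact: hausdorff_plane|].
  rewrite -(setCK [set w | e <= _]); apply: open_closedC.
  apply/open_cabsP => w /=; move/negP; rewrite -ltNge => we.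
  exists (e - cabs (w - z)); first by rewrite subr_gt0.
  move=> y yw; apply/negP; rewrite -ltNge.
  by have := cabsD (y - w) (w - z); rewrite addrA subrK; lra.
have [[b Bb]|nB] := pselect (B !=set0); last first.
  exists 1 => // w Aw _; rewrite ltNge; apply/negP => h; apply: nB; exists w; split => //.
have [|m] := @compact_EVT_min _ R (fun w => cabs (g w - g z)) B (ex_intro _ b Bb) cB.
  apply/subspace_continuousP => w [Aw we].
  have /within_continuousP/(_ w Aw) cw := cg.
  move=> U [k /= k0 kU]; have [d d0 hd] := cw _ k0.
  apply/nbhs_cabsP; exists d => // y yd [Ay _]; apply: kU; rewrite /ball_ /=.
  apply: le_lt_trans (hd y Ay yd).
  have := cabs_dist_le (g y - g z) (g w - g z).
  have := cabs_dist_le (g w - g z) (g y - g z).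
  have -> : g w - g z - (g y - g z) = - (g y - g w) by ring.
  have -> : g y - g z - (g w - g z) = g y - g w by ring.
  by rewrite cabsN ler_norml => h1 h2; lra.
rewrite inE => -[Am me] mmin; exists (cabs (g m - g z)).
  rewrite cabs_gt0 subr_eq0; apply/negP => /eqP /(ig m z); rewrite !inE => /(_ Am Az) mz.
  by move: me; rewrite /= mz subrr cabs0; lra.
move=> w Aw; apply: contraTT; rewrite -!leNgt => we; apply: mmin; rewrite inE; by split.
Qed.

End InsideOutside.

(** * The unit circle *)

Section UnitCircle.
Context (R : realType).
Implicit Types (a s t x : R) (z w p : R[i]).

Lemma expiD s t : expi (s + t) = expi s * expi t.
Proof.
by apply/eqP; rewrite eq_complex /expi /= cosD sinD addrC [in X in _ && X]addrC !eqxx /=.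
Qed.

Lemma cabs_expi t : cabs (expi t) = 1.
Proof.
apply/eqP; rewrite -(eqrXn2 (n := 2)) ?cabs_ge0 // expr1n sqr_cabs /=.
by rewrite cos2Dsin2.
Qed.

Lemma expi0 : expi 0 = 1 :> R[i].
Proof. by rewrite /expi cos0 sin0. Qed.

Lemma expi_neq0 t : expi t != 0.
Proof. by rewrite -cabs_gt0 cabs_expi. Qed.

Lemma expiD2pi t : expi (t + 2 * pi) = expi t.
Proof. by rewrite /expi mulr_natl cosD2pi sinD2pi. Qed.

Lemma expiDpi t : expi (t + pi) = - expi t.
Proof.
have -> : expi (t + pi) = expi t * expi pi by rewrite expiD.
have -> : expi pi = -1 :> R[i] by rewrite /expi cospi sinpi; apply/eqP; rewrite eq_complex /= oppr0 !eqxx.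
by rewrite mulrN1.
Qed.

Lemma expiD_2pi_int t (n : int) : expi (t + n%:~R * (2 * pi)) = expi t.
Proof.
have natE (k : nat) : (Posz k.+1)%:~R = k%:~R + 1 :> R.
  by rewrite -!pmulrn -natr1.
elim/int_ind: n => [|n IH|n IH]; first by rewrite mul0r addr0.
  by rewrite natE mulrDl mul1r addrA expiD2pi; exact: IH.
rewrite -(expiD2pi (t + _)) -[in RHS]IH; congr expi.
by rewrite !rmorphN /= natE; ring.
Qed.

Lemma sin_lip x y : `|sin x - sin y| <= `|x - y| :> R.
Proof.
wlog xy : x y / x < y.
  move=> W; have [/W//|yx|->] := ltgtP x y; last by rewrite !subrr.
  by rewrite distrC (distrC x); exact: W.
have [|c _ E] := @MVT R sin cos x y xy.
  by apply: continuous_subspaceT => u; exact: continuous_sin.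
by rewrite distrC E normrM (distrC x) ler_piMl // cos_max.
Qed.

Lemma cabs_expiB_le s t : cabs (expi s - expi t) <= 2 * `|s - t|.
Proof.
apply: le_trans (cabs_le_ReIm _) _.
have -> : complex.Im (expi s - expi t) = sin s - sin t by [].
have -> : complex.Re (expi s - expi t) = sin (s + pi / 2) - sin (t + pi / 2).
  by rewrite !sinDpihalf.
have := sin_lip s t; have := sin_lip (s + pi / 2) (t + pi / 2).
have -> : s + pi / 2 - (t + pi / 2) = s - t by ring.
lra.
Qed.

(** The derivative of the sine at 0 is 1. *)
Lemma cabs_expiB_ge : exists2 d : R, 0 < d & forall s t, `|s - t| < d ->
  `|s - t| / 2 <= cabs (expi s - expi t).
Proof.
have : u^-1 *: (sin (u *: 1 + 0) - sin 0) @[u --> 0^'] --> (cos 0 : R).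
  have [h <-] := is_derive_sin (0 : R).
  exact: h.
rewrite cos0 => /cvgrPdist_lt/(_ (1 / 2)) []; first by lra.
move=> d /= d0 hd; exists d => // s t st.
have -> : expi s - expi t = expi t * (expi (s - t) - 1).
  by rewrite mulrBr -expiD mulr1; congr (expi _ - _); ring.
rewrite cabsM cabs_expi mul1r.
have [->|n0] := eqVneq (s - t) 0; first by rewrite normr0 mul0r cabs_ge0.
have := hd (s - t); rewrite /ball_ /= sub0r normrN => /(_ st n0).
rewrite sin0 subr0 addr0 /GRing.scale /= mulr1 => h.
apply: le_trans (Im_le_cabs _).
have -> : complex.Im (expi (s - t) - 1) = sin (s - t) by rewrite /= subr0.
have {h} : 1 / 2 <= `|(s - t)^-1 * sin (s - t)|.
  have := ler_norm ((s - t)^-1 * sin (s - t)); move: h; rewrite ltr_norml; lra.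
by rewrite normrM normfV ler_pdivlMl ?normr_gt0 //; lra.
Qed.

Lemma expi_onto a z : cabs z = 1 -> exists2 t, a <= t < a + 2 * pi & expi t = z.
Proof.
move=> z1.
have [t0 t0z] : exists t, expi t = z.
  move/(congr1 (fun r => r ^+ 2)): z1; rewrite expr1n sqr_cabs; case: z => x y /= xy.
  have x1 : -1 <= x <= 1 by have := sqr_ge0 y; nra.
  have cx := acosK x1.
  have sx : sin (acos x) ^+ 2 = y ^+ 2 by rewrite sin2cos2 cx; lra.
  have /orP[/eqP h|/eqP h] : (sin (acos x) == y) || (sin (acos x) == - y).
    by rewrite -eqf_sqr sx.
    by exists (acos x); rewrite /expi cx h.
  by exists (- acos x); rewrite /expi cosN sinN cx h opprK.
have p0 : 0 < 2 * pi :> R by rewrite mulr_gt0 // pi_gt0.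
pose n : int := Num.floor ((t0 - a) / (2 * pi)).
exists (t0 + (- n)%:~R * (2 * pi)); last by rewrite expiD_2pi_int.
have := floor_itv ((t0 - a) / (2 * pi)); rewrite -/n => /andP[].
rewrite ler_pdivlMr // ltr_pdivrMr // intrD mulrDl rmorphN /=.
move: (n%:~R : R) => q h1 h2; rewrite /= mul1r in h2; rewrite mulNr; lra.
Qed.

Lemma cos_eq1 x : 0 <= x -> x < 2 * pi -> cos x = 1 -> x = 0.
Proof.
move=> x0 x1 c1; have [xp|xp] := leP x pi.
  by apply: cos_inj; rewrite ?in_itv /= ?x0 ?lexx ?pi_ge0 //; rewrite cos0.
have : 2 * pi - x = 0.
  apply: cos_inj; rewrite ?in_itv /= ?lexx ?pi_ge0 //; first by lra.
  have -> : 2 * pi - x = - x + pi *+ 2 by ring.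
  by rewrite cosD2pi cosN c1 cos0.
lra.
Qed.

Lemma expi_inj s t : `|s - t| < 2 * pi -> expi s = expi t -> s = t.
Proof.
move=> st E.
have c1 : cos `|s - t| = 1.
  rewrite cos_norm; have : expi (s - t) = 1.
    by rewrite expiD E -expiD subrr expi0.
  by case.
by apply/eqP; rewrite -subr_eq0 -normr_eq0; apply/eqP/cos_eq1.
Qed.

Lemma circle_expi t : circle R (expi t).
Proof. by rewrite circleE /= cabs_expi. Qed.

Lemma path_Re_continuous (u : R -> R[i]) t :
  (forall e : R, 0 < e -> exists2 d : R, 0 < d & forall s, `|s - t| < d -> cabs (u s - u t) < e) ->
  {for t, continuous (fun s => complex.Re (u s))} /\ {for t, continuous (fun s => complex.Im (u s))}.
Proof.
move=> cu; split=> B [e /= /cu[d d0 dh] eB]; exists d => // s; rewrite /ball_ /= distrC => sd;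
  apply: eB; rewrite /ball_ /= distrC; apply: le_lt_trans (dh s sd).
- by have := Re_le_cabs (u s - u t); rewrite ReD ReN.
- by have := Im_le_cabs (u s - u t); rewrite ImD; case: (u t).
Qed.

(** The stereographic coordinate on the circle, projected from the point 1. *)
Definition stereo z : R := complex.Im z / (1 - complex.Re z).

Lemma Re_lt1_circle z : cabs z = 1 -> z != 1 -> complex.Re z < 1.
Proof.
move/(congr1 (fun r => r ^+ 2)); rewrite expr1n sqr_cabs; case: z => x y /= xy z1.
rewrite lt_neqAle; apply/andP; split; last by have := sqr_ge0 y; nra.
apply: contraNneq z1 => x1; rewrite eq_complex /= x1 eqxx /=.
by move/eqP: xy; rewrite x1 expr1n -subr_eq0 addrC addKr sqrf_eq0.
Qed.

Lemma stereo_inj z w : cabs z = 1 -> cabs w = 1 -> z != 1 -> w != 1 ->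
  stereo z = stereo w -> z = w.
Proof.
move=> z1 w1 zn wn; have := Re_lt1_circle z1 zn; have := Re_lt1_circle w1 wn.
move: z1 w1 => /(congr1 (fun r => r ^+ 2)) + /(congr1 (fun r => r ^+ 2)).
rewrite /stereo expr1n !sqr_cabs; case: z w {zn wn} => x y [x' y'] /= h h' x1 x1' E.
have n1 : 1 - x != 0 by rewrite subr_eq0 gt_eqF.
have n1' : 1 - x' != 0 by rewrite subr_eq0 gt_eqF.
have yE : y = y' / (1 - x') * (1 - x) by rewrite -E divfK.
have k1 : y' / (1 - x') * (1 - x') = y' by rewrite divfK.
move: (y' / (1 - x')) yE k1 => k yE k1.
have K (a : R) : a < 1 -> a ^+ 2 + (k * (1 - a)) ^+ 2 = 1 -> a * (k ^+ 2 + 1) = k ^+ 2 - 1.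
  move=> a1 ha; have : (1 - a) * (a * (k ^+ 2 + 1) - (k ^+ 2 - 1)) = 0.
    transitivity (1 - (a ^+ 2 + (k * (1 - a)) ^+ 2)); last by rewrite ha subrr.
    ring.
  by move/eqP; rewrite mulf_eq0 subr_eq0 gt_eqF //= subr_eq0 => /eqP.
have xx : x = x'.
  have k0 : k ^+ 2 + 1 != 0 by have k2 := sqr_ge0 k; rewrite gt_eqF //; lra.
  by apply: (mulIf k0); rewrite !K // ?k1 // -yE.
by apply/eqP; rewrite eq_complex /= -xx eqxx yE -k1 xx eqxx.
Qed.

(** The inverse of a parametrisation, rotated so that some point of the disc goes to 1
and followed by the stereographic coordinate, would be continuous, real and
injective on a small circle of the disc.  But by the intermediate value theorem a
continuous real function on a circle takes the same value at two antipodal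
points. *)
Lemma jordan_curve_no_disc (G : set R[i]) p (r : R) : jordan_curve G -> 0 < r ->
  (forall z, cabs (z - p) < r -> G z) -> False.
Proof.
move=> [g [cg ig GE]] r0 rG.
have inv := continuous_injection_inverse (@compact_circle R) cg ig.
have r2 : 0 < r / 2 by rewrite divr_gt0.
have r4 : 0 < r / 4 by rewrite divr_gt0.
have : forall z, exists w, cabs (z - p) < r -> circle R w /\ g w = z.
  move=> z; have [/rG|] := pselect (cabs (z - p) < r); last by exists 0.
  by rewrite GE => -[w cw <-]; exists w.
move/choice => [h hh].
pose q : R[i] := p + (r / 2)%:C%C.
have qp : cabs (q - p) < r by rewrite /q addrC addKr cabs_real gtr0_norm //; lra.
have [hq gq] := hh q qp.
pose x t : R[i] := p + (r / 4)%:C%C * expi t.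
have xp t : cabs (x t - p) = r / 4.
  by rewrite /x addrC addKr cabsM cabs_real cabs_expi mulr1 gtr0_norm.
have xr t : cabs (x t - p) < r by rewrite xp; lra.
have y0 : h q != 0 by rewrite -cabs_gt0; move: hq; rewrite circleE /= => ->.
pose u t := h (x t) / h q.
have u1 t : cabs (u t) = 1.
  have [hx _] := hh _ (xr t); move: hq hx; rewrite circleE /= /u cabsM cabsV => -> ->.
  by rewrite divr1.
have un t : u t != 1.
  apply/eqP => E; have [hx gx] := hh _ (xr t).
  have : h (x t) = h q by rewrite -[h q]mul1r -E /u divfK.
  move=> /(congr1 g); rewrite gx gq => xq; have := xp t; rewrite xq.
  by rewrite /q addrC addKr cabs_real gtr0_norm //; lra.
have cu t (e : R) : 0 < e -> exists2 d : R, 0 < d & forall s, `|s - t| < d -> cabs (u s - u t) < e.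
  move=> e0; have [hx gx] := hh _ (xr t).
  have [d d0 hd] := inv _ hx _ e0.
  exists (d / r); first by rewrite divr_gt0.
  move=> s; rewrite ltr_pdivlMr // => st.
  have [hxs gxs] := hh _ (xr s).
  have -> : u s - u t = (h (x s) - h (x t)) / h q by rewrite /u mulrBl.
  rewrite cabsM cabsV; move: (hq); rewrite circleE /= => ->; rewrite divr1.
  apply: hd => //; rewrite gxs gx.
  have -> : x s - x t = (r / 4)%:C%C * (expi s - expi t) by rewrite /x; ring.
  rewrite cabsM cabs_real gtr0_norm //; have := cabs_expiB_le s t; nra.
pose phi t := stereo (u t).
have cphi : continuous phi.
  move=> t; have [cRe cIm] := path_Re_continuous (cu t).
  apply: (@continuousM _ _ (fun t => complex.Im (u t)) (fun t => (1 - complex.Re (u t))^-1)) => //.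
  apply: (@continuousV _ _ (fun t => 1 - complex.Re (u t))).
    by rewrite subr_eq0 gt_eqF // Re_lt1_circle.
  by apply: cvgB; [exact: cvg_cst|exact: cRe].
have phi2 t : phi (t + pi + pi) = phi t.
  by rewrite /phi /u /x !expiDpi opprK.
(* psi changes sign under t |-> t + pi *)
pose psi t := phi t - phi (t + pi).
have [||t _ pt] := @IVT R psi 0 pi 0 (pi_ge0 R).
- apply: continuous_subspaceT => t.
  apply: cvgB; first exact: cphi.
  apply: (@continuous_comp _ _ _ (fun t => t + pi) phi); last exact: cphi.
  by apply: cvgD; [exact: cvg_id|exact: cvg_cst].
- have -> : psi pi = - psi 0 by rewrite /psi -{2}[pi]add0r phi2 add0r opprB.
  by rewrite ge_min le_max; have [] := leP (psi 0) 0 => psi0; apply/andP; split; apply/orP; lra.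
have /stereo_inj : phi t = phi (t + pi) by apply/eqP; rewrite -subr_eq0; apply/eqP.
move=> /(_ (u1 _) (u1 _) (un _) (un _)) E.
have hE : h (x t) = h (x (t + pi)) by rewrite -[h _](divfK y0) -[RHS](divfK y0); congr (_ * _).
have [_ g1] := hh _ (xr t); have [_ g2] := hh _ (xr (t + pi)).
have : x t = x (t + pi) by rewrite -g1 -g2 hE.
rewrite /x expiDpi => /addrI /eqP; rewrite mulrN -subr_eq0 opprK -mulr2n mulrn_eq0 /=.
by rewrite mulf_eq0 (negbTE (expi_neq0 _)) orbF -cabs_eq0 cabs_real gtr0_norm // gt_eqF.
Qed.
End UnitCircle.

(** * Gluing along two closed sets that cover the plane *)

Section Covering.
Context (R : realType).
Implicit Types (z w p c x : R[i]) (A B K : set R[i]) (f g F : R[i] -> R[i]).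

Lemma closed_far A p : closed A -> ~ A p ->
  exists2 r : R, 0 < r & forall z, cabs (z - p) < r -> ~ A z.
Proof. by move=> cA Ap; have /open_cabsP/(_ p Ap) : open (~` A) by exact: closed_openC. Qed.

Lemma closed_cover_near A B p : closed A -> closed B -> (forall z, A z \/ B z) ->
  [\/ A p /\ B p,
     A p /\ exists2 r : R, 0 < r & forall z, cabs (z - p) < r -> A z
   | B p /\ exists2 r : R, 0 < r & forall z, cabs (z - p) < r -> B z].
Proof.
move=> cA cB AB.
have [Ap|nAp] := pselect (A p).
  have [Bp|nBp] := pselect (B p); first by constructor 1.
  constructor 2; split => //; have [r r0 hr] := closed_far cB nBp.
  by exists r => // z /hr; case: (AB z).
constructor 3; split; first by case: (AB p).
by have [r r0 hr] := closed_far cA nAp; exists r => // z /hr; case: (AB z).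
Qed.

Lemma cont_within_cover A B F p : closed A -> closed B -> (forall z, A z \/ B z) ->
  (A p -> cont_within A F p) -> (B p -> cont_within B F p) -> cont_within setT F p.
Proof.
move=> cA cB AB hA hB e e0.
have [[Ap Bp]|[Ap [r r0 hr]]|[Bp [r r0 hr]]] := closed_cover_near p cA cB AB.
- have [d d0 hd] := hA Ap e e0; have [d' d'0 hd'] := hB Bp e e0.
  exists (Num.min d d'); first by rewrite lt_min d0.
  by move=> z _; rewrite lt_min => /andP[z1 z2]; case: (AB z) => ?; [exact: hd|exact: hd'].
- have [d d0 hd] := hA Ap e e0.
  exists (Num.min r d); first by rewrite lt_min r0.
  by move=> z _; rewrite lt_min => /andP[/hr Az]; exact: hd.
- have [d d0 hd] := hB Bp e e0.
  exists (Num.min r d); first by rewrite lt_min r0.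
  by move=> z _; rewrite lt_min => /andP[/hr Az]; exact: hd.
Qed.

(** Where both sets are present the two derivatives are equal, since they can both be
computed along the intersection. *)
Lemma diff_within_cover A B F p (P : R[i] -> Prop) :
  closed A -> closed B -> (forall z, A z \/ B z) ->
  (A p -> exists2 c, P c & diff_within A F p c) ->
  (B p -> exists2 c, P c & diff_within B F p c) ->
  (A p -> B p -> forall d : R, 0 < d ->
     exists2 x, (A `&` B) x & x != p /\ cabs (x - p) < d) ->
  exists2 c, P c & diff_within setT F p c.
Proof.
move=> cA cB AB hA hB acc.
have [[Ap Bp]|[Ap [r r0 hr]]|[Bp [r r0 hr]]] := closed_cover_near p cA cB AB.
- have [c Pc dc] := hA Ap; have [c' Pc' dc'] := hB Bp.
  have cc' : c = c'.
    apply: (diff_within_unique (diff_within_sub _ dc) (diff_within_sub _ dc') (acc Ap Bp)).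
    + exact: subIsetl.
    + exact: subIsetr.
  exists c => //; rewrite -cc' in dc'.
  by apply: diff_within_sub (diff_within_setU dc dc') => z _; exact: AB.
- have [c Pc dc] := hA Ap; exists c => //; exact: (diff_within_local r0 hr dc).
- have [c Pc dc] := hB Bp; exists c => //; exact: (diff_within_local r0 hr dc).
Qed.

Lemma bounded_on_compact K f : compact K -> {within K, continuous f} ->
  exists2 M : R, 0 <= M & forall z, K z -> cabs (f z) <= M.
Proof.
move=> cK cf; have [[k Kk]|nK] := pselect (K !=set0); last first.
  by exists 0 => // z Kz; case: nK; exists z.
have [|m _ hm] := @compact_EVT_max _ R (fun z => cabs (f z)) K (ex_intro _ k Kk) cK.
  apply/subspace_continuousP => w Kw.
  have /within_continuousP/(_ w Kw) cw := cf.
  move=> U [e /= e0 eU]; have [d d0 hd] := cw _ e0.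
  apply/nbhs_cabsP; exists d => // y yd Ky; apply: eU; rewrite /ball_ /=.
  apply: le_lt_trans (hd y Ky yd).
  have := cabs_dist_le (f y) (f w); have := cabs_dist_le (f w) (f y).
  by rewrite (cabs_distC (f w)) ler_norml => h1 h2; lra.
by exists (cabs (f m)); [exact: cabs_ge0|move=> z Kz; apply: hm; rewrite inE].
Qed.

Lemma poly_roots (P : {poly R[i]}) : P != 0 -> exists S : seq R[i], forall z, z \notin S -> ~~ root P z.
Proof.
move=> P0; have [S PE] := closed_field_poly_normal P; exists S => z.
by rewrite PE rootZ ?lead_coef_eq0 // root_prod_XsubC.
Qed.

Lemma regular_seq (Q : qdiff R) : qnum Q != 0 ->
  exists S : seq R[i], forall z, z \notin S -> regular Q z.
Proof. by move=> Q0; apply: poly_roots; rewrite mulf_neq0 // qden_neq0. Qed.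

Lemma cont_within_restrict A B f p (r : R) : 0 < r ->
  (forall z, B z -> cabs (z - p) < r -> A z) -> cont_within A f p -> cont_within B f p.
Proof.
move=> r0 BA cf e /cf[d d0 hd]; exists (Num.min r d); first by rewrite lt_min r0.
by move=> z Bz; rewrite lt_min => /andP[zr zd]; apply: hd => //; exact: BA.
Qed.

Lemma cont_within_eq A f g p : A p -> (forall z, A z -> f z = g z) ->
  cont_within A f p -> cont_within A g p.
Proof.
move=> Ap fg cf e /cf[d d0 hd]; exists d => // z Az zd.
by rewrite -!fg //; exact: hd.
Qed.

End Covering.

(** * The mappings associated with a Jordan curve *)

Section AssociatedMappings.
Context (R : realType).
Implicit Types (z w p c x : R[i]) (G : set R[i]).

(** The closures of the two regions cover the plane because the curve contains no disc.
They meet only in values of the boundary mappings, because the regions are open and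
disjoint. *)
Lemma associated_mappingsP G phim phip : jordan_curve G -> associated_mappings G phim phip ->
  [/\ forall x, closure (inside G) x \/ closure (outside G) x,
      forall x, closure (inside G) x -> closure (outside G) x -> 
        exists2 z, circle R z & phim z = x,
      forall z, circle R z -> G (phim z)
    & forall z, circle R z -> G (phip z)].
Proof.
move=> jG [[[fm im sm] dm] [[fcm icm scm] _ _] [[fp ip sp] dp] [[fcp icp scp] _ _] _].
have cG := jordan_curve_closed jG.
have /open_cabsP oI := open_inside cG; have /open_cabsP oO := open_outside cG.
have dcd : disc R `<=` cdisc R by move=> z /ltW.
have oco : outer R `<=` couter R by move=> z /ltW.
have IO x : inside G x -> ~ closure (outside G) x.
  move=> Ix /closureP cO; have [d d0 hd] := oI x Ix.
  by have [w Ow wx] := cO d d0; apply: inside_outside (hd w wx) Ow.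
have OI x : outside G x -> ~ closure (inside G) x.
  move=> Ix /closureP cO; have [d d0 hd] := oO x Ix.
  by have [w Ow wx] := cO d d0; apply: inside_outside Ow (hd w wx).
split.
- move=> x; apply: contrapT => /not_orP[nI nO].
  have [r r0 hr] := closed_far (@closed_closure _ _) nI.
  have [r' r'0 hr'] := closed_far (@closed_closure _ _) nO.
  apply: (@jordan_curve_no_disc _ G x (Num.min r r') jG); first by rewrite lt_min r0.
  move=> z; rewrite lt_min => /andP[/hr nIz /hr' nOz]; apply: contrapT => nGz.
  by case: (inside_or_outside nGz) => /subset_closure.
- move=> x cI cO; have [z zd zx] := scm x cI; exists z => //.
  rewrite circleE /=; move: zd; rewrite cdiscE /= le_eqVlt => /predU1P[//|z1].
  case: (IO x) => //; rewrite -zx; apply: fm; by rewrite discE.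
- move=> z zc; have zcd : cdisc R z by move: zc; rewrite circleE cdiscE /= => ->.
  apply: contrapT => nG; case: (inside_or_outside nG) => [/sm[w wd wz]|/OI].
    have wE : w = z by apply: icm; rewrite ?inE //; exact: dcd.
    by move: zc wd; rewrite wE circleE discE /= => ->; rewrite ltxx.
  by apply; exact: fcm.
- move=> z zc; have zcd : couter R z by move: zc; rewrite circleE couterE /= => ->.
  apply: contrapT => nG; case: (inside_or_outside nG) => [/IO|/sp[w wd wz]].
    by apply; exact: fcp.
  have wE : w = z by apply: icp; rewrite ?inE //; exact: oco.
  by move: zc wd; rewrite wE circleE outerE /= => ->; rewrite ltxx.
Qed.

Lemma associated_mappings_infty (phip : R[i] -> R[i]) c : 
  (fun w => w * phip w^-1) @ 0^' --> c -> forall e : R, 0 < e ->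
  exists2 r : R, 0 < r & forall z, r < cabs z -> cabs (phip z - c * z) <= e * cabs z.
Proof.
move=> hc e e0.
have : nbhs c [set w | cabs (w - c) < e] by apply/nbhs_cabsP; exists e.
move/hc => /nbhs_cabsP[d d0 dA]; exists d^-1; first by rewrite invr_gt0.
move=> z zd; have z0 : 0 < cabs z by apply: lt_trans zd; rewrite invr_gt0.
have zn : z != 0 by rewrite -cabs_gt0.
have := dA z^-1; rewrite subr0 cabsV invf_plt ?posrE // => /(_ zd).
rewrite invr_eq0 => /(_ zn) /=; rewrite invrK => h.
have -> : phip z - c * z = (z^-1 * phip z - c) * z by field.
by rewrite cabsM ler_pM2r // ltW.
Qed.

End AssociatedMappings.

(** * The transition map between two curves *)

Section Gluing.
Context (R : realType).
Implicit Types (z w p c x : R[i]) (G : set R[i]).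

(** A point x of large modulus is phi_+1(z) with z of large modulus, because phi_- and
phi_+1 are bounded on compact sets; there phi_+1(z) ~ c1 z and phi_+2(z) ~ c2 z. *)
Lemma growth_quotient (G : set R[i]) phim phip1 phip2 F c1 c2 : c1 != 0 ->
  jordan_curve G -> associated_mappings G phim phip1 ->
  (fun w => w * phip1 w^-1) @ 0^' --> c1 -> (fun w => w * phip2 w^-1) @ 0^' --> c2 ->
  (forall w, couter R w -> F (phip1 w) = phip2 w) ->
  forall e : R, 0 < e -> exists2 r : R, 0 < r & forall z, r < cabs z ->
    cabs (F z - c2 / c1 * z) <= e * cabs z.
Proof.
move=> c10 jG aG h1 h2 hF e e0; pose a := c2 / c1.
have [cov _ _ _] := associated_mappingsP jG aG.
move: aG => [_ [[_ _ sm] cm _] _ [[_ _ sp] cp _] _].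
have cc : 0 < cabs c1 by rewrite cabs_gt0.
have a1 : 0 < 1 + cabs a by have := cabs_ge0 a; lra.
pose k := Num.min (cabs c1 / 2) (e * (cabs c1 / 2) / (1 + cabs a)).
have k0 : 0 < k by rewrite lt_min !divr_gt0 ?mulr_gt0 ?divr_gt0.
have [r1 r10 hr1] := associated_mappings_infty h1 k0.
have [r2 r20 hr2] := associated_mappings_infty h2 k0.
have [M1 M10 hM1] : exists2 M : R, 0 <= M & forall z, cdisc R z -> cabs (phim z) <= M.
  apply: bounded_on_compact cm; rewrite cdiscE; exact: compact_closed_disc.
have [M2 M20 hM2] : exists2 M : R, 0 <= M & forall z, (couter R `&` [set z | cabs z <= r1 + r2]) z -> cabs (phip1 z) <= M.
  apply: bounded_on_compact.
    apply: (subclosed_compact _ (@compact_closed_disc R (r1 + r2))); last exact: subIsetr.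
    apply: closedI; last by apply: compact_closed; [exact: hausdorff_plane|exact: compact_closed_disc].
    rewrite -(setCK (couter R)); apply: open_closedC; rewrite couterE.
    apply/open_cabsP => w /negP; rewrite -ltNge => w1.
    exists (1 - cabs w) => [|y yw]; first by rewrite subr_gt0.
    by apply/negP; rewrite -ltNge; have := cabs_dist_le y w; lra.
  apply/within_continuousP => p [cp' _].
  move/within_continuousP: cp => /(_ p cp').
  by apply: cont_within_sub => z [].
exists (M1 + M2 + 1); first by lra.
move=> x xr.
have [/sm[z zd zx]|/sp[z zo zx]] := cov x.
  by have := hM1 z zd; rewrite zx; lra.
have zr : r1 + r2 < cabs z.
  rewrite ltNge; apply/negP => zr; have := hM2 z (conj zo zr); rewrite zx; lra.
have B1 := hr1 z ltac:(lra); have B2 := hr2 z ltac:(lra).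
rewrite -zx hF // -/a.
have -> : phip2 z - a * phip1 z = (phip2 z - c2 * z) - a * (phip1 z - c1 * z).
  by rewrite /a; field.
apply: le_trans (cabsB _ _) _; rewrite cabsM.
have B3 : cabs a * cabs (phip1 z - c1 * z) <= cabs a * (k * cabs z).
  by rewrite ler_wpM2l ?cabs_ge0.
have B4 : cabs c1 * cabs z <= cabs (phip1 z) + cabs (phip1 z - c1 * z).
  have E : c1 * z = phip1 z - (phip1 z - c1 * z) by ring.
  by rewrite -cabsM {1}E cabsB.
have ka : k <= cabs c1 / 2 by rewrite ge_min lexx.
have kb : k * (1 + cabs a) <= e * (cabs c1 / 2) by rewrite -ler_pdivlMr // ge_min lexx orbT.
have B5 : k * cabs z <= cabs c1 / 2 * cabs z by rewrite ler_wpM2r ?cabs_ge0.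
have B6 : e * (cabs c1 / 2 * cabs z) <= e * cabs (phip1 z) by rewrite ler_pM2l //; lra.
have B7 : k * (1 + cabs a) * cabs z <= e * (cabs c1 / 2) * cabs z by rewrite ler_wpM2r ?cabs_ge0.
lra.
Qed.

(** F'^2 = Q1 / Q2(F) is differentiable off E, since F is. *)
Lemma affine_of_pullback (Q1 Q2 : qdiff R) F (E : seq R[i]) a :
  (forall p, cont_within setT F p) ->
  (forall p, p \notin E -> [/\ regular Q1 p, regular Q2 (F p) &
    exists2 c, c ^+ 2 = qeval Q1 p / qeval Q2 (F p) & diff_within setT F p c]) ->
  (forall e : R, 0 < e -> exists2 r : R, 0 < r & forall z, r < cabs z ->
    cabs (F z - a * z) <= e * cabs z) ->
  exists b, forall z, F z = a * z + b.
Proof.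
move=> cF dF Foo; apply: (@affine_of_jet2 _ F E) => // p pE.
have [r r0 hr] := isolated_seq E p.
have near z : cabs (z - p) < r -> z \notin E.
  by have [->//|zp] := eqVneq z p; exact: hr.
have [/regularP[np1 q1] /regularP[np2 q2] [c cE dc]] := dF p pE.
have [a1 d1] := diff_within_qeval setT np1.
have [a2 d2] := diff_within_qeval setT np2.
apply: (@jet2_square_derivative _ F (derive1 F) (fun z => qeval Q1 z * (qeval Q2 (F z))^-1) p _ r r0).
- move=> z /near zE; have [_ _ [c' _ dc']] := dF z zE.
  by have [_ ->] := diff_derive1 dc'.
- move=> z /near zE; have [_ _ [c' <- dc']] := dF z zE.
  by have [_ ->] := diff_derive1 dc'.
- by rewrite mulf_neq0 ?invr_eq0.
- apply: diff_withinM d1 _; apply: diff_withinV => //.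
  exact: diff_within_comp d2 dc.
Qed.

Lemma transition_minus (Q1 Q2 Qm : qdiff R) (K : set R[i]) phi1 phi2 F :
  homeomorphism_on (cdisc R) K phi1 -> {within cdisc R, continuous phi2} ->
  (forall z, disc R z -> derivable phi1 z 1 /\ derivable phi2 z 1) ->
  is_pullback (disc R) phi1 Q1 Qm -> is_pullback (disc R) phi2 Q2 Qm ->
  (forall z, cdisc R z -> F (phi1 z) = phi2 z) ->
  forall z, cdisc R z -> regular Qm z -> regular Q1 (phi1 z) -> regular Q2 (phi2 z) ->
  exists2 c, c ^+ 2 = qeval Q1 (phi1 z) / qeval Q2 (phi2 z) & diff_within K F (phi1 z) c.
Proof.
move=> [[f1 i1 s1] c1 [g cg gK]] c2 dphi p1 p2 hF z zd /regularP[npz qz] r1 r2.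
have KE : phi1 @` cdisc R = K.
  apply/seteqP; split=> [_ [x xd <-]|x /s1//]; exact: f1.
rewrite -KE; apply: (@transition_derivative _ Q1 Q2 phi1 phi2 (derive1 phi1) (derive1 phi2) g F (qeval Qm) (cdisc R) z 1) => //.
- move=> x xd _; split; first by move/within_continuousP: c1 => /(_ x xd).
  by move/within_continuousP: c2 => /(_ x xd).
- by move=> x xd _; have [h1 h2] := dphi x xd; split; exact: derivable_diff.
- move=> x xd _; have [e1 h1] := p1 x xd; have [e2 h2] := p2 x xd.
  by split=> [|] ?; [apply: h1; rewrite e1|apply: h2; rewrite e2].
- exact: cont_within_qeval.
- by rewrite KE; move/within_continuousP: cg; apply; exact: f1.
Qed.

Lemma diff_within_comp_inv (f df : R[i] -> R[i]) z : z != 0 ->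
  diff_within setT f z^-1 (df z^-1) ->
  diff_within setT (fun w => f w^-1) z (df z^-1 * (- z ^- 2)).
Proof.
move=> z0 h; apply: diff_within_comp => //.
have := @diff_withinV _ setT id z 1 z0; rewrite mulN1r; apply.
move=> e e0; exists 1 => // w _ _.
by rewrite mul1r subrr cabs0 mulr_ge0 ?cabs_ge0 ?ltW.
Qed.

Lemma cabs_inv_lt1 z : z != 0 -> (cabs z^-1 < 1) = (1 < cabs z).
Proof. by move=> z0; rewrite cabsV invf_plt ?posrE ?cabs_gt0 // invr1. Qed.

Lemma cabs_inv_le1 z : z != 0 -> (cabs z^-1 <= 1) = (1 <= cabs z).
Proof. by move=> z0; rewrite cabsV invf_ple ?posrE ?cabs_gt0 // invr1. Qed.

(** The exterior of the disc is not convex, so the coordinate w = 1/z is used: it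
turns the coefficient Qp into Qp(1/w) w^-4, and the punctured closed disc is a
closed disc locally. *)
Lemma transition_plus (Q1 Q2 Qp : qdiff R) (K : set R[i]) phi1 phi2 F :
  homeomorphism_on (couter R) K phi1 -> {within couter R, continuous phi2} ->
  (forall z, outer R z -> derivable phi1 z 1 /\ derivable phi2 z 1) ->
  is_pullback (outer R) phi1 Q1 Qp -> is_pullback (outer R) phi2 Q2 Qp ->
  (forall z, couter R z -> F (phi1 z) = phi2 z) ->
  forall z, couter R z -> regular Qp z -> regular Q1 (phi1 z) -> regular Q2 (phi2 z) ->
  exists2 c, c ^+ 2 = qeval Q1 (phi1 z) / qeval Q2 (phi2 z) & diff_within K F (phi1 z) c.
Proof.
move=> [[f1 i1 s1] c1 [g cg gK]] c2 dphi p1 p2 hF z zo /regularP[npz qz] r1 r2.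
have nz w : couter R w -> w != 0.
  by rewrite couterE /= -cabs_gt0; apply: lt_le_trans.
have z0 := nz z zo.
pose A := cdisc R `\ 0.
have Aco w : A w -> couter R w^-1.
  move=> [wd /eqP w0]; rewrite couterE /= -cabs_inv_le1 ?invr_eq0 // invrK.
  by move: wd; rewrite cdiscE.
have coA w : couter R w -> A w^-1.
  move=> wo; have w0 := nz w wo; split; last by apply/eqP; rewrite /= invr_eq0.
  by rewrite cdiscE /= cabs_inv_le1 //; move: wo; rewrite couterE.
pose psi1 w := phi1 w^-1; pose psi2 w := phi2 w^-1.
have KE : psi1 @` A = K.
  apply/seteqP; split=> [_ [x /Aco xo <-]|x /s1[w /[dup] wo /coA Aw <-]]; first exact: f1.
  by exists w^-1 => //; rewrite /psi1 invrK.
have zE1 : phi1 z = psi1 z^-1 by rewrite /psi1 invrK.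
have zE2 : phi2 z = psi2 z^-1 by rewrite /psi2 invrK.
rewrite zE1 zE2 in r1 r2 *; rewrite -KE.
have r0 : 0 < cabs z^-1 by rewrite cabs_gt0 invr_eq0.
have n0 w : cabs (w - z^-1) < cabs z^-1 -> w != 0.
  by apply: contraTneq => ->; rewrite sub0r cabsN ltxx.
have dA w : cdisc R w -> cabs (w - z^-1) < cabs z^-1 -> A w.
  by move=> wd /n0 w0; split => //; apply/eqP.
have dO w : disc R w -> w != 0 -> outer R w^-1.
  by rewrite discE outerE /= => w1 w0; rewrite -cabs_inv_lt1 ?invr_eq0 // invrK.
have cinv w : w != 0 -> cont_within A (fun w => w^-1) w.
  by move=> w0; apply: cont_withinV => //; exact: cont_within_id.
have rest w f : cdisc R w -> cabs (w - z^-1) < cabs z^-1 -> cont_within A f w -> cont_within (cdisc R) f w.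
  move=> wd wr; have rr : 0 < cabs z^-1 - cabs (w - z^-1) by rewrite subr_gt0.
  apply: (cont_within_restrict rr) => y yd yw; apply: dA => //.
  by have := cabsD (y - w) (w - z^-1); rewrite addrA subrK; lra.
have zA : A z^-1 := coA z zo.
have zz : cabs (z^-1 - z^-1) < cabs z^-1 by rewrite subrr cabs0.
apply: (@transition_derivative _ Q1 Q2 psi1 psi2 (fun w => derive1 phi1 w^-1 * (- w ^- 2))
   (fun w => derive1 phi2 w^-1 * (- w ^- 2)) (fun x => (g x)^-1) F
   (fun w => qeval Qp w^-1 * (w^-1) ^+ 4) A z^-1 (cabs z^-1)) => //.
- by move=> w [].
- move=> w wd wr; have w0 := n0 w wr; have Aw := dA w wd wr.
  have wo := Aco w Aw.
  split; apply: rest => //; apply: (cont_within_comp (B := couter R)) => //; try exact: cinv.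
    by move/within_continuousP: c1 => /(_ _ wo).
  by move/within_continuousP: c2 => /(_ _ wo).
- move=> w wd wr; have w0 := n0 w wr; have [h1 h2] := dphi _ (dO w wd w0).
  by split; [apply: (@diff_within_comp_inv phi1) => //|apply: (@diff_within_comp_inv phi2) => //]; exact: derivable_diff.
- move=> w wd wr; have w0 := n0 w wr; have wo := dO w wd w0.
  have [e1 h1] := p1 _ wo; have [e2 h2] := p2 _ wo.
  by split=> [|] np; [rewrite h1 ?e1|rewrite h2 ?e2] => //; field.
- apply: rest => //; first by have [] := zA.
  apply: cont_withinM; last by apply/cont_withinXn/cinv; rewrite invr_eq0.
  apply: (cont_within_comp (B := setT)) => //; first by apply: cinv; rewrite invr_eq0.
  by rewrite invrK; exact: cont_within_qeval.
- by rewrite invrK mulf_neq0 // expf_neq0.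
- by move=> w Aw; rewrite /psi1 gK ?invrK //; exact: Aco.
- by move=> w Aw; rewrite /psi1 hF //; exact: Aco.
- rewrite KE /psi1 invrK.
  apply: cont_withinV; first by rewrite gK.
  by move/within_continuousP: cg; apply; exact: f1.
Qed.
End Gluing.

(** * Uniqueness for given boundary identifications *)

Section Uniqueness.
Context (R : realType).
Implicit Types (z w p c x : R[i]) (G : set R[i]).

Lemma pullback_qnum_neq0 (U : set R[i]) (Q P : qdiff R) phi (r : R) p : 0 < r ->
  (forall z, cabs (z - p) < r -> U z) -> qnum P != 0 -> is_pullback U phi Q P -> qnum Q != 0.
Proof.
move=> r0 rU P0 pb; have [S hS] := regular_seq P0.
have [z zS [_ zp]] := exists_notin_seq S p r0.
have /regularP[np q] := hS z zS; have [_ h] := pb z (rU z zp).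
apply: contraNneq q => Q0; rewrite h // /qeval Q0 horner0 !mul0r //.
Qed.

(** The transition map F is affine by [affine_of_pullback]; it sends each side of G1
onto the same side of G2, hence G1 onto G2. *)
Lemma welded_maps_affine (Qm Qp Q1 Q2 : qdiff R) G1 G2 phim1 phip1 phim2 phip2 :
  qnum Qm != 0 -> qnum Qp != 0 -> jordan_curve G1 -> jordan_curve G2 ->
  associated_mappings G1 phim1 phip1 -> associated_mappings G2 phim2 phip2 ->
  is_pullback (disc R) phim1 Q1 Qm -> is_pullback (disc R) phim2 Q2 Qm ->
  is_pullback (outer R) phip1 Q1 Qp -> is_pullback (outer R) phip2 Q2 Qp ->
  (forall z, circle R z -> exists2 w, circle R w &
     phim1 z = phip1 w /\ phim2 z = phip2 w) ->
  exists a b, [/\ a != 0, forall z, cdisc R z -> phim2 z = a * phim1 z + b &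
     (fun z => a * z + b) @` G1 = G2].
Proof.
move=> Qm0 Qp0 jG1 jG2 a1 a2 pm1 pm2 pp1 pp2 weld.
have Q10 : qnum Q1 != 0.
  by apply: (pullback_qnum_neq0 (p := 0) ltr01 _ Qm0 pm1) => z; rewrite subr0 discE.
have Q20 : qnum Q2 != 0.
  by apply: (pullback_qnum_neq0 (p := 0) ltr01 _ Qm0 pm2) => z; rewrite subr0 discE.
have [cov1 over1 Gm1 Gp1] := associated_mappingsP jG1 a1.
have [cov2 over2 Gm2 Gp2] := associated_mappingsP jG2 a2.
have [cb1 hm1 cbp1 hp1 [c1 c10 lim1]] := a1.
have [cb2 hm2 cbp2 hp2 [c2 c20 lim2]] := a2.
have [[fm1 im1 sm1] cm1 [gm1 cgm1 gm1K]] := hm1.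
have [[fp1 ip1 sp1] cp1 [gp1 cgp1 gp1K]] := hp1.
have [[fm2 im2 sm2] cm2 [gm2 cgm2 gm2K]] := hm2.
have [[fp2 ip2 sp2] cp2 [gp2 cgp2 gp2K]] := hp2.
have cco : circle R `<=` couter R by move=> z; rewrite circleE couterE /= => ->.
have ccd : circle R `<=` cdisc R by move=> z; rewrite circleE cdiscE /= => ->.
pose F x := if pselect (closure (inside G1) x) then phim2 (gm1 x) else phip2 (gp1 x).
have Fm z : cdisc R z -> F (phim1 z) = phim2 z.
  by move=> zd; rewrite /F; case: pselect => [cI|/(_ (fm1 _ zd))//] /=; rewrite gm1K.
have Fp w : couter R w -> F (phip1 w) = phip2 w.
  move=> wo; rewrite /F; case: pselect => [cI|nI] /=; last by rewrite gp1K.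
  have [z zc zE] := over1 _ cI (fp1 _ wo).
  have [w' wc [e1 e2]] := weld z zc.
  have ww : w = w'.
    apply: ip1; [by rewrite inE|by rewrite inE; exact: cco|by rewrite -zE e1].
  have zd : cdisc R z by exact: ccd.
  by rewrite ww -e1 (gm1K z zd) e2.
have cFm p : closure (inside G1) p -> cont_within (closure (inside G1)) F p.
  move=> cI; apply: (cont_within_eq (f := fun x => phim2 (gm1 x))) => // [x|].
    by move=> /sm1[z zd <-]; rewrite gm1K // Fm.
  apply: (cont_within_comp (B := cdisc R)).
  - by move=> x /sm1[z zd <-]; rewrite gm1K.
  - by move/within_continuousP: cgm1; apply.
  - move/within_continuousP: cm2; apply.
    by have [z zd <-] := sm1 _ cI; rewrite gm1K.
have cFp p : closure (outside G1) p -> cont_within (closure (outside G1)) F p.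
  move=> cI; apply: (cont_within_eq (f := fun x => phip2 (gp1 x))) => // [x|].
    by move=> /sp1[z zd <-]; rewrite gp1K // Fp.
  apply: (cont_within_comp (B := couter R)).
  - by move=> x /sp1[z zd <-]; rewrite gp1K.
  - by move/within_continuousP: cgp1; apply.
  - move/within_continuousP: cp2; apply.
    by have [z zd <-] := sp1 _ cI; rewrite gp1K.
have cF p : cont_within setT F p.
  exact: (cont_within_cover (@closed_closure _ _) (@closed_closure _ _) cov1 (@cFm p) (@cFp p)).
have [Sm hSm] := regular_seq Qm0; have [Sp hSp] := regular_seq Qp0.
have [S1 hS1] := regular_seq Q10; have [S2 hS2] := regular_seq Q20.
(* the points over critical points of one of the four differentials *)
pose E := map phim1 Sm ++ map phip1 Sp ++ S1 ++ map (phim1 \o gm2) S2 ++ map (phip1 \o gp2) S2.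
have acc p : closure (inside G1) p -> closure (outside G1) p -> forall d : R, 0 < d ->
    exists2 x, (closure (inside G1) `&` closure (outside G1)) x & x != p /\ cabs (x - p) < d.
  move=> cI cO d d0; have [z zc <-] := over1 p cI cO.
  have zd := ccd _ zc.
  have [d' d'0 hd'] := (within_continuousP _ _).1 cm1 z zd _ d0.
  have [t t0 [td t1]] := exists_small (divr_gt0 d'0 (ltr0Sn R 1)) ltr01.
  pose w := z * expi t.
  have wc : circle R w by move: zc; rewrite circleE /= /w cabsM cabs_expi mulr1.
  have wd := ccd _ wc.
  have wz : w != z.
    have z0 : z != 0 by rewrite -cabs_gt0; move: zc; rewrite circleE /= => ->.
    rewrite -[X in _ != X]mulr1 (inj_eq (mulfI z0)) -(expi0 R).
    apply/eqP => /expi_inj; rewrite subr0 gtr0_norm // => h.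
    have tp : t < 2 * pi by have := pi_ge2 R; lra.
    by move: t0; rewrite h // ltxx.
  exists (phim1 w); last split.
  - split; first exact: fm1.
    by have [w' w'c [-> _]] := weld w wc; apply/fp1/cco.
  - by apply: contraNneq wz => h; apply/eqP/im1; rewrite ?inE.
  - apply: hd' => //; have -> : w - z = z * (expi t - expi 0) by rewrite /w expi0; ring.
    rewrite cabsM; move: zc; rewrite circleE /= => ->; rewrite mul1r.
    have := cabs_expiB_le t 0; rewrite subr0 gtr0_norm //.
    by move: td; rewrite ltr_pdivlMr //; lra.
have dcd : disc R `<=` cdisc R by move=> z /ltW.
have [b Fab] : exists b, forall z, F z = c2 / c1 * z + b.
  apply: (@affine_of_pullback _ Q1 Q2 F E) => //; last first.
    exact: (growth_quotient (lt0r_neq0 c10) jG1 a1 lim1 lim2 Fp).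
  move=> p; rewrite !mem_cat !negb_or => /and5P[p1 p2 p3 p4 p5].
  have rQ1 := hS1 p p3.
  have rm z : cdisc R z -> phim1 z = p -> regular Qm z /\ regular Q2 (phim2 z).
    move=> zd zp; split.
      by apply: hSm; apply: contraNN p1 => zS; rewrite -zp map_f.
    apply: hS2; apply: contraNN p4 => zS; rewrite -zp -(gm2K z zd).
    exact: (map_f (phim1 \o gm2)).
  have rp z : couter R z -> phip1 z = p -> regular Qp z /\ regular Q2 (phip2 z).
    move=> zd zp; split.
      by apply: hSp; apply: contraNN p2 => zS; rewrite -zp map_f.
    apply: hS2; apply: contraNN p5 => zS; rewrite -zp -(gp2K z zd).
    exact: (map_f (phip1 \o gp2)).
  have rF : regular Q2 (F p).
    case: (cov1 p) => [/sm1[z zd zp]|/sp1[z zd zp]].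
      by rewrite -zp Fm //; have [] := rm z zd zp.
    by rewrite -zp Fp //; have [] := rp z zd zp.
  split => //.
  apply: (@diff_within_cover _ (closure (inside G1)) (closure (outside G1)) F p
    (fun c => c ^+ 2 = qeval Q1 p / qeval Q2 (F p)) (@closed_closure _ _) (@closed_closure _ _) cov1 _ _ (@acc p)).
  - move=> /sm1[z zd zp]; have [r1 r2] := rm z zd zp.
    rewrite -zp Fm //; apply: (transition_minus hm1 cm2 _ pm1 pm2 Fm zd r1 _ r2).
      by move=> x xd; split; [exact: cb1.2|exact: cb2.2].
    by rewrite zp.
  - move=> /sp1[z zd zp]; have [r1 r2] := rp z zd zp.
    rewrite -zp Fp //; apply: (transition_plus hp1 cp2 _ pp1 pp2 Fp zd r1 _ r2).
      by move=> x xd; split; [exact: cbp1.2|exact: cbp2.2].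
    by rewrite zp.
have [[fi1 _ si1] _] := cb1; have [[fo1 _ so1] _] := cbp1.
have [[fi2 _ _] _] := cb2; have [[fo2 _ _] _] := cbp2.
have a0 : c2 / c1 != 0 by rewrite mulf_neq0 ?invr_eq0 // gt_eqF.
exists (c2 / c1), b; split => //.
  by move=> z zd; rewrite -Fab Fm.
have nIn (G : set R[i]) z : inside G z -> ~ G z by case.
have nOut (G : set R[i]) z : outside G z -> ~ G z by case.
apply/seteqP; split=> [y [x xG <-]|y yG].
  rewrite -Fab; case: (cov1 x) => [/sm1[z zd zx]|/sp1[z zd zx]].
    rewrite -zx Fm //; apply: Gm2; rewrite circleE /=.
    move: zd; rewrite cdiscE /= le_eqVlt => /predU1P[//|z1].
    case: (nIn G1 x) => //; rewrite -zx; apply: fi1; by rewrite discE.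
  rewrite -zx Fp //; apply: Gp2; rewrite circleE /=.
  move: zd; rewrite couterE /= le_eqVlt => /predU1P[//|z1].
  case: (nOut G1 x) => //; rewrite -zx; apply: fo1; by rewrite outerE.
pose x := (y - b) / (c2 / c1).
have xy : c2 / c1 * x + b = y by rewrite /x mulrC divfK // subrK.
exists x => //; apply: contrapT => nG.
have oco : outer R `<=` couter R by move=> z /ltW.
case: (inside_or_outside nG) => [/si1|/so1].
  move=> [z zd zx]; apply: (nIn G2 y) => //.
  rewrite -xy -Fab -zx Fm; last exact: dcd.
  exact: fi2.
move=> [z zd zx]; apply: (nOut G2 y) => //.
rewrite -xy -Fab -zx Fp; last exact: oco.
exact: fo2.
Qed.

(** Both differentials pull back to Qm, so the rational functions Q1 and
a^2 Q2(a z + b) agree at infinitely many points.  The poles agree too because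
fractions are in lowest terms. *)
Lemma pullback_affine (Qm Q1 Q2 : qdiff R) (phi1 phi2 : R[i] -> R[i]) (a b : R[i]) : qnum Qm != 0 -> a != 0 ->
  set_inj (disc R) phi1 -> (forall z, disc R z -> derivable phi1 z 1) ->
  (forall z, cdisc R z -> phi2 z = a * phi1 z + b) ->
  is_pullback (disc R) phi1 Q1 Qm -> is_pullback (disc R) phi2 Q2 Qm ->
  is_pullback setT (fun z => a * z + b) Q2 Q1.
Proof.
move=> Qm0 a0 i1 d1 E p1 p2.
have dcd : disc R `<=` cdisc R by move=> z /ltW.
pose L : {poly R[i]} := a *: 'X + b%:P.
have LE z : L.[z] = a * z + b by rewrite !hornerE.
pose P := qnum Q1 * (qden Q2 \Po L) - a ^+ 2 *: (qnum Q2 \Po L) * qden Q1.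
have PE z : P.[z] = (qnum Q1).[z] * (qden Q2).[a * z + b]
   - a ^+ 2 * (qnum Q2).[a * z + b] * (qden Q1).[z].
  by rewrite !hornerE !horner_comp LE.
have d2 z : disc R z -> derive1 phi2 z = a * derive1 phi1 z.
  move=> zd; have h := derivable_diff (d1 z zd).
  have [] // := @diff_derive1 _ phi2 z (a * derive1 phi1 z).
  have z1 : 0 < 1 - cabs z by rewrite subr_gt0; move: zd; rewrite discE.
  apply: (@diff_within_local _ [set w | cabs (w - z) < 1 - cabs z] _ _ _ _ z1) => //.
  move=> e e0; have ea : 0 < e / cabs a by rewrite divr_gt0 // cabs_gt0.
  have [d d0 hd] := h _ ea; exists d => // w /= wz wd.
  have wd1 : cdisc R w.
    by rewrite cdiscE /=; have := cabsD (w - z) z; rewrite subrK; lra.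
  rewrite !E //; last exact: dcd.
  have -> : a * phi1 w + b - (a * phi1 z + b) - a * derive1 phi1 z * (w - z) =
    a * (phi1 w - phi1 z - derive1 phi1 z * (w - z)) by ring.
  have ac : 0 < cabs a by rewrite cabs_gt0.
  have := hd w I wd; rewrite cabsM -(ler_pM2l ac) => /le_trans; apply.
  by rewrite mulrA [_ * (e / _)]mulrC divfK // gt_eqF.
have key : forall z, disc R z -> regular Qm z -> P.[phi1 z] = 0.
  move=> z zd /regularP[np q0].
  have [e1 h1] := p1 z zd; have [e2 h2] := p2 z zd.
  have n1 : ~~ pole Q1 (phi1 z) by rewrite -e1.
  have n2 : ~~ pole Q2 (phi2 z) by rewrite -e2.
  have := h2 np; rewrite (h1 np) d2 // exprMn (mulrA (qeval Q2 _)) => H.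
  have D0 : derive1 phi1 z ^+ 2 != 0 by apply: contraNneq q0 => D0; rewrite h1 // D0 mulr0.
  move: (mulIf D0 H); rewrite PE -E; last exact: dcd.
  rewrite /qeval => HH; move: n1 n2; rewrite /pole /root => n1 n2.
  have -> : (qnum Q1).[phi1 z] = (qnum Q1).[phi1 z] / (qden Q1).[phi1 z] * (qden Q1).[phi1 z].
    by rewrite divfK.
  by rewrite HH; field.
have P0 : P = 0.
  apply/eqP/negPn/negP => Pn0.
  have [S hS] := poly_roots Pn0; have [Sm hSm] := regular_seq Qm0.
  have : exists g : R[i] -> R[i], forall z, disc R z -> g (phi1 z) = z.
    have : forall x, exists z, (phi1 @` disc R) x -> disc R z /\ phi1 z = x.
      move=> x; have [[z zd zx]|] := pselect ((phi1 @` disc R) x); first by exists z.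
      by exists 0.
    move=> /choice[g hg]; exists g => z zd.
    have [gd ge] := hg (phi1 z) (ex_intro2 _ _ z zd erefl).
    by apply: i1; rewrite ?inE.
  move=> [g hg].
  have [z zS [_ zd]] := exists_notin_seq (Sm ++ map g S) 0 ltr01.
  move: zS; rewrite mem_cat negb_or => /andP[z1 z2].
  have zdd : disc R z by rewrite discE /=; move: zd; rewrite subr0.
  have /hS : phi1 z \notin S by apply: contraNN z2 => zS; rewrite -(hg z zdd) map_f.
  by rewrite /root key ?eqxx //; exact: hSm.
have PE0 z : (qnum Q1).[z] * (qden Q2).[a * z + b] = a ^+ 2 * (qnum Q2).[a * z + b] * (qden Q1).[z].
  by apply/eqP; rewrite -subr_eq0 -PE P0 horner0.
have cop (Q : qdiff R) z : root (qden Q) z -> (qnum Q).[z] != 0.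
  by move=> rz; have := q_coprime Q; rewrite coprimep_sym => /coprimep_root; apply.
move=> z _; have DE : derive1 (fun z => a * z + b) z = a.
  have [] // := @diff_derive1 _ (fun z => a * z + b) z a.
  move=> e e0; exists 1 => // w _ _.
  have -> : a * w + b - (a * z + b) - a * (w - z) = 0 by ring.
  by rewrite cabs0 mulr_ge0 ?cabs_ge0 ?ltW.
have poleE : pole Q1 z = pole Q2 (a * z + b).
  rewrite /pole; apply/idP/idP => h; have := cop _ _ h; have := PE0 z;
    move: h; rewrite /root => /eqP ->; rewrite mulr0 => /eqP.
    by rewrite mulf_eq0 => /orP[->|].
  by rewrite eq_sym -mulrA mulf_eq0 (negbTE (expf_neq0 2 a0)) /= mulf_eq0 => /orP[->|].
split=> // np; rewrite DE /qeval.
have np2 : ~~ pole Q2 (a * z + b) by rewrite -poleE.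
move: np np2; rewrite /pole /root => np np2.
have -> : (qnum Q1).[z] = (qnum Q1).[z] * (qden Q2).[a * z + b] / (qden Q2).[a * z + b].
  by rewrite mulfK.
by rewrite PE0; field; rewrite np np2.
Qed.
End Uniqueness.

(** * Integrals of a nonnegative function over intervals *)

Section IntervalIntegral.
Context (R : realType).
Notation mu := (@lebesgue_measure R).
Variable h : R -> R.
Hypothesis mh : measurable_fun setT h.
Hypothesis h0 : forall t, 0 <= h t.
Local Open Scope ereal_scope.

Definition oo_integral (a b : R) : \bar R := \int[mu]_(t in `]a, b[) (h t)%:E.

Lemma measurable_fun_EFin_itv (D : set R) : measurable D -> measurable_fun D (fun t => (h t)%:E).
Proof. by move=> mD; apply/measurable_EFinP; exact: measurable_funTS. Qed.

Lemma oo_integral_ge0 a b : 0 <= oo_integral a b.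
Proof. by apply: integral_ge0 => t _; rewrite lee_fin. Qed.

Lemma oo_integral_xx a : oo_integral a a = 0.
Proof. by rewrite /oo_integral set_itv_ge ?integral_set0 // bnd_simp ltxx. Qed.

Lemma oo_integral_closed a b (b0 b1 : bool) :
  oo_integral a b = \int[mu]_(t in [set` Interval (BSide b0 a) (BSide b1 b)]) (h t)%:E.
Proof. by rewrite /oo_integral [RHS]integral_itv_bndoo //; apply: measurable_fun_EFin_itv; exact: measurable_itv. Qed.

Lemma oo_integral_split a c b : (a <= c)%R -> (c <= b)%R -> oo_integral a b = oo_integral a c + oo_integral c b.
Proof.
rewrite le_eqVlt => /predU1P[<- _|ac]; first by rewrite oo_integral_xx add0e.
rewrite le_eqVlt => /predU1P[->|cb]; first by rewrite oo_integral_xx adde0.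
rewrite (oo_integral_closed a c false false) /oo_integral.
have -> : [set` `]a, b[ ] = [set` Interval (BSide false a) (BSide false c)] `|` `]c, b[ :> set R.
  by rewrite -itv_bndbnd_setU // bnd_simp ?ltW.
rewrite ge0_integral_setU //.
- by apply: measurable_fun_EFin_itv; apply: measurableU; exact: measurable_itv.
- by move=> t _; rewrite lee_fin.
- apply/disj_setPRL => t /=; rewrite !in_itv /= => /andP[ct _]; apply/negP.
  by rewrite negb_and -!ltNge ct orbT.
Qed.

Lemma oo_integral_le a b a' b' : (a' <= a)%R -> (b <= b')%R -> oo_integral a b <= oo_integral a' b'.
Proof.
move=> aa bb; apply: ge0_subset_integral => //.
- by apply: measurable_fun_EFin_itv; exact: measurable_itv.
- by move=> t _; rewrite lee_fin.
- by apply: subset_itv; rewrite bnd_simp.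
Qed.

Lemma measure_oo a b : (a <= b)%R -> mu `]a, b[ = (b - a)%:E.
Proof.
move=> ab; rewrite lebesgue_measure_itv /= lte_fin; case: ltP => // ba.
by rewrite (_ : b = a) ?subrr //; apply/eqP; rewrite eq_le ab ba.
Qed.

Lemma oo_integral_ub a b (M : R) : (a <= b)%R -> (forall t, (a < t < b)%R -> (h t <= M)%R) ->
  oo_integral a b <= (M * (b - a))%:E.
Proof.
move=> ab hM; rewrite EFinM -(measure_oo ab) -integral_cst //.
apply: ge0_le_integral => //.
- by move=> t _; rewrite lee_fin.
- by apply: measurable_fun_EFin_itv; exact: measurable_itv.
Qed.

Lemma oo_integral_lb a b (m : R) : (a <= b)%R -> (0 <= m)%R -> (forall t, (a < t < b)%R -> (m <= h t)%R) ->
  (m * (b - a))%:E <= oo_integral a b.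
Proof.
move=> ab m0 hM; rewrite EFinM -(measure_oo ab) -integral_cst //.
apply: ge0_le_integral => //.
- by apply: measurable_fun_EFin_itv; exact: measurable_itv.
Qed.

Lemma oo_integral_gt0 a b c : (a < c < b)%R -> {for c, continuous h} -> (0 < h c)%R -> 0 < oo_integral a b.
Proof.
move=> /andP[ac cb] ch hc.
have hc2 : (0 < h c / 2)%R by rewrite divr_gt0.
have /(_ [set y | h c / 2 < y]%R) [] := ch.
  exists (h c / 2)%R => //= y; rewrite /ball_ /= ltr_norml => /andP[_]; lra.
move=> d /= d0 hd.
pose k := Num.min d (b - c)%R.
have k0 : (0 < k)%R by rewrite lt_min d0 subr_gt0.
have kd : (k <= d)%R by rewrite ge_min lexx.
have kb : (k <= b - c)%R by rewrite ge_min lexx orbT.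
apply: (@lt_le_trans _ _ (oo_integral c (c + k))); last by apply: oo_integral_le; [exact: ltW|lra].
have h1 : (h c / 2 * (c + k - c))%:E <= oo_integral c (c + k).
  apply: oo_integral_lb; [by lra|by lra|].
  move=> t tc; apply/ltW/hd; rewrite /ball_ /= distrC gtr0_norm; lra.
apply: lt_le_trans h1; rewrite lte_fin mulr_gt0 //; lra.
Qed.

(** The integrals over ]a + (b - a) / n, b - (b - a) / n[ increase to the integral over
]a, b[. *)
Lemma oo_integral_exhaust a b (l : \bar R) : (a < b)%R -> l < oo_integral a b ->
  exists c d : R, [/\ (a < c < b)%R, (a < d < b)%R, (c <= d)%R & l < oo_integral c d].
Proof.
move=> ab lab.
pose q n := ((b - a) / n.+2%:R)%R.
have ba : (0 < b - a)%R by rewrite subr_gt0.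
have qab n : (0 < q n)%R /\ (q n < b - a)%R.
  by rewrite /q; split; rewrite ?divr_gt0 // ltr_pdivrMr // ltr_pMr // ltr1n.
have qle n m : (n <= m)%N -> (q m <= q n)%R.
  by move=> nm; rewrite /q ler_pM2l // lef_pV2 ?posrE // ler_nat.
have cE : \bigcup_n `](a + q n)%R, (b - q n)%R[%classic = `]a, b[%classic.
  apply/seteqP; split=> [t [n _]|t] /=; rewrite !in_itv /=.
    by have [] := qab n; lra.
  move=> tab; pose e := Num.min (t - a)%R (b - t)%R.
  have e0 : (0 < e)%R by rewrite lt_min; apply/andP; split; lra.
  have ea : (e <= t - a)%R by rewrite ge_min lexx.
  have eb : (e <= b - t)%R by rewrite ge_min lexx orbT.
  have /archi_boundP := divr_ge0 (ltW ba) (ltW e0).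
  set n := Num.bound _ => hn; exists n => //=; rewrite in_itv /=.
  suff : (q n < e)%R by lra.
  rewrite /q ltr_pdivrMr // mulrC -ltr_pdivrMr //; apply: lt_trans hn _.
  by rewrite ltr_nat.
have cv : oo_integral (a + q n) (b - q n) @[n --> \oo] --> oo_integral a b.
  rewrite [in X in _ --> X]/oo_integral -cE.
  apply: (@ge0_nondecreasing_set_cvg_integral _ (measurableTypeR R) R
    (fun n => `](a + q n)%R, (b - q n)%R[%classic) (fun t => (h t)%:E) (@lebesgue_measure R)).
  - move=> n m nm; apply/subsetPset/subset_itv; rewrite bnd_simp //.
      by rewrite lerD2l qle.
    by rewrite lerD2l lerN2 qle.
  - by move=> n; exact: measurable_itv.
  - by move=> n; apply: measurable_fun_EFin_itv; exact: measurable_itv.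
  - by move=> n t _; rewrite lee_fin.
have /cv[N _ hN] : nbhs (oo_integral a b) [set x | l < x].
  by apply: open_nbhs_nbhs; split => //; exact: open_ereal_gt_ereal.
exists (a + q N)%R, (b - q N)%R; have [q1 q2] := qab N.
have q3 : (q N <= (b - a) / 2)%R := qle 0%N N (leq0n N).
have hl := hN N (leqnn N); split=> //; lra.
Qed.

Lemma oo_integral_ivt a b (l : R) : (a <= b)%R -> oo_integral a b < +oo -> 0 <= l%:E <= oo_integral a b ->
  exists2 t, (a <= t <= b)%R & oo_integral a t = l%:E.
Proof.
move=> ab fab /andP[l0 lb].
have iab : (@lebesgue_measure R).-integrable `[a, b] (EFin \o h).
  apply/integrableP; split; first by apply: measurable_fun_EFin_itv; exact: measurable_itv.
  under eq_integral do rewrite /= ger0_norm //.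
  by rewrite -(oo_integral_closed a b true false).
have := parameterized_integral_continuous ab iab => cab.
pose f x := fine (oo_integral a x).
have fE : (fun x => parameterized_integral (@lebesgue_measure R) a x h) = f.
  by apply/funext => x; rewrite /parameterized_integral /Rintegral /f (oo_integral_closed a x true false).
rewrite fE in cab.
have fin x : (x <= b)%R -> oo_integral a x \is a fin_num.
  by move=> xb; rewrite ge0_fin_numE ?oo_integral_ge0 //; apply: le_lt_trans fab; exact: oo_integral_le.
have [|t tab tl] := @IVT R f a b l ab cab.
  rewrite /f oo_integral_xx /= ge_min le_max; apply/andP; split; apply/orP; first by left.
  by right; rewrite -lee_fin fineK // fin.
exists t; first by move: tab; rewrite in_itv.
by rewrite -tl fineK // fin //; move: tab; rewrite in_itv /= => /andP[].
Qed.

End IntervalIntegral.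

(** What is used of the integral of a density [h] over an open interval.  These
properties are invariant under t |-> - t, which exchanges the two ends of an
interval, so each of the statements below about a left end has a mirror image. *)
Record interval_length (R : realType) (h : R -> R) (L : R -> R -> \bar R) : Prop := {
  itvlen_ge0 : forall a b, (0 <= L a b)%E;
  itvlen_split : forall a c b, a <= c -> c <= b -> L a b = (L a c + L c b)%E;
  itvlen_ub : forall a b (M : R), a <= b -> (forall t, a < t < b -> h t <= M) ->
    (L a b <= (M * (b - a))%:E)%E;
  itvlen_lb : forall a b (m : R), a <= b -> 0 <= m -> (forall t, a < t < b -> m <= h t) ->
    ((m * (b - a))%:E <= L a b)%E;
  itvlen_exhaust : forall a b l, a < b -> (l < L a b)%E -> exists c d : R,
    [/\ a < c < b, a < d < b, c <= d & (l < L c d)%E];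
  itvlen_ivt : forall a b (l : R), a <= b -> (L a b < +oo)%E -> (0 <= l%:E <= L a b)%E ->
    exists2 t, a <= t <= b & L a t = l%:E }.

Section IntervalLength.
Context (R : realType).
Implicit Types (h : R -> R) (L : R -> R -> \bar R) (a b c d m M : R).

Lemma itvlen_opp h L : interval_length h L ->
  interval_length (fun t => h (- t)) (fun a b => L (- b) (- a)).
Proof.
move=> HL; split.
- by move=> a b; exact: itvlen_ge0 HL _ _.
- by move=> a c b ac cb; rewrite (@itvlen_split _ _ _ HL _ (- c)) ?lerN2 // addeC.
- move=> a b M ab hM; have -> : b - a = - a - - b by rewrite opprK addrC.
  apply: (itvlen_ub HL); rewrite ?lerN2 // => t tab.
  by rewrite -[t]opprK hM //; lra.
- move=> a b M ab M0 hM; have -> : b - a = - a - - b by rewrite opprK addrC.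
  apply: (itvlen_lb HL); rewrite ?lerN2 // => t tab.
  by rewrite -[t]opprK hM //; lra.
- move=> a b l ab /(itvlen_exhaust HL)[|c [d [h1 h2 h3 h4]]]; first by rewrite ltrN2.
  by exists (- d), (- c); rewrite !opprK; split => //; lra.
- move=> a b l ab fab /andP[l0 lb].
  have fin x y : - b <= x -> x <= y -> y <= - a -> L x y \is a fin_num.
    move=> bx xy ya; rewrite ge0_fin_numE ?(itvlen_ge0 HL) //.
    apply: le_lt_trans fab; rewrite (itvlen_split HL bx (le_trans xy ya)) (itvlen_split HL xy ya).
    by rewrite addeCA leeDl // adde_ge0 // (itvlen_ge0 HL).
  have ab' : - b <= - a by rewrite lerN2.
  have fF := fin _ _ (lexx _) ab' (lexx _).
  have [||t tab tE] := @itvlen_ivt _ _ _ HL (- b) (- a) (fine (L (- b) (- a)) - l) ab'.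
  - by [].
  - move: lb l0; rewrite -(fineK fF) !lee_fin => h1 h2; apply/andP; split; lra.
  exists (- t); first by lra.
  have [t1 t2] : - b <= t /\ t <= - a by split; lra.
  have := itvlen_split HL t1 t2; rewrite tE opprK -(fineK fF) -(fineK (fin _ _ t1 t2 (lexx _))).
  by move=> -[] E; congr EFin; lra.
Qed.

Section Fixed.
Variables (h : R -> R) (L : R -> R -> \bar R).
Hypothesis HL : interval_length h L.
Hypothesis h0 : forall t, 0 <= h t.
Local Open Scope ereal_scope.

Lemma itvlen_xx a : L a a = 0.
Proof.
apply/eqP; rewrite eq_le (itvlen_ge0 HL) andbT.
have : L a a <= (0 * (a - a))%:E; last by rewrite mul0r.
by apply: (itvlen_ub HL) => // t /andP[h1 h2]; lra.
Qed.

Lemma itvlen_le a b a' b' : (a' <= a)%R -> (a <= b)%R -> (b <= b')%R -> L a b <= L a' b'.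
Proof.
move=> aa ab bb; rewrite (itvlen_split HL aa (le_trans ab bb)) (itvlen_split HL ab bb).
by rewrite addeCA leeDl // adde_ge0 // (itvlen_ge0 HL).
Qed.

Lemma itvlen_exhaust_right a b l : (a < b)%R -> l < L a b ->
  exists2 d : R, (a < d < b)%R & l < L a d.
Proof.
move=> ab /(itvlen_exhaust HL ab)[c [d [cab dab cd lcd]]]; exists d => //.
by apply: lt_le_trans lcd _; apply: itvlen_le => //; lra.
Qed.

Lemma itvlen_exhaust_left a b l : (a < b)%R -> l < L a b ->
  exists2 c : R, (a < c < b)%R & l < L c b.
Proof.
move=> ab /(itvlen_exhaust HL ab)[c [d [cab dab cd lcd]]]; exists c => //.
by apply: lt_le_trans lcd _; apply: itvlen_le => //; lra.
Qed.

Lemma half_pow_small (e : R) : (0 < e)%R -> exists N, (2^-1 ^+ N < e :> R)%R.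
Proof.
move=> e0; have /archi_boundP : (0 <= e^-1)%R by rewrite invr_ge0 ltW.
set n := Num.bound _ => hn; exists n.
rewrite exprVn invf_plt ?posrE ?exprn_gt0 //; apply: lt_trans hn _.
by rewrite -natrX ltr_nat ltn_expl.
Qed.

(** Where h^2 <= M / (t - a), the piece between (b - a) / 4^(N+1) and (b - a) / 4^N from a
contributes at most a constant times 2^-N. *)
Lemma itvlen_fin_left a b (M : R) : (a < b)%R -> (0 <= M)%R ->
  (forall t, (a < t < b)%R -> (h t ^+ 2 * (t - a) <= M)%R) -> L a b < +oo.
Proof.
move=> ab M0 hM; pose dl := (b - a)%R; have dl0 : (0 < dl)%R by rewrite subr_gt0.
(* any D with D >= 1 and D dl >= M satisfies D^2 dl >= M *)
pose D := (M / dl + 1)%R.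
have MD : (0 <= M / dl)%R by rewrite divr_ge0 // ltW.
have D1 : (1 <= D)%R by rewrite /D; lra.
pose r N : R := (2^-1 ^+ N)%R; have r0 N : (0 < r N)%R by rewrite exprn_gt0.
have rS N : r N.+1 = (r N / 2)%R by rewrite /r exprSr.
have r1 N : (r N <= 1)%R by elim: N => [|N IH]; rewrite ?rS /r ?expr0 //; have := r0 N; rewrite /r in IH *; lra.
pose c N := (a + dl * r N ^+ 2)%R.
have claim N : (c N <= b)%R /\ L (c N) b <= (4 * D * dl * (1 - r N))%:E.
  elim: N => [|N [cb IH]].
    rewrite /c /r expr0 expr1n mulr1 subrr mulr0 /dl addrC subrK; split => //.
    by rewrite itvlen_xx.
  have cc : (c N.+1 <= c N)%R.
    by rewrite /c rS lerD2l ler_pM2l //; have := r0 N; nra.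
  split; first exact: le_trans cc cb.
  rewrite (itvlen_split HL cc cb).
  have : L (c N.+1) (c N) <= (2 * D / r N * (c N - c N.+1))%:E.
    apply: (itvlen_ub HL) => // t /andP[t1 t2].
    have ta : (dl * (r N / 2) ^+ 2 < t - a)%R by move: t1; rewrite /c rS; lra.
    have tab : (a < t < b)%R.
      have : (0 < dl * (r N / 2) ^+ 2)%R by rewrite mulr_gt0 // exprn_gt0 // divr_gt0.
      lra.
    have := hM t tab => ht.
    rewrite ler_pdivlMr // -(@ler_pXn2r _ 2) ?nnegrE ?mulr_ge0 // ?(ltW (r0 N)) //; last by lra.
    rewrite exprMn exprMn.
    have h1 : (h t ^+ 2 * (dl * (r N / 2) ^+ 2) <= M)%R.
      by apply: le_trans ht; rewrite ler_wpM2l ?sqr_ge0 // ltW.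
    have h2 : (M = (D - 1) * dl)%R by rewrite /D addrK divfK // gt_eqF.
    have h3 : (h t ^+ 2 * r N ^+ 2 * dl <= 4 * (D - 1) * dl)%R.
      by move: h1; rewrite h2 expr_div_n; lra.
    move: h3; rewrite ler_pM2r // => h3; apply: le_trans h3 _; nra.
  move=> h1; apply: le_trans (leeD h1 IH) _; rewrite -EFinD lee_fin /c rS.
  have E : (2 * D / r N * (a + dl * r N ^+ 2 - (a + dl * (r N / 2) ^+ 2)) = 3 / 2 * (D * dl) * r N)%R.
    by field; rewrite gt_eqF.
  rewrite E; have : (0 < D * dl * r N)%R by rewrite !mulr_gt0 //; lra.
  lra.
have Dd : (0 < D * dl)%R by rewrite mulr_gt0 //; lra.
suff : L a b <= (4 * D * dl)%:E by move=> /le_lt_trans; apply; exact: ltry.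
rewrite leNgt; apply/negP => /(itvlen_exhaust_left ab)[x xab lx].
have e0 : (0 < (x - a) / dl)%R by rewrite divr_gt0 // subr_gt0; lra.
have [N hN] := half_pow_small e0.
have [_ hc] := claim N.
have : L x b <= L (c N) b.
  apply: itvlen_le => //; last by lra.
  rewrite /c.
  have : (dl * r N ^+ 2 <= x - a)%R; last by lra.
  move: hN; rewrite ltr_pdivlMr // -/(r N) => hN.
  by have := r1 N; have := r0 N; nra.
move=> /(lt_le_trans lx) /lt_le_trans/(_ hc); rewrite lte_fin.
by have := r0 N; nra.
Qed.

(** Where h >= m / (t - a), each of the infinitely many pieces between (b - a) / 2^(N+1)
and (b - a) / 2^N from a contributes at least m / 2. *)
Lemma itvlen_inf_left a b (m : R) : (a < b)%R -> (0 < m)%R ->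
  (forall t, (a < t < b)%R -> (m <= h t * (t - a))%R) -> L a b = +oo.
Proof.
move=> ab m0 hm; pose dl := (b - a)%R; have dl0 : (0 < dl)%R by rewrite subr_gt0.
pose r N : R := (2^-1 ^+ N)%R; have r0 N : (0 < r N)%R by rewrite exprn_gt0.
have rS N : r N.+1 = (r N / 2)%R by rewrite /r exprSr.
pose c N := (a + dl * r N)%R.
have ca N : (a < c N)%R by rewrite /c ltrDl mulr_gt0.
have claim N : (c N <= b)%R /\ (m / 2 * N%:R)%:E <= L (c N) b.
  elim: N => [|N [cb IH]].
    rewrite /c /r expr0 mulr1 /dl addrC subrK; split => //.
    by rewrite mulr0 (itvlen_ge0 HL).
  have cc : (c N.+1 <= c N)%R.
    by rewrite /c rS lerD2l ler_pM2l //; have := r0 N; lra.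
  split; first exact: le_trans cc cb.
  rewrite (itvlen_split HL cc cb).
  have : (m / (dl * r N) * (c N - c N.+1))%:E <= L (c N.+1) (c N).
    apply: (itvlen_lb HL) => //; first by rewrite divr_ge0 ?mulr_ge0 // ltW.
    move=> t /andP[t1 t2].
    have tab : (a < t < b)%R by have := ca N.+1; lra.
    rewrite ler_pdivrMr ?mulr_gt0 //; apply: le_trans (hm t tab) _.
    by rewrite ler_wpM2l //; move: t2; rewrite /c; lra.
  move=> h1; apply: le_trans (leeD h1 IH); rewrite -EFinD lee_fin /c rS -[N.+1%:R]natr1.
  have -> : (m / (dl * r N) * (a + dl * r N - (a + dl * (r N / 2))) = m / 2)%R.
    by field; rewrite !gt_eqF.
  lra.
apply/eqP; rewrite eq_le leey /= leNgt; apply/negP => hfin.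
have : L a b \is a fin_num by rewrite ge0_fin_numE // (itvlen_ge0 HL).
have hcN N : L (c N) b <= L a b.
  by apply: itvlen_le; [exact: ltW|by have [] := claim N|].
case: (L a b) hcN hfin => // l hl _ _.
have [N hN] : exists N : nat, (l < m / 2 * N%:R)%R.
  have m2 : (0 < m / 2)%R by lra.
  have l0 : (0 <= `|l| / (m / 2))%R by rewrite divr_ge0 // ltW.
  have /archi_boundP := l0; set n := Num.bound _ => hn; exists n.
  by move: hn; rewrite ltr_pdivrMr // mulrC; apply: le_lt_trans; exact: ler_norm.
have [_ h1] := claim N; have := le_trans h1 (hl N); rewrite lee_fin; lra.
Qed.


End Fixed.

End IntervalLength.

(** * Lengths along the circle *)

Section Density.
Context (R : realType).
Implicit Types (Q : qdiff R) (a b c d s t w : R) (z : R[i]).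

(** The factor |Q|^(1/2) at e^{it}, on the circle where |dz| = dt. *)
Definition density Q t : R := Num.sqrt (cabs (qeval Q (expi t))).

Lemma density_ge0 Q t : 0 <= density Q t.
Proof. exact: sqrtr_ge0. Qed.

Lemma sqr_density Q t : density Q t ^+ 2 = cabs (qeval Q (expi t)).
Proof. by rewrite sqr_sqrtr ?cabs_ge0. Qed.

Lemma continuous_path_real (u : R -> R) t :
  (forall e : R, 0 < e -> exists2 d : R, 0 < d & forall s, `|s - t| < d -> `|u s - u t| < e) ->
  {for t, continuous u}.
Proof.
move=> cu B [e /= /cu[d d0 dh] eB]; exists d => // s; rewrite /ball_ /= distrC => sd.
by apply: eB; rewrite /ball_ /= distrC; exact: dh.
Qed.

Lemma continuous_cabs_expi (f : R[i] -> R[i]) t : cont_within setT f (expi t) ->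
  {for t, continuous (fun s => cabs (f (expi s)))}.
Proof.
move=> cf; apply: continuous_path_real => e /cf[d d0 hd].
exists (d / 2); first by rewrite divr_gt0.
move=> s st; apply: le_lt_trans (hd (expi s) I _); last first.
  by apply: le_lt_trans (cabs_expiB_le s t) _; lra.
have := cabs_dist_le (f (expi s)) (f (expi t)); have := cabs_dist_le (f (expi t)) (f (expi s)).
by rewrite (cabs_distC (f (expi t))) ler_norml => h1 h2; lra.
Qed.

Lemma density_continuous Q t : ~~ pole Q (expi t) -> {for t, continuous (density Q)}.
Proof.
move=> np; have c := continuous_cabs_expi (@cont_within_qeval _ setT Q _ np).
by apply: (@continuous_comp _ _ _ (fun s => cabs (qeval Q (expi s))) Num.sqrt) => //; exact: sqrt_continuous.
Qed.

Lemma measurable_cabs_horner (P : {poly R[i]}) :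
  measurable_fun setT (fun t : R => cabs P.[expi t]).
Proof.
apply: continuous_measurable_fun => t.
by apply: (@continuous_cabs_expi (horner P)); exact: cont_within_horner.
Qed.

Lemma measurable_density Q : measurable_fun setT (density Q).
Proof.
have -> : density Q = (fun t => powR (cabs (qnum Q).[expi t] * powR (cabs (qden Q).[expi t]) (-1)) 2^-1).
  apply/funext => t; rewrite powR12_sqrt; last by rewrite mulr_ge0 ?cabs_ge0 ?powR_ge0.
  by rewrite powR_inv1 ?cabs_ge0 // -cabsV -cabsM.
apply: (measurableT_comp (measurable_powR _)).
apply: measurable_funM; first exact: measurable_cabs_horner.
by apply: (measurableT_comp (measurable_powR _)); exact: measurable_cabs_horner.
Qed.

Lemma qlengthE Q a b : qlength Q a b = oo_integral (density Q) a b.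
Proof. by []. Qed.

Lemma qlength_interval Q : interval_length (density Q) (qlength Q).
Proof.
have m := measurable_density Q; have p := density_ge0 Q; split.
- by move=> a b; exact: oo_integral_ge0.
- by move=> a c b; exact: oo_integral_split.
- by move=> a b M; exact: oo_integral_ub.
- by move=> a b M; exact: oo_integral_lb.
- by move=> a b l; exact: (oo_integral_exhaust m p).
- by move=> a b l; exact: (oo_integral_ivt m p).
Qed.

Lemma infinite_critical_pole Q z : infinite_critical Q z -> pole Q z.
Proof.
rewrite /infinite_critical /pole => h; apply: contraTT h => nr.
by rewrite mupNroot.
Qed.

Lemma critical_cases Q z : ~~ regular Q z -> finite_critical Q z \/ infinite_critical Q z.
Proof.
rewrite /regular negbK rootM /finite_critical /infinite_critical => /orP[->|]; first by left.
rewrite -dvdp_XsubCl XsubC_dvd ?qden_neq0 //.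
case: (mup z (qden Q)) => [//|[|n]] _; first by left; rewrite orbT.
by right.
Qed.

Lemma horner_bounded_near (P : {poly R[i]}) z : exists2 d : R, 0 < d &
  forall w : R[i], cabs (w - z) < d -> cabs P.[w] <= cabs P.[z] + 1.
Proof.
have [d d0 hd] := @cont_within_horner _ setT P z 1 ltr01; exists d => // w wz.
by have := hd w I wz; have := cabs_dist_le P.[w] P.[z]; lra.
Qed.

Lemma horner_bounded_below_near (P : {poly R[i]}) z : P.[z] != 0 -> exists2 d : R, 0 < d &
  forall w : R[i], cabs (w - z) < d -> cabs P.[z] / 2 <= cabs P.[w].
Proof.
rewrite -cabs_gt0 => P0; have P2 : 0 < cabs P.[z] / 2 by rewrite divr_gt0.
have [d d0 hd] := @cont_within_horner _ setT P z _ P2; exists d => // w wz.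
by have := hd w I wz; have := cabs_dist_le P.[z] P.[w]; rewrite cabs_distC; lra.
Qed.

(** The denominator vanishes at most to order one at e^{ia}, and chords are comparable
to arcs. *)
Lemma density_upper Q a : ~~ infinite_critical Q (expi a) ->
  exists d M : R, [/\ 0 < d, 0 <= M & forall t, `|t - a| < d -> t != a ->
    density Q t ^+ 2 * `|t - a| <= M].
Proof.
move=> ni; have [d3 d30 h3] := @cabs_expiB_ge R.
have [D [D0 hD]] : exists D : {poly R[i]}, ~~ root D (expi a) /\
    (qden Q = D \/ qden Q = D * ('X - (expi a)%:P)).
  have [r|nr] := boolP (root (qden Q) (expi a)); last by exists (qden Q); split=> //; left.
  have /factor_theorem[D DE] := r; exists D; split; last by right.
  apply: contra ni => /factor_theorem[D' D'E].
  rewrite /infinite_critical mup_geq ?qden_neq0 //.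
  by rewrite DE D'E -mulrA -expr2 dvdp_mulIr.
have [d1 d10 h1] := horner_bounded_near (qnum Q) (expi a).
have [d2 d20 h2] := horner_bounded_below_near D0.
set A := cabs (qnum Q).[expi a] + 1 in h1; set B := cabs D.[expi a] / 2 in h2.
have A0 : 0 < A by have := cabs_ge0 (qnum Q).[expi a]; rewrite /A; lra.
have B0 : 0 < B by rewrite /B divr_gt0 // cabs_gt0.
have K0 : 0 < 2 * A / B by rewrite divr_gt0 // mulr_gt0.
exists (Num.min 1 (Num.min d3 (Num.min (d1 / 2) (d2 / 2)))), (2 * A / B); split.
- by rewrite !lt_min ltr01 d30 !divr_gt0.
- exact: ltW.
move=> t; rewrite !lt_min => /and4P[t1 t3 td1 td2] ta.
have ta0 : 0 < `|t - a| by rewrite normr_gt0 subr_eq0.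
have e1 := cabs_expiB_le t a.
have n1 : cabs (qnum Q).[expi t] <= A by apply: h1; lra.
have n2 : B <= cabs D.[expi t] by apply: h2; lra.
have n3 := h3 t a t3.
rewrite sqr_density /qeval cabsM cabsV mulrAC.
have q0 : 0 < cabs (qden Q).[expi t].
  by case: hD => ->; rewrite ?hornerM ?hornerXsubC ?cabsM; [lra|apply: mulr_gt0; lra].
rewrite ler_pdivrMr //.
have AB : 2 * A / B * B = 2 * A by rewrite divfK // gt_eqF.
apply: (@le_trans _ _ (A * `|t - a|)); first by rewrite ler_wpM2r // ltW.
case: hD => ->.
  apply: (@le_trans _ _ (2 * A / B * B)); first by rewrite AB; nra.
  by rewrite ler_pM2l.
rewrite hornerM hornerXsubC cabsM.
apply: (@le_trans _ _ (2 * A / B * (B * (`|t - a| / 2)))); first by rewrite mulrA AB; lra.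
rewrite ler_pM2l //.
by apply: ler_pM => //; rewrite ?ltW //; lra.
Qed.

(** The denominator is divisible by the square of z - e^{ia}, and the numerator does not
vanish there since fractions are in lowest terms. *)
Lemma density_lower Q a : infinite_critical Q (expi a) ->
  exists d m : R, [/\ 0 < d, 0 < m & forall t, `|t - a| < d -> t != a -> ~~ pole Q (expi t) ->
    m <= density Q t * `|t - a|].
Proof.
move=> ic.
have [D DE] : exists D, qden Q = D * ('X - (expi a)%:P) ^+ 2.
  apply/dvdpP; rewrite -mup_geq ?qden_neq0 //; exact: ic.
have N0 : (qnum Q).[expi a] != 0.
  have := infinite_critical_pole ic; rewrite /pole.
  by have := q_coprime Q; rewrite coprimep_sym => /coprimep_root; apply.
have [d1 d10 h1] := horner_bounded_below_near N0.
have [d2 d20 h2] := horner_bounded_near D (expi a).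
set A := cabs (qnum Q).[expi a] / 2 in h1; set B := cabs D.[expi a] + 1 in h2.
have B0 : 0 < B by have := cabs_ge0 D.[expi a]; rewrite /B; lra.
have A0 : 0 < A by rewrite /A divr_gt0 // cabs_gt0.
exists (Num.min (d1 / 2) (d2 / 2)), (Num.sqrt (A / (4 * B))); split.
- by rewrite lt_min !divr_gt0.
- by rewrite sqrtr_gt0 divr_gt0 // mulr_gt0.
move=> t; rewrite lt_min => /andP[td1 td2] ta np.
have ta0 : 0 < `|t - a| by rewrite normr_gt0 subr_eq0.
have e1 := cabs_expiB_le t a.
have n1 : A <= cabs (qnum Q).[expi t] by apply: h1; lra.
have n2 : cabs D.[expi t] <= B by apply: h2; lra.
rewrite -(@ler_pXn2r _ 2) ?nnegrE ?mulr_ge0 ?sqrtr_ge0 //.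
have k0 : 0 <= A / (4 * B) by rewrite ltW // divr_gt0 // mulr_gt0.
rewrite exprMn sqr_density sqr_sqrtr //.
rewrite /qeval cabsM cabsV [leRHS]mulrAC.
have q0 : 0 < cabs (qden Q).[expi t] by rewrite cabs_gt0.
rewrite ler_pdivlMr // DE hornerM horner_exp hornerXsubC cabsM cabsX.
have AB : A / (4 * B) * (4 * B) = A by rewrite divfK // gt_eqF // mulr_gt0.
apply: (@le_trans _ _ (A / (4 * B) * (B * (2 * `|t - a|) ^+ 2))).
  apply: ler_wpM2l => //; apply: ler_pM; rewrite ?cabs_ge0 ?exprn_ge0 ?cabs_ge0 //.
  by rewrite ler_pXn2r // nnegrE ?cabs_ge0 // mulr_ge0.
have -> : A / (4 * B) * (B * (2 * `|t - a|) ^+ 2) = A / (4 * B) * (4 * B) * `|t - a| ^+ 2 by ring.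
by rewrite AB ler_wpM2r // sqr_ge0.
Qed.

Lemma qlength_fin_left Q a b : a < b -> ~~ infinite_critical Q (expi a) ->
  exists2 c, a < c < b & (qlength Q a c < +oo)%E.
Proof.
move=> ab /density_upper[d [M [d0 M0 hM]]].
have ba : 0 < (b - a) / 2 by rewrite divr_gt0 // subr_gt0.
have [t t0 [td tb]] := exists_small d0 ba.
exists (a + t); first by lra.
apply: (itvlen_fin_left (qlength_interval Q) (density_ge0 Q) _ M0); first by lra.
move=> u au; have ua : 0 < u - a by lra.
rewrite -(gtr0_norm ua); apply: hM; first by rewrite gtr0_norm //; lra.
by rewrite -subr_eq0 gt_eqF.
Qed.

Lemma qlength_fin_right Q a b : a < b -> ~~ infinite_critical Q (expi b) ->
  exists2 c, a < c < b & (qlength Q c b < +oo)%E.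
Proof.
move=> ab /density_upper[d [M [d0 M0 hM]]].
have ba : 0 < (b - a) / 2 by rewrite divr_gt0 // subr_gt0.
have [t t0 [td tb]] := exists_small d0 ba.
exists (b - t); first by lra.
have := @itvlen_fin_left _ _ _ (itvlen_opp (qlength_interval Q)) (fun t => density_ge0 Q (- t)) (- b) (- b + t) M.
rewrite opprK opprD opprK; apply=> //; first by lra.
move=> u au; have ua : 0 < u + b by lra.
have E : - u - b = - (u + b) by ring.
have -> : u + b = `|- u - b| by rewrite E normrN gtr0_norm.
apply: hM; first by rewrite E normrN gtr0_norm //; lra.
by rewrite -subr_eq0 E oppr_eq0 gt_eqF.
Qed.

Lemma qlength_fin_inner Q a b : a <= b -> (forall t, a <= t <= b -> ~~ pole Q (expi t)) ->
  (qlength Q a b < +oo)%E.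
Proof.
move=> ab np.
have [|c _ hc] := @EVT_max R (density Q) a b ab.
  apply: continuous_in_subspaceT => t; rewrite inE /= in_itv /= => tab.
  by apply: density_continuous; exact: np.
apply: le_lt_trans (ltry (density Q c * (b - a))).
apply: (itvlen_ub (qlength_interval Q)) => // t /andP[t1 t2].
by apply: hc; rewrite in_itv /=; lra.
Qed.

Lemma qlength_fin Q a b : a <= b -> (forall t, a < t < b -> ~~ pole Q (expi t)) ->
  ~~ infinite_critical Q (expi a) -> ~~ infinite_critical Q (expi b) ->
  (qlength Q a b < +oo)%E.
Proof.
have HL := qlength_interval Q.
rewrite le_eqVlt => /predU1P[->|ab] np na nb; first by rewrite (itvlen_xx HL) ltry.
have [c cab hc] := qlength_fin_left ab na.
have cb : c < b by lra.
have [d dcb hd] := qlength_fin_right cb nb.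
have [ac cd db] : [/\ a <= c, c <= d & d <= b] by split; lra.
rewrite (itvlen_split HL ac (le_trans cd db)) (itvlen_split HL cd db).
have hcd : (qlength Q c d < +oo)%E.
  by apply: qlength_fin_inner => // t tcd; apply: np; lra.
by apply: lte_add_pinfty => //; exact: lte_add_pinfty.
Qed.

Lemma qlength_inf_left Q a b : a < b -> (forall t, a < t < b -> ~~ pole Q (expi t)) ->
  infinite_critical Q (expi a) -> qlength Q a b = +oo%E.
Proof.
have HL := qlength_interval Q.
move=> ab np /density_lower[d [m [d0 m0 hm]]].
have ba : 0 < b - a by rewrite subr_gt0.
have [t t0 [td tb]] := exists_small d0 ba.
have E : qlength Q a (a + t) = +oo%E.
  apply: (itvlen_inf_left HL (density_ge0 Q) _ m0); first by lra.
  move=> u au; have ua : 0 < u - a by lra.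
  rewrite -(gtr0_norm ua); apply: hm; first by rewrite gtr0_norm //; lra.
    by rewrite -subr_eq0 gt_eqF.
  by apply: np; lra.
have [h1 h2] : a <= a + t /\ a + t <= b by split; lra.
have := itvlen_le HL (lexx a) h1 h2; rewrite E leye_eq => /eqP //.
Qed.

Lemma qlength_inf_right Q a b : a < b -> (forall t, a < t < b -> ~~ pole Q (expi t)) ->
  infinite_critical Q (expi b) -> qlength Q a b = +oo%E.
Proof.
have HL := qlength_interval Q.
move=> ab np /density_lower[d [m [d0 m0 hm]]].
have ba : 0 < b - a by rewrite subr_gt0.
have [t t0 [td tb]] := exists_small d0 ba.
have E : qlength Q (b - t) b = +oo%E.
  have := @itvlen_inf_left _ _ _ (itvlen_opp HL) (fun t => density_ge0 Q (- t)) (- b) (- b + t) m.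
  rewrite opprK opprD opprK; apply=> //; first by lra.
  move=> u au; have ua : 0 < u + b by lra.
  have E : - u - b = - (u + b) by ring.
  have -> : u + b = `|- u - b| by rewrite E normrN gtr0_norm.
  apply: hm; last by apply: np; lra.
  - by rewrite E normrN gtr0_norm //; lra.
  - by rewrite -subr_eq0 E oppr_eq0 gt_eqF.
have [h1 h2] : a <= b - t /\ b - t <= b by split; lra.
have := itvlen_le HL h1 h2 (lexx b); rewrite E leye_eq => /eqP //.
Qed.

Lemma qlength_gt0 Q a b : qnum Q != 0 -> a < b -> (0 < qlength Q a b)%E.
Proof.
move=> Q0 ab; have [S hS] := regular_seq Q0.
have [r r0 hr] := isolated_seq S (expi a).
have pi2 := pi_ge2 R.
have m0 : 0 < Num.min (r / 2) 1 by rewrite lt_min divr_gt0 ?ltr01.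
have ba : 0 < (b - a) / 2 by rewrite divr_gt0 // subr_gt0.
have [t t0 [tm tb]] := exists_small m0 ba.
move: tm; rewrite lt_min => /andP[tr t1].
have reg : regular Q (expi (a + t)).
  apply: hS; apply: hr.
    apply/eqP => E; have : a + t = a.
      by apply: expi_inj E; rewrite [a + t]addrC addrK gtr0_norm //; lra.
    lra.
  have := cabs_expiB_le (a + t) a; rewrite [a + t - a]addrC addKr gtr0_norm //; lra.
have /regularP[np q] := reg.
apply: (@oo_integral_gt0 _ _ (measurable_density Q) (density_ge0 Q) _ _ (a + t)); first by lra.
  exact: density_continuous.
by rewrite sqrtr_gt0 cabs_gt0.
Qed.

(** The intermediate value theorem, on ]w, c[ with c < b such that the length already
exceeds l: its length is finite even when that of ]w, b[ is not. *)
Lemma qlength_forward Q w b (l : R) : w <= b -> (forall t, w < t < b -> ~~ pole Q (expi t)) ->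
  ~~ infinite_critical Q (expi w) -> 0 <= l -> (l%:E < qlength Q w b)%E ->
  exists2 t, w <= t < b & qlength Q w t = l%:E.
Proof.
have HL := qlength_interval Q.
rewrite le_eqVlt => /predU1P[->|wb] np nw l0.
  by rewrite (itvlen_xx HL) lte_fin ltNge l0.
move=> /(itvlen_exhaust_right HL wb)[c cwb lc].
have fc : (qlength Q w c < +oo)%E.
  have nc : ~~ infinite_critical Q (expi c).
    by apply: contra (np c cwb); exact: infinite_critical_pole.
  by apply: (qlength_fin _ _ nw nc) => [|t ht]; [lra|apply: np; lra].
have [|||t tw tl] := @itvlen_ivt _ _ _ HL w c l.
- by lra.
- exact: fc.
- by rewrite lee_fin l0 ltW.
by exists t => //; lra.
Qed.

Lemma qlength_backward Q a w (l : R) : a <= w -> (forall t, a < t < w -> ~~ pole Q (expi t)) ->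
  ~~ infinite_critical Q (expi w) -> 0 <= l -> (l%:E < qlength Q a w)%E ->
  exists2 t, a < t <= w & qlength Q t w = l%:E.
Proof.
have HL := qlength_interval Q; have HL' := itvlen_opp HL.
rewrite le_eqVlt => /predU1P[->|aw] np nw l0.
  by rewrite (itvlen_xx HL) lte_fin ltNge l0.
move=> /(itvlen_exhaust_left HL aw)[c cwb lc].
have fc : (qlength Q c w < +oo)%E.
  have nc : ~~ infinite_critical Q (expi c).
    by apply: contra (np c cwb); exact: infinite_critical_pole.
  by apply: (qlength_fin _ _ nc nw) => [|t ht]; [lra|apply: np; lra].
have [|||t tw tl] := @itvlen_ivt _ _ _ HL' (- w) (- c) l.
- by lra.
- by rewrite !opprK.
- by rewrite !opprK lee_fin l0 ltW.
exists (- t); first by lra.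
by move: tl; rewrite opprK.
Qed.

Lemma density_periodic Q t (n : int) : density Q (t + n%:~R * (2 * pi)) = density Q t.
Proof. by rewrite /density expiD_2pi_int. Qed.

Lemma qlength_shift Q a b (n : int) : a <= b -> (forall t, ~~ pole Q (expi t)) ->
  qlength Q (a + n%:~R * (2 * pi)) (b + n%:~R * (2 * pi)) = qlength Q a b.
Proof.
move=> ab np; set k := n%:~R * _.
have m := measurable_density Q.
rewrite !qlengthE !(oo_integral_closed m _ _ true false).
have dE : derive1 (fun x : R => x + k) = cst 1.
  by apply/funext => x; rewrite derive1E derive_val addr0.
rewrite (@integration_by_substitution_increasing _ (fun x => x + k) (density Q) a b) //.
- by apply: eq_integral => x _; rewrite !fctE dE /= mulr1 /k density_periodic.
- by move=> x y _ _; rewrite ltrD2r.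
- by rewrite dE => x _; exact: cvg_cst.
- by rewrite dE; exact: is_cvg_cst.
- by rewrite dE; exact: is_cvg_cst.
- split => //.
  + by apply: cvgD; [exact: cvg_at_right_filter|exact: cvg_cst].
  + by apply: cvgD; [exact: cvg_at_left_filter|exact: cvg_cst].
- by apply: continuous_subspaceT => t; exact: density_continuous.
Qed.

(** Cut the turn at the multiple of 2 pi that it contains, and translate one piece by
2 pi. *)
Lemma qlength_full_turn Q a : (forall t, ~~ pole Q (expi t)) ->
  qlength Q a (a + 2 * pi) = qlength Q 0 (2 * pi).
Proof.
move=> np; have HL := qlength_interval Q.
have p0 : 0 < 2 * pi :> R by rewrite mulr_gt0 // pi_gt0.
pose n : int := Num.floor (a / (2 * pi)); pose k := n%:~R * (2 * pi) : R.
have [ka ak] : k <= a /\ a < k + 2 * pi.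
  have := floor_itv (a / (2 * pi)); rewrite -/n => /andP[].
  rewrite ler_pdivlMr // ltr_pdivrMr // intrD /k; move: (n%:~R : R) => q h1 h2; split; lra.
have -> : qlength Q 0 (2 * pi) = qlength Q k (k + 2 * pi).
  by have := qlength_shift n (ltW p0) np; rewrite add0r [2 * pi + _]addrC => ->.
rewrite (itvlen_split HL ka (ltW ak)).
have ak2 : k + 2 * pi <= a + 2 * pi by rewrite lerD2r.
rewrite (itvlen_split HL (ltW ak) ak2) addeC; congr (_ + _)%E.
by have := qlength_shift 1 ka np; rewrite mul1r => ->.
Qed.

End Density.

(** * Endpoints of the maximal arcs *)

Section Welding.
Context (R : realType).
Implicit Types (Q : qdiff R) (a b c d s t w : R) (z : R[i]).

Lemma circle_arc_nopole Q a b : max_signed_arc Q (circle_arc a b) ->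
  forall t, a < t < b -> ~~ pole Q (expi t).
Proof.
by move=> [[_ np _] _] t tab; apply: np; exists t => //; rewrite /= in_itv.
Qed.

Lemma ge0_limit (v : R[i]) :
  (forall e : R, 0 < e -> exists2 u : R[i], 0 <= u & cabs (v - u) < e) -> 0 <= v.
Proof.
move=> h; rewrite lecE /=; apply/andP; split.
  rewrite -normr_eq0 eq_le normr_ge0 andbT; apply/ler_addgt0Pr => e e0; rewrite add0r.
  have [u] := h e e0; rewrite lecE /= => /andP[/eqP u0 _] vu.
  have := Im_le_cabs (v - u); rewrite ImD.
  have -> : complex.Im (- u) = 0 by case: u u0 {vu} => x y /= ->; rewrite oppr0.
  by rewrite addr0; lra.
apply/ler_addgt0Pr => e e0; have [u] := h e e0.
rewrite lecE /= => /andP[_ u0] vu.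
have := Re_le_cabs (v - u); rewrite ReD ReN; have := ler_norm (complex.Re u - complex.Re v).
by rewrite distrC => h1 h2; lra.
Qed.

Lemma along_circle_cont Q z : ~~ pole Q z -> cont_within setT (along_circle Q) z.
Proof.
move=> np.
have := cont_withinM (@cont_within_cst _ setT (-1) z)
  (cont_withinM (cont_within_qeval setT np) (cont_withinXn 2 (@cont_within_id _ setT z))).
by congr cont_within; apply/funext => y; rewrite mulN1r.
Qed.

Lemma nonpos_opp Q A : nonpos_on Q A <-> forall z, A z -> 0 <= - along_circle Q z.
Proof. by split=> h z /h; rewrite oppr_ge0. Qed.

Lemma sign_at_end Q A p : ~~ pole Q (expi p) ->
  (forall e : R, 0 < e -> exists2 t, A (expi t) & `|t - p| < e) ->
  (nonneg_on Q A -> 0 <= along_circle Q (expi p)) /\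
  (nonpos_on Q A -> along_circle Q (expi p) <= 0).
Proof.
move=> np acc; have ap (e : R) : 0 < e -> exists2 z, A z & cabs (along_circle Q (expi p) - along_circle Q z) < e.
  move=> e0; have [d d0 hd] := along_circle_cont np e0.
  have d20 : 0 < d / 2 by rewrite divr_gt0.
  have [t At tp] := acc _ d20.
  exists (expi t) => //; rewrite cabs_distC; apply: hd => //.
  by apply: le_lt_trans (cabs_expiB_le t p) _; lra.
split=> [h|/nonpos_opp h]; last rewrite -oppr_ge0.
  by apply: ge0_limit => e /ap[z Az zp]; exists (along_circle Q z) => //; exact: h.
apply: ge0_limit => e /ap[z Az zp]; exists (- along_circle Q z); first exact: h.
by rewrite -opprD cabsN.
Qed.

Lemma circle_arc_approach a b p : a < b -> p = a \/ p = b -> forall e : R, 0 < e ->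
  exists2 t, circle_arc a b (expi t) & `|t - p| < e.
Proof.
move=> ab pe e e0; have ba : 0 < (b - a) / 2 by rewrite divr_gt0 // subr_gt0.
have [u u0 [ue ub]] := exists_small e0 ba.
case: pe => ->.
  exists (a + u); first by exists (a + u) => //; rewrite /= in_itv /=; lra.
  by rewrite [a + u]addrC addrK gtr0_norm.
exists (b - u); first by exists (b - u) => //; rewrite /= in_itv /=; lra.
by rewrite addrAC subrr sub0r normrN gtr0_norm.
Qed.

(** At a regular point the differential along the circle is nonzero, and its sign is
that of both adjacent arcs; so a set A consisting of these arcs and the point
would contradict maximality. *)
Lemma no_regular_junction Q a p b A : a < p -> p < b -> b <= p + 2 * pi ->
  max_signed_arc Q (circle_arc a p) -> max_signed_arc Q (circle_arc p b) ->
  is_open_arc A -> (forall z, A z -> [\/ circle_arc a p z, z = expi p | circle_arc p b z]) ->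
  circle_arc p b `<=` A -> A (expi p) -> ~ regular Q (expi p).
Proof.
move=> ap pb b2 Ml Mr oA Acov AR Ap reg; have /regularP[np q0] := reg.
have v0 : along_circle Q (expi p) != 0.
  by rewrite /along_circle oppr_eq0 mulf_neq0 // expf_neq0 // expi_neq0.
have [Lp Ln] := sign_at_end np (circle_arc_approach ap (or_intror erefl)).
have [Rp Rn] := sign_at_end np (circle_arc_approach pb (or_introl erefl)).
have [[_ npl sl] _] := Ml; have [[_ npr sr] maxr] := Mr.
have sA : signed_arc Q A.
  split => //.
    by move=> z /Acov[/npl|->|/npr].
  case: sl sr => [hl|hl] [hr|hr].
  - left => z /Acov[/hl//|->|/hr//]; exact: Lp.
  - by move: v0; rewrite eq_le Lp ?Rn.
  - by move: v0; rewrite eq_le Rp ?Ln.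
  - right => z /Acov[/hl//|->|/hr//]; exact: Ln.
have AE := maxr A sA AR; move: Ap; rewrite AE => -[t /=]; rewrite in_itv /= => tp E.
have : t = p by apply: expi_inj E; rewrite gtr0_norm; lra.
lra.
Qed.

Lemma circle_arc_shift a b : circle_arc (a + 2 * pi) (b + 2 * pi) = circle_arc a b :> set R[i].
Proof.
apply/seteqP; split=> [_ [t /= + <-]|_ [t /= + <-]]; rewrite in_itv /= => tab.
  exists (t - 2 * pi); first by rewrite /= in_itv /=; lra.
  by rewrite -expiD2pi subrK.
by exists (t + 2 * pi); [rewrite /= in_itv /=; lra|rewrite expiD2pi].
Qed.

Lemma enum_le Q k (z : nat -> R) i j : enumerates Q (Arcs k z) ->
  (i <= j)%N -> (j <= k)%N -> z i <= z j.
Proof.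
move=> [_ _ h].
elim: j => [|j IH]; first by rewrite leqn0 => /eqP ->.
rewrite leq_eqVlt => /predU1P[->//|ij] jk.
by apply: le_trans (IH ij (ltnW jk)) _; have [/ltW] := h j jk.
Qed.

Lemma arc_junction Q a p b : a < p -> p < b -> b <= a + 2 * pi ->
  max_signed_arc Q (circle_arc a p) -> max_signed_arc Q (circle_arc p b) -> ~ regular Q (expi p).
Proof.
move=> ap pb ba Ma Mb.
apply: (no_regular_junction (A := circle_arc a b) ap pb _ Ma Mb).
- by lra.
- by right; exists a, b; split => //; lra.
- move=> _ [t /= + <-]; rewrite in_itv /= => tab; have [tp|tp|->] := ltgtP t p.
  + by constructor 1; exists t => //; rewrite /= in_itv /=; lra.
  + by constructor 3; exists t => //; rewrite /= in_itv /=; lra.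
  + by constructor 2.
- by move=> _ [t /= + <-]; rewrite in_itv /= => tab; exists t => //; rewrite /= in_itv /=; lra.
- by exists p => //; rewrite /= in_itv /=; lra.
Qed.

(** With a single arc the two sides of p belong to the same arc, which could be
enlarged to the whole circle. *)
Lemma loop_junction Q p : max_signed_arc Q (circle_arc p (p + 2 * pi)) -> ~ regular Q (expi p).
Proof.
have p2 : 0 < 2 * pi :> R by rewrite mulr_gt0 // pi_gt0.
move=> M; have M' : max_signed_arc Q (circle_arc (p - 2 * pi) p).
  by rewrite -circle_arc_shift subrK.
apply: (no_regular_junction (A := circle R) _ _ _ M' M) => //; try lra.
- by left.
- move=> w; rewrite circleE => /(expi_onto p)[t tp <-].
  have [->|tn] := eqVneq t p; first by constructor 2.
  constructor 3; exists t => //; rewrite /= in_itv /=.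
  have : p < t by rewrite lt_neqAle eq_sym tn; lra.
  by lra.
- by move=> _ [t _ <-]; exact: circle_expi.
- exact: circle_expi.
Qed.

Lemma junction_critical Q k (z : nat -> R) j : enumerates Q (Arcs k z) ->
  (j <= k)%N -> ~~ regular Q (expi (z j)).
Proof.
move=> enum; have [k0 zk h] := enum.
wlog jk : j / (j < k)%N.
  move=> W; rewrite leq_eqVlt => /predU1P[->|jk]; last exact: W (ltnW jk).
  by rewrite zk expiD2pi; exact: W.
move=> _; apply/negP.
case: j jk => [|j] jk; last first.
  have [zl Ml] := h j (ltnW jk); have [zr Mr] := h j.+1 jk.
  apply: arc_junction zl zr _ Ml Mr.
  have := enum_le enum (leq0n j) (ltnW (ltnW jk)); have := enum_le enum jk (leqnn k); rewrite zk; lra.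
have [zr Mr] := h 0%N jk.
have kk : k = k.-1.+1 by rewrite prednK.
have kl : (k.-1 < k)%N by rewrite {2}kk.
have [zl Ml] := h k.-1 kl; rewrite -kk zk in zl Ml.
have [k1|k1] := posnP k.-1.
  by apply: loop_junction; rewrite k1 in Ml.
apply: (@arc_junction Q (z k.-1 - 2 * pi) _ (z 1%N)) => //.
- by lra.
- by have := enum_le enum k1 (ltnW kl); lra.
- by rewrite -circle_arc_shift subrK.
Qed.

Lemma enum_find Q k (z : nat -> R) s : enumerates Q (Arcs k z) -> z 0%N <= s < z 0%N + 2 * pi ->
  exists2 j, (j < k)%N & z j <= s < z j.+1.
Proof.
move=> [k0 zk h]; rewrite -zk => /andP[s0].
have : forall n, (n <= k)%N -> s < z n -> exists2 j, (j < n)%N & z j <= s < z j.+1.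
  elim=> [|n IH] nk sn; first by lra.
  have [zs|sz] := leP (z n) s; first by exists n => //; rewrite zs sn.
  by have [j jn zj] := IH (ltnW nk) sz; exists j => //; exact: ltnW.
by move=> /(_ k (leqnn k)) H /H.
Qed.

Lemma enum_infinite_next Q k (z : nat -> R) j : enumerates Q (Arcs k z) -> (j < k)%N ->
  infinite_critical Q (expi (z j.+1)) = infinite_critical Q (expi (z (if (j.+1 < k)%N then j.+1 else 0%N))).
Proof.
move=> [k0 zk h] jk; case: (ltnP j.+1 k) => kj; first by [].
have -> : j.+1 = k by apply/eqP; rewrite eqn_leq jk kj.
by rewrite zk expiD2pi.
Qed.

Lemma enum_nopole Q k (z : nat -> R) j t : enumerates Q (Arcs k z) ->
  (j < k)%N -> z j < t < z j.+1 -> ~~ pole Q (expi t).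
Proof. by move=> [_ _ h] jk; have [_ /circle_arc_nopole] := h j jk; apply. Qed.

Lemma nopole_not_infinite Q z : ~~ pole Q z -> ~~ infinite_critical Q z.
Proof. by apply: contra; exact: infinite_critical_pole. Qed.

Lemma symmetric_form_qnum_neq0 Q : has_symmetric_form Q -> qnum Q != 0.
Proof.
move=> [K [cs [ps [al [be [K0 _ _ _ E]]]]]]; apply/eqP => Q0.
have sP (ts : seq R) : symP ts != 0.
  rewrite /symP prodf_seq_neq0; apply/allP => t _ /=.
  by rewrite scaler_eq0 negb_or expi_neq0 polyXsubC_eq0.
have sB (us : seq R[i]) : symB us != 0.
  rewrite /symB prodf_seq_neq0; apply/allP => u _ /=.
  rewrite mulf_neq0 ?polyXsubC_eq0 //.
  apply/eqP => /(congr1 (fun p => p.[0])); rewrite !hornerE ?mulr0 ?subr0 => /eqP.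
  by rewrite oner_eq0.
have KX : K%:C%C *: (symP al * symB cs) != 0.
  rewrite scaler_eq0 negb_or mulf_neq0 // andbT.
  by apply: contraNneq K0 => /complexI ->.
by move: E; rewrite Q0 mul0r => /esym/eqP; rewrite mulf_eq0 (negbTE KX) (negbTE (qden_neq0 Q)).
Qed.

End Welding.

(** * Every point of the circle is identified with some point *)

Section WeldingTotal.
Context (R : realType).
Implicit Types (Q : qdiff R) (a b c d s t w : R) (z : R[i]).

Lemma ereal_real (x : \bar R) : (0 <= x)%E -> (x < +oo)%E -> exists2 l : R, 0 <= l & x = l%:E.
Proof.
move=> x0 xf; exists (fine x); first exact: fine_ge0.
by rewrite fineK // ge0_fin_numE.
Qed.

(** On the side of Qp only ]wb, b'[ needs to be long enough; it may have infinite
length. *)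
Lemma match_forward Qm Qp wa s b wb b' : wa <= s -> s < b ->
  (forall t, wa < t < b -> ~~ pole Qm (expi t)) ->
  (forall t, wb < t < b' -> ~~ pole Qp (expi t)) -> wb <= b' ->
  ~~ infinite_critical Qm (expi wa) -> ~~ infinite_critical Qp (expi wb) ->
  (qlength Qm wa s < qlength Qp wb b')%E ->
  exists2 t, wb <= t < b' & qlength Qm wa s = qlength Qp wb t.
Proof.
move=> was sb npm npp wbb na nb lt.
have f1 : (qlength Qm wa s < +oo)%E.
  move: was; rewrite le_eqVlt => /predU1P[<-|was].
    by rewrite (itvlen_xx (qlength_interval Qm)) ltry.
  apply: qlength_fin => [|t ht||]; [exact: ltW|by apply: npm; lra|exact: na|].
  by apply/nopole_not_infinite/npm; rewrite was sb.
have [l l0 lE] := ereal_real (itvlen_ge0 (qlength_interval Qm) wa s) f1; rewrite lE in lt *.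
have [t ht tl] := qlength_forward wbb npp nb l0 lt; by exists t.
Qed.

Lemma match_backward Qm Qp wa s a wb a' : a < s -> s <= wa ->
  (forall t, a < t < wa -> ~~ pole Qm (expi t)) ->
  (forall t, a' < t < wb -> ~~ pole Qp (expi t)) -> a' <= wb ->
  ~~ infinite_critical Qm (expi wa) -> ~~ infinite_critical Qp (expi wb) ->
  qlength Qp a' wb = +oo%E ->
  exists2 t, a' < t <= wb & qlength Qm s wa = qlength Qp t wb.
Proof.
move=> as_ swa npm npp wbb na nb inf.
have f1 : (qlength Qm s wa < +oo)%E.
  move: swa; rewrite le_eqVlt => /predU1P[->|swa].
    by rewrite (itvlen_xx (qlength_interval Qm)) ltry.
  apply: qlength_fin => [|t ht||]; [exact: ltW|by apply: npm; lra| |exact: na].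
  by apply/nopole_not_infinite/npm; rewrite as_ swa.
have [l l0 lE] := ereal_real (itvlen_ge0 (qlength_interval Qm) s wa) f1; rewrite lE.
have lt : (l%:E < qlength Qp a' wb)%E by rewrite inf ltry.
have [t ht tl] := qlength_backward wbb npp nb l0 lt; by exists t.
Qed.

Lemma welding_circle Qm Qp (wm wp : R) s : qnum Qm != 0 ->
  (forall t, ~~ pole Qm (expi t)) -> (forall t, ~~ pole Qp (expi t)) ->
  qlength Qm 0 (2 * pi) = qlength Qp 0 (2 * pi) -> wm < s < wm + 2 * pi ->
  exists2 t, wp < t < wp + 2 * pi & qlength Qm wm s = qlength Qp wp t.
Proof.
move=> Qm0 nm np L /andP[ws sp].
have Hm := qlength_interval Qm; have Hp := qlength_interval Qp.
have p2 : 0 < 2 * pi :> R by rewrite mulr_gt0 // pi_gt0.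
have f1 : (qlength Qm wm s < +oo)%E.
  by apply: qlength_fin_inner => [|t _]; [exact: ltW|exact: nm].
have [l l0 lE] := ereal_real (itvlen_ge0 Hm wm s) f1.
have wpp : wp <= wp + 2 * pi by lra.
have lt : (l%:E < qlength Qp wp (wp + 2 * pi))%E.
  rewrite (qlength_full_turn wp np) -L -(qlength_full_turn wm nm).
  rewrite (itvlen_split Hm (ltW ws) (ltW sp)) lE lteDl //.
  exact: qlength_gt0.
have [t /andP[wt tw] tl] := qlength_forward wpp (fun t _ => np t) (nopole_not_infinite (np wp)) l0 lt.
exists t; last by rewrite lE tl.
rewrite tw andbT lt_neqAle wt andbT; apply/eqP => tE.
by have := qlength_gt0 Qm0 ws; rewrite lE -tl -tE (itvlen_xx Hp) ltxx.
Qed.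

(** Finite lengths of corresponding arcs agree, and an endpoint is at infinite distance
in one arc exactly when its partner is in the other; so in each of the three
cases for the representatives the arc of Qp is long enough to contain the partner
of s. *)
Lemma welding_total (Qm Qp : qdiff R) (Em Ep : arc_enum R) (wm wp : nat -> R) :
  qnum Qm != 0 ->
  enumerates Qm Em -> enumerates Qp Ep -> coordinated Qm Qp Em Ep ->
  representatives Qm Em Ep wm wp ->
  forall z, circle R z -> exists s t, expi s = z /\
    identified_angles Qm Qp Em Ep wm wp s t.
Proof.
move=> Qm0.
have Hm := qlength_interval Qm.
case: Em => [|km zm]; case: Ep => [|kp zp] //= em ep.
  move=> [_ len] _ z; rewrite circleE => /(expi_onto (wm 0%N))[s sw <-].
  have [[_ nm _] _] := em; have [[_ np _] _] := ep.
  have nm' t : ~~ pole Qm (expi t) by apply: nm; exact: circle_expi.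
  have np' t : ~~ pole Qp (expi t) by apply: np; exact: circle_expi.
  have [->|sn] := eqVneq s (wm 0%N); first by exists (wm 0%N), (wp 0%N); split => //; left.
  have ws : wm 0%N < s < wm 0%N + 2 * pi.
    by rewrite lt_neqAle eq_sym sn; lra.
  have fm : (qlength Qm 0 (2 * pi) < +oo)%E.
    by apply: qlength_fin_inner => [|t _]; [rewrite mulr_ge0 // pi_ge0|exact: nm'].
  have fin : qlength Qm 0 (2 * pi) \is a fin_num by rewrite ge0_fin_numE // (itvlen_ge0 Hm).
  have [_ L] := len fin.
  have [t ht tl] := welding_circle (wp 0%N) Qm0 nm' np' L ws.
  by exists s, t; split => //; right.
move=> [kk co] rep z; subst kp.
rewrite circleE => /(expi_onto (zm 0%N))[s sw <-].
have [j jk sj] := enum_find em sw.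
have [->|sn] := eqVneq s (zm j).
  by exists (zm j), (zp j); split => //; exists j => //; constructor 1.
have zs : zm j < s by rewrite lt_neqAle eq_sym sn; lra.
have sz : s < zm j.+1 by lra.
have [k0 zkm hm] := em; have [_ zkp hp] := ep.
have [zm1 _] := hm j jk; have [zp1 _] := hp j jk.
have npm t : zm j < t < zm j.+1 -> ~~ pole Qm (expi t) by exact: enum_nopole em jk.
have npp t : zp j < t < zp j.+1 -> ~~ pole Qp (expi t) by exact: enum_nopole ep jk.
have [_ icj len] := co j jk.
have icj1 : infinite_critical Qm (expi (zm j.+1)) = infinite_critical Qp (expi (zp j.+1)).
  rewrite (enum_infinite_next em jk) (enum_infinite_next ep jk).
  case: (ltnP j.+1 km) => h; first by have [_ e _] := co _ h; exact: e.
  by have [_ e _] := co _ k0; exact: e.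
have [r1 r2 r3] := rep j jk.
have critm i : (i <= km)%N -> ~~ infinite_critical Qm (expi (zm i)) -> finite_critical Qm (expi (zm i)).
  move=> ik; have [fc _|ic] := critical_cases (junction_critical em ik); first exact: fc.
  by rewrite ic.
suff [t ht] : exists t, [\/ s = zm j /\ t = zp j, s = wm j /\ t = wp j,
   [/\ zm j < s <= wm j, zp j < t <= wp j & qlength Qm s (wm j) = qlength Qp t (wp j)]
   | [/\ wm j <= s < zm j.+1, wp j <= t < zp j.+1 & qlength Qm (wm j) s = qlength Qp (wp j) t]].
  by exists s, t; split => //; exists j.
(* the representative is the initial point *)
have [ic0|nic0] := boolP (infinite_critical Qm (expi (zm j))); last first.
  have [wmE wpE] := r1 (critm j (ltnW jk) nic0).
  have nic0' : ~~ infinite_critical Qp (expi (zp j)) by rewrite -icj.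
  have lt : (qlength Qm (zm j) s < qlength Qp (zp j) (zp j.+1))%E.
    have nis : ~~ infinite_critical Qm (expi s) by apply/nopole_not_infinite/npm; rewrite zs sz.
    have f1 : (qlength Qm (zm j) s < +oo)%E.
      by apply: qlength_fin => [|t ht||]; [exact: ltW|by apply: npm; lra|exact: nic0|exact: nis].
    have [ic1|nic1] := boolP (infinite_critical Qm (expi (zm j.+1))).
      by rewrite (qlength_inf_right zp1 npp) -?icj1.
    have f2 := qlength_fin (ltW zm1) npm nic0 nic1.
    have fin : qlength Qm (zm j) (zm j.+1) \is a fin_num by rewrite ge0_fin_numE // (itvlen_ge0 Hm).
    have [_ <-] := len fin.
    rewrite (itvlen_split Hm (ltW zs) (ltW sz)).
    have [l l0 ->] := ereal_real (itvlen_ge0 Hm (zm j) s) f1.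
    by rewrite lteDl //; exact: qlength_gt0.
  have [t ht tl] := match_forward (ltW zs) sz npm npp (ltW zp1) nic0 nic0' lt.
  by exists t; constructor 4; rewrite wmE wpE; split; rewrite ?(ltW zs) ?sz.
have ic0' : infinite_critical Qp (expi (zp j)) by rewrite -icj.
(* the representative is the terminal point *)
have [ic1|nic1] := boolP (infinite_critical Qm (expi (zm j.+1))); last first.
  have [wmE wpE] := r2 ic0 (critm j.+1 jk nic1).
  have nic1' : ~~ infinite_critical Qp (expi (zp j.+1)) by rewrite -icj1.
  have inf := qlength_inf_left zp1 npp ic0'.
  have [t ht tl] := match_backward zs (ltW sz) npm npp (ltW zp1) nic1 nic1' inf.
  by exists t; constructor 3; rewrite wmE wpE; split; rewrite ?(ltW sz) ?zs.
(* the representative is an inner point, at infinite distance from both ends *)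
have [/andP[m1 m2] /andP[q1 q2]] := r3 ic0 ic1.
have nwm : ~~ infinite_critical Qm (expi (wm j)) by apply/nopole_not_infinite/npm; rewrite m1 m2.
have nwp : ~~ infinite_critical Qp (expi (wp j)) by apply/nopole_not_infinite/npp; rewrite q1 q2.
have ic1' : infinite_critical Qp (expi (zp j.+1)) by rewrite -icj1.
have nppr t : wp j < t < zp j.+1 -> ~~ pole Qp (expi t) by move=> ht; apply: npp; lra.
have nppl t : zp j < t < wp j -> ~~ pole Qp (expi t) by move=> ht; apply: npp; lra.
have npmr t : wm j < t < zm j.+1 -> ~~ pole Qm (expi t) by move=> ht; apply: npm; lra.
have npml t : zm j < t < wm j -> ~~ pole Qm (expi t) by move=> ht; apply: npm; lra.
have [sle|sgt] := leP s (wm j).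
  have inf := qlength_inf_left q1 nppl ic0'.
  have [t ht tl] := match_backward zs sle npml nppl (ltW q1) nwm nwp inf.
  by exists t; constructor 3; split; rewrite ?zs ?sle.
have inf := qlength_inf_right q2 nppr ic1'.
have lt : (qlength Qm (wm j) s < qlength Qp (wp j) (zp j.+1))%E.
  rewrite inf; apply: qlength_fin => [|t ht||]; [exact: ltW|by apply: npm; lra|exact: nwm|].
  by apply/nopole_not_infinite/npm; rewrite zs sz.
have [t ht tl] := match_forward (ltW sgt) sz npmr nppr (ltW q2) nwm nwp lt.
by exists t; constructor 4; split; rewrite ?(ltW sgt) ?sz.
Qed.

End WeldingTotal.

Theorem theorem6 (R : realType) (Qm Qp : qdiff R)
    (sym_m : has_symmetric_form Qm) (sym_p : has_symmetric_form Qp)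
    (Em Ep : arc_enum R)
    (enum_m : enumerates Qm Em) (enum_p : enumerates Qp Ep)
    (coord : coordinated Qm Qp Em Ep)
    (wm wp : nat -> R) (reps : representatives Qm Em Ep wm wp)
    (Q1 Q2 : qdiff R) (G1 G2 : set R[i])
    (pair1 : welding_pair Qm Qp Em Ep wm wp Q1 G1)
    (pair2 : welding_pair Qm Qp Em Ep wm wp Q2 G2) :
  exists a b c d : R[i],
    [/\ a * d - b * c != 0,
        mobius a b c d @` (@of_plane R @` G1) = @of_plane R @` G2
      & is_pullback [set z | c * z + d != 0]
          (fun z => (a * z + b) / (c * z + d)) Q2 Q1].
Proof.
have Qm0 := symmetric_form_qnum_neq0 sym_m; have Qp0 := symmetric_form_qnum_neq0 sym_p.
have [jG1 _ [phim1 [phip1 [a1 pm1 pp1 w1]]]] := pair1.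
have [jG2 _ [phim2 [phip2 [a2 pm2 pp2 w2]]]] := pair2.
have weld z : circle R z -> exists2 w, circle R w & phim1 z = phip1 w /\ phim2 z = phip2 w.
  move=> /(welding_total Qm0 enum_m enum_p coord reps)[s [t [<- st]]].
  by exists (expi t); [exact: circle_expi|split; [exact: w1|exact: w2]].
have [a [b [a0 phiE GE]]] := welded_maps_affine Qm0 Qp0 jG1 jG2 a1 a2 pm1 pm2 pp1 pp2 weld.
have [[[_ im1 _] dm1] _ _ _ _] := a1.
have pb := pullback_affine Qm0 a0 im1 dm1 phiE pm1 pm2.
have affE : (fun z => (a * z + b) / (0 * z + 1)) = (fun z => a * z + b).
  by apply/funext => z; rewrite mul0r add0r divr1.
exists a, b, 0, 1; split.
- by rewrite mulr1 mulr0 subr0.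
- rewrite -GE; have M z : mobius a b 0 1 (of_plane z) = of_plane (a * z + b).
    by rewrite /mobius /of_plane /= mul0r add0r oner_eq0 divr1.
  apply/seteqP; split=> [_ [_ [z zG <-] <-]|_ [_ [z zG <-] <-]].
    by rewrite M; exists (a * z + b) => //; exists z.
  by exists (of_plane z); [exists z|rewrite M].
- by rewrite affE => z _; exact: pb.
Qed.
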